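(* Let $p$ be prime, $m\geq1$, and $R=\mathbb Z_{p^m}[\mathbb Z^D]$. (1) Every translation-invariant topological CSS code $(\varphi_X,\varphi_Z)$ over $R$ satisfies $\operatorname{grade}_R(E_X^\ell)>\ell$ for all $\ell\geq1$, where $E_X^\ell=\operatorname{Ext}_R^\ell(\overline{\operatorname{coker}\varphi_X},R)$. (2) A finitely generated $R$-module $E$ is realizable as the $j$-th superselection layer, for $j\geq1$, if and only if $\operatorname{grade}_R(E)>j$. (3) Moreover, when $\operatorname{grade}_R(E)>j$, for any free resolution $\cdots\to G_{j+1}\xrightarrow{\partial_{j+1}}G_j\xrightarrow{\partial_j}G_{j-1}\to\cdots\to G_0\to E\to0$ by finitely generated free $R$-modules, the maps $$\varphi_X:=\partial_j^\dagger\colon G_{j-1}^\dagger\to G_j^\dagger,\qquad \varphi_Z:=\partial_{j+1}\colon G_{j+1}\to G_j$$ define a topological CSS code realizing $E$ as the $j$-th superselection layer, for which $\operatorname{coker}\varphi_X$ admits a free resolution of length at most $j$. If $E\neq0$, the projective dimension of $\operatorname{coker}\varphi_X$ is exactly $j$.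
   Context: $R=\mathbb Z_{p^m}[\mathbb Z^D]=\mathbb Z_{p^m}[x_1^{\pm1},\dots,x_D^{\pm1}]$ with $\mathbb Z_{p^m}$-linear involution $\overline{x^{\mathbf v}}=x^{-\mathbf v}$. For an $R$-module $M$, $\overline M$ is the same abelian group with action $r\ast m=\overline r\,m$, and $M^\dagger=\operatorname{Hom}_R(\overline M,R)$; on maps, $\dagger$ is the induced dual, which for matrices is the conjugate transpose $\varphi^\dagger=\overline\varphi^{\mathsf T}$. For finite-rank free $F$, $F^{\dagger\dagger}=F$ canonically. A translation-invariant CSS code over $R$ is a pair of $R$-linear maps $\varphi_X:G_X\to P$, $\varphi_Z:G_Z\to P^\dagger$ of finite-rank free modules (equivalently matrices $\varphi_X\in M_{q\times a}(R)$, $\varphi_Z\in M_{q\times b}(R)$) with $\varphi_X^\dagger\varphi_Z=0$. It is topological if $\operatorname{im}\varphi_X=\ker\varphi_Z^\dagger$ and $\operatorname{im}\varphi_Z=\ker\varphi_X^\dagger$. For a finitely generated $R$-module $E$, $\operatorname{grade}_R(E)=\inf\{i\ge0:\operatorname{Ext}_R^i(E,R)\neq0\}$, with $\operatorname{grade}_R(0)=\infty$. $E$ is realizable as the $j$-th superselection layer if there is a translation-invariant topological CSS code over $R$ with $\operatorname{Ext}_R^j(\overline{\operatorname{coker}\varphi_X},R)\cong_R E$ and $\operatorname{Ext}_R^\ell(\overline{\operatorname{coker}\varphi_X},R)=0$ for all $\ell>0$, $\ell\ne j$; such a code is said to realize $E$ as the $j$-th superselection layer. *)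

(* Defs.v *)
From HB Require Import structures.
From mathcomp Require Import all_boot all_order all_algebra finmap.
From mathcomp Require Import generic_quotient ring_quotient.
From mathcomp Require Import boolp functions.
From mathcomp.multinomials Require Import monalg.

Set Implicit Arguments.
Unset Strict Implicit.
Unset Printing Implicit Defensive.

Import GRing.Theory.

Local Open Scope ring_scope.
Local Open Scope quotient_scope.

HB.mixin Record hasInvolution R of GRing.ComNzRing R := {
  bar : {rmorphism R -> R};
  barK : involutive bar
}.

#[short(type="invRingType")]
HB.structure Definition InvRing := {R of GRing.ComNzRing R & hasInvolution R}.

(* The free A-module on G with the convolution product.  The ring structure
   that monalg puts on {malg A[K]} is not usable here: it requires a monoid of
   exponents whose only invertible element is the neutral one. *)
Definition group_algebra (A : nzRingType) (G : zmodType) : Type := {malg A[G]}.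

Section GroupAlgebra.
Context (A : nzRingType) (G : zmodType).
Local Notation AG := (group_algebra A G).
Implicit Types (g h : AG) (k l : G).

HB.instance Definition _ := GRing.Lmodule.on AG.

Definition ga_one : AG := << 0 >>.

Definition ga_mul g h : AG :=
  \sum_(k <- msupp g) \sum_(l <- msupp h) << g@_k * h@_l *g k + l >>.

Lemma ga_mulw (d1 d2 : {fset G}) g h :
  (msupp g `<=` d1)%fset -> (msupp h `<=` d2)%fset ->
  ga_mul g h = \sum_(k <- d1) \sum_(l <- d2) << g@_k * h@_l *g k + l >>.
Proof.
move=> le_d1 le_d2; rewrite /ga_mul (big_fset_incl _ le_d1) /=.
  apply/eq_bigr=> k1 _; apply/big_fset_incl => // k _ /mcoeff_outdom ->.
  by rewrite mulr0 monalgU0.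
move=> k _ /mcoeff_outdom g1k.
by rewrite big1 => // k' _; rewrite g1k mul0r monalgU0.
Qed.

Lemma ga_mul0g : left_zero 0 ga_mul.
Proof. by move=> g; rewrite /ga_mul msupp0 big_seq_fset0. Qed.

Lemma ga_mulg0 : right_zero 0 ga_mul.
Proof.
by move=> g; rewrite /ga_mul big1 // => k _; rewrite msupp0 big_seq_fset0.
Qed.

Lemma ga_mulUg c k g :
  ga_mul << c *g k >> g = \sum_(l <- msupp g) << c * g@_l *g k + l >>.
Proof.
rewrite (ga_mulw msuppU_le (fsubset_refl _)) big_seq_fset1.
by apply/eq_bigr => l _; rewrite mcoeffUU.
Qed.

Lemma ga_mulgU c k g :
  ga_mul g << c *g k >> = \sum_(l <- msupp g) << g@_l * c *g l + k >>.
Proof.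
rewrite (ga_mulw (fsubset_refl _) msuppU_le).
by apply/eq_bigr=> l _; rewrite big_seq_fset1 mcoeffUU.
Qed.

Lemma ga_mulUU c1 c2 k1 k2 :
  ga_mul << c1 *g k1 >> << c2 *g k2 >> = << c1 * c2 *g k1 + k2 >>.
Proof. by rewrite (ga_mulw msuppU_le msuppU_le) !big_seq_fset1 !mcoeffUU. Qed.

Lemma ga_mulDl : left_distributive ga_mul +%R.
Proof.
move=> g1 g2 g.
rewrite [in RHS](ga_mulw (fsubsetUl _ (msupp g2)) (fsubset_refl (msupp g))).
rewrite [in RHS](ga_mulw (fsubsetUr (msupp g1) _) (fsubset_refl (msupp g))).
rewrite (ga_mulw (msuppD_le _ _) (fsubset_refl (msupp g))).
rewrite -big_split /=; apply/eq_bigr=> k1 _.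
rewrite -big_split /=; apply/eq_bigr=> k2 _.
by rewrite mcoeffD mulrDl monalgUD.
Qed.

Lemma ga_mulDr : right_distributive ga_mul +%R.
Proof.
move=> g g1 g2.
rewrite [in RHS](ga_mulw (fsubset_refl (msupp g)) (fsubsetUl _ (msupp g2))).
rewrite [in RHS](ga_mulw (fsubset_refl (msupp g)) (fsubsetUr (msupp g1) _)).
rewrite (ga_mulw (fsubset_refl (msupp g)) (msuppD_le _ _)).
rewrite -big_split /=; apply/eq_bigr => k1 _.
rewrite -big_split /=; apply/eq_bigr => k2 _.
by rewrite mcoeffD mulrDr monalgUD.
Qed.

Lemma ga_mul_suml I (r : seq I) (F : I -> AG) h :
  ga_mul (\sum_(i <- r) F i) h = \sum_(i <- r) ga_mul (F i) h.
Proof.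
exact: (big_morph (ga_mul^~ h) (fun _ _ => ga_mulDl _ _ _) (ga_mul0g _)).
Qed.

Lemma ga_mul_sumr I (r : seq I) (F : I -> AG) g :
  ga_mul g (\sum_(i <- r) F i) = \sum_(i <- r) ga_mul g (F i).
Proof.
exact: (big_morph (ga_mul g) (fun _ _ => ga_mulDr _ _ _) (ga_mulg0 _)).
Qed.

Lemma ga_ind (P : AG -> Prop) :
  (forall c k, P << c *g k >>) -> (forall g h, P g -> P h -> P (g + h)) ->
  forall g, P g.
Proof.
move=> PU PD g; rewrite [g]monalgE; elim: (enum_fset _) => [|k r IH].
  by rewrite big_nil -(monalgU0 (G := A) (0 : G)); apply: PU.
by rewrite big_cons; apply: PD.
Qed.

Lemma ga_mul1g : left_id ga_one ga_mul.
Proof.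
move=> g; rewrite /ga_one ga_mulUg [RHS]monalgE.
by apply/eq_bigr=> k _; rewrite mul1r add0r.
Qed.

Lemma ga_mulg1 : right_id ga_one ga_mul.
Proof.
move=> g; rewrite /ga_one ga_mulgU [RHS]monalgE.
by apply/eq_bigr=> k _; rewrite mulr1 addr0.
Qed.

Lemma ga_mulA : associative ga_mul.
Proof.
elim/ga_ind=> [c1 k1|g g' IH IH'] g2 g3; last by rewrite !ga_mulDl IH IH'.
elim/ga_ind: g2 g3 => [c2 k2|g g' IH IH'] g3; last first.
  by rewrite ga_mulDl !ga_mulDr ga_mulDl IH IH'.
elim/ga_ind: g3 => [c3 k3|g g' IH IH']; last by rewrite !ga_mulDr IH IH'.
by rewrite !ga_mulUU mulrA addrA.
Qed.

Lemma ga_one_neq0 : ga_one != 0.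
Proof. by rewrite /ga_one monalgU_eq0 oner_eq0. Qed.

HB.instance Definition _ := GRing.Zmodule_isNzRing.Build AG
  ga_mulA ga_mul1g ga_mulg1 ga_mulDl ga_mulDr ga_one_neq0.

Lemma ga_coeff_sum I (r : seq I) (F : I -> AG) k :
  (\sum_(i <- r) F i)@_k = \sum_(i <- r) (F i)@_k.
Proof. exact: (raddf_sum (mcoeff k)). Qed.

(* x^v |-> x^(-v), A-linearly *)
Definition ga_conj g : AG := \sum_(k <- msupp g) << g@_k *g - k >>.

Lemma ga_conjE g k : (ga_conj g)@_k = g@_(- k).
Proof.
have -> : g@_(- k) = \sum_(l <- msupp g) << g@_l *g l >>@_(- k).
  by rewrite [in LHS](monalgE (g : {malg A[G]})) raddf_sum.
rewrite /ga_conj ga_coeff_sum; by apply: eq_bigr => l _; rewrite !mcoeffU eqr_oppLR.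
Qed.

Lemma ga_conjU c k : ga_conj << c *g k >> = << c *g - k >>.
Proof. by apply/malgP=> l; rewrite ga_conjE !mcoeffU eqr_oppLR. Qed.

Lemma ga_conjK : involutive ga_conj.
Proof. by move=> g; apply/malgP=> k; rewrite !ga_conjE opprK. Qed.

Lemma ga_conj_linear : linear ga_conj.
Proof.
move=> a g h; apply/malgP=> k.
by rewrite ga_conjE !mcoeffD !mcoeffZ !ga_conjE.
Qed.

HB.instance Definition _ := GRing.isLinear.Build A AG AG _ ga_conj
  ga_conj_linear.

Lemma ga_conj_monoid_morphism : monoid_morphism ga_conj.
Proof.
split=> [|g h]; first by rewrite [LHS]ga_conjU oppr0.
elim/ga_ind: g h => [c k|g g' IH IH'] h; last by rewrite mulrDl !raddfD /= mulrDl IH IH'.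
elim/ga_ind: h => [d l|h h' IH IH']; last by rewrite mulrDr !raddfD /= mulrDr IH IH'.
by rewrite [LHS](congr1 ga_conj (ga_mulUU _ _ _ _)) !ga_conjU [RHS]ga_mulUU opprD.
Qed.

HB.instance Definition _ := GRing.isMonoidMorphism.Build AG AG ga_conj
  ga_conj_monoid_morphism.

End GroupAlgebra.

Section ComGroupAlgebra.
Context (A : comNzRingType) (G : zmodType).

Lemma ga_mulC : commutative (@ga_mul A G).
Proof.
elim/ga_ind=> [c k|g g' IH IH'] h; last by rewrite ga_mulDl ga_mulDr IH IH'.
elim/ga_ind: h => [d l|h h' IH IH']; last by rewrite ga_mulDl ga_mulDr IH IH'.
by rewrite !ga_mulUU mulrC addrC.
Qed.

HB.instance Definition _ :=
  GRing.PzRing_hasCommutativeMul.Build (group_algebra A G) ga_mulC.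

HB.instance Definition _ := hasInvolution.Build (group_algebra A G)
  (@ga_conjK A G : involutive (@ga_conj A G : {rmorphism _ -> _})).
End ComGroupAlgebra.

Definition laurent (p m D : nat) : invRingType :=
  group_algebra 'Z_(p ^ m) 'rV[int]_D.

Section Modules.
Context {R : comNzRingType}.
Implicit Types (U V W M N : lmodType R).

Definition zero_module M := forall x : M, x = 0.

Definition isomorphic M N := exists f : {linear M -> N}, bijective f.

Definition surjective U V (f : U -> V) := forall y, exists x, f x = y.

Definition exact_at U V W (f : U -> V) (g : V -> W) :=
  forall y, g y = 0 <-> exists x, f x = y.

Definition finitely_generated M :=
  exists n (f : {linear 'rV[R]_n -> M}), surjective f.

Definition finite_free M := exists n, isomorphic 'rV[R]_n M.

Definition free_module M := exists K : choiceType, isomorphic {malg R[K]} M.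

Definition projective M :=
  forall V W (g : {linear V -> W}) (f : {linear M -> W}), surjective g ->
  exists h : {linear M -> V}, forall x, g (h x) = f x.

Section Submodule.
Context {V} (S : submodClosed V).

Record submodule := Submodule { submodule_val :> V; _ : submodule_val \in S }.
HB.instance Definition _ := [isSub for submodule_val].
HB.instance Definition _ := [Choice of submodule by <:].
HB.instance Definition _ := [SubChoice_isSubLmodule of submodule by <:].

(* S again; submodClosed does not record the closure under opposites that
   Quotient.quot requires *)
Definition submodule_pred : pred V := fun x => x \in S.

Lemma submodule_pred_closed : zmod_closed submodule_pred.
Proof.
split=> [|x y Sx Sy]; first exact: (rpred0 S).
by rewrite unfold_in /submodule_pred -scaleN1r rpredD ?rpredZ.
Qed.

HB.instance Definition _ :=
  GRing.isZmodClosed.Build V submodule_pred submodule_pred_closed.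

Definition quot_module : Type :=
  Quotient.quot (GRing.ZmodClosed.clone V submodule_pred _).
HB.instance Definition _ := GRing.Zmodule.on quot_module.
HB.instance Definition _ := EqQuotient.on quot_module.

Definition quotient_scale (a : R) (x : quot_module) : quot_module :=
  \pi_quot_module (a *: repr x).

Lemma quotient_eqP (x y : V) :
  reflect (\pi_quot_module x = \pi_quot_module y) (x - y \in S).
Proof.
rewrite -[x - y \in S]/(x - y \in submodule_pred) Quotient.idealrBE.
exact: eqP.
Qed.

Lemma quotient_piD (x y : V) :
  \pi_quot_module (x + y) = \pi_quot_module x + \pi_quot_module y.
Proof. exact: Quotient.pi_add. Qed.

Lemma quotient_piZ a (x : V) :
  quotient_scale a (\pi_quot_module x) = \pi_quot_module (a *: x).
Proof.
apply/quotient_eqP; rewrite -scalerBr; apply: rpredZ.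
by apply/quotient_eqP; rewrite reprK.
Qed.

Lemma quotient_scaleA a b (x : quot_module) :
  quotient_scale a (quotient_scale b x) = quotient_scale (a * b) x.
Proof.
by rewrite -[x]reprK (quotient_piZ b) (quotient_piZ a) quotient_piZ scalerA.
Qed.

Lemma quotient_scale1 : left_id 1 quotient_scale.
Proof. by move=> x; rewrite -[x]reprK quotient_piZ scale1r. Qed.

Lemma quotient_scaleDr : right_distributive quotient_scale +%R.
Proof.
move=> a x y; rewrite -[x]reprK -[y]reprK.
by rewrite -quotient_piD !quotient_piZ -quotient_piD scalerDr.
Qed.

Lemma quotient_scaleDl (x : quot_module) :
  {morph quotient_scale^~ x : a b / a + b}.
Proof.
move=> a b; rewrite -[x]reprK.
by rewrite !quotient_piZ -quotient_piD scalerDl.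
Qed.

HB.instance Definition _ := GRing.Zmodule_isLmodule.Build R quot_module
  quotient_scaleA quotient_scale1 quotient_scaleDr quotient_scaleDl.

End Submodule.

Section KernelImage.
Context {U V} (f : {linear U -> V}).

Definition in_ker : pred U := fun x => f x == 0.
Definition in_im : pred V := fun y => `[< exists x, f x = y >].

Lemma ker_closed : subsemimod_closed in_ker.
Proof.
split; first split.
- by rewrite /in_ker unfold_in linear0.
- by move=> x y /eqP fx /eqP fy; rewrite unfold_in /in_ker linearD fx fy addr0.
- by move=> a x /eqP fx; rewrite unfold_in /in_ker linearZ_LR fx scaler0.
Qed.

Lemma im_closed : subsemimod_closed in_im.
Proof.
split; first split.
- by apply/asboolP; exists 0; rewrite linear0.
- move=> _ _ /asboolP[x <-] /asboolP[y <-].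
  by apply/asboolP; exists (x + y); rewrite linearD.
- by move=> a _ /asboolP[x <-]; apply/asboolP; exists (a *: x); rewrite linearZ_LR.
Qed.

HB.instance Definition _ := GRing.isSubmodClosed.Build R U in_ker ker_closed.
HB.instance Definition _ := GRing.isSubmodClosed.Build R V in_im im_closed.

Definition kernel : lmodType R :=
  submodule (GRing.SubmodClosed.clone R U in_ker _).
Definition coker : lmodType R :=
  quot_module (GRing.SubmodClosed.clone R V in_im _).

End KernelImage.

Section Hom.
Context (M N : lmodType R).

Definition is_linear : pred (M -> N) := fun f => `[< linear f >].

Lemma is_linear_closed : subsemimod_closed is_linear.
Proof.
split; first split.
- by apply/asboolP=> a x y; rewrite -[RHS]/(a *: 0 + 0) scaler0 addr0.
- move=> f g /asboolP lf /asboolP lg; apply/asboolP=> a x y.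
  by rewrite -![(f + g) _]/(f _ + g _) lf lg scalerDr addrACA.
- move=> b f /asboolP lf; apply/asboolP=> a x y.
  by rewrite -![(b *: f) _]/(b *: f _) lf scalerDr !scalerA mulrC.
Qed.

HB.instance Definition _ :=
  GRing.isSubmodClosed.Build R (M -> N) is_linear is_linear_closed.

Record hom_module := Hom { hom_val :> M -> N; _ : hom_val \in is_linear }.
HB.instance Definition _ := [isSub for hom_val].
HB.instance Definition _ := [Choice of hom_module by <:].
HB.instance Definition _ := [SubChoice_isSubLmodule of hom_module by <:].

Lemma hom_linear (f : hom_module) : linear f.
Proof. by case: f => f /= /asboolP. Qed.

HB.instance Definition _ (f : hom_module) :=
  GRing.isLinear.Build R M N _ (hom_val f) (hom_linear f).

Lemma linear_in_hom (f : {linear M -> N}) : (f : M -> N) \in is_linear.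
Proof. by apply/asboolP=> a x y; rewrite linearP. Qed.

Definition to_hom (f : {linear M -> N}) : hom_module := Hom (linear_in_hom f).

End Hom.

Section Precomposition.
Context {U V} (f : {linear U -> V}) (N : lmodType R).

Definition precomp (h : hom_module V N) : hom_module U N := to_hom (h \o f).

Lemma precomp_linear : linear precomp.
Proof. by move=> a h k; apply/val_inj. Qed.

HB.instance Definition _ :=
  GRing.isLinear.Build R (hom_module V N) (hom_module U N) _ precomp precomp_linear.

End Precomposition.
Arguments precomp {U V} f N h.

Record resolution M := Resolution {
  res_obj :> nat -> lmodType R;
  res_d : forall i, {linear res_obj i.+1 -> res_obj i};
  res_aug : {linear res_obj 0 -> M};
  res_aug_surj : surjective res_aug;
  res_exact0 : exact_at (res_d 0) res_aug;
  res_exactS : forall i, exact_at (res_d i.+1) (res_d i)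
}.

Definition length_le M (F : resolution M) (n : nat) :=
  forall i, (n < i)%N -> zero_module (F i).

Section StandardResolution.

(* the canonical surjection onto M of the free module on the set M *)
Definition free_cover M (g : {malg R[M]}) : M := \sum_(x <- msupp g) g@_x *: x.

Lemma free_coverw M (d : {fset M}) (g : {malg R[M]}) :
  (msupp g `<=` d)%fset -> free_cover g = \sum_(x <- d) g@_x *: x.
Proof.
move=> le_d; apply: big_fset_incl => // x _ /mcoeff_outdom ->.
by rewrite scale0r.
Qed.

Lemma free_cover_linear M : linear (@free_cover M).
Proof.
move=> a g h; pose d := (msupp g `|` msupp h `|` msupp (a *: g + h))%fset.
rewrite (@free_coverw _ d) ?fsubsetUr // (@free_coverw _ d g); last first.
  by rewrite /d -fsetUA fsubsetUl.
rewrite (@free_coverw _ d h); last first.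
  by rewrite /d [X in (X `|` _)%fset]fsetUC -fsetUA fsubsetUl.
rewrite scaler_sumr -big_split; apply: eq_bigr => x _ /=.
by rewrite mcoeffD mcoeffZ scalerDl scalerA.
Qed.

HB.instance Definition _ M :=
  GRing.isLinear.Build R {malg R[M]} M _ (@free_cover M) (@free_cover_linear M).

Lemma free_cover_surj M : surjective (@free_cover M).
Proof.
move=> x; exists << x >>.
by rewrite (free_coverw msuppU_le) big_seq_fset1 mcoeffUU scale1r.
Qed.

Context (M : lmodType R).

Fixpoint std_syzygy (i : nat) : lmodType R :=
  if i is i'.+1 then kernel (@free_cover (std_syzygy i')) else M.

Definition std_obj (i : nat) : lmodType R := {malg R[std_syzygy i]}.

Definition std_d (i : nat) : {linear std_obj i.+1 -> std_obj i} :=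
  (val : std_syzygy i.+1 -> std_obj i) \o @free_cover (std_syzygy i.+1).

Lemma std_exact i : exact_at (std_d i) (@free_cover (std_syzygy i)).
Proof.
move=> y; split=> [y0|[x <-]]; last first.
  by rewrite /std_d /=; apply/eqP; case: (free_cover x).
have yK : y \in in_ker (@free_cover (std_syzygy i)) by apply/eqP.
have [x ex] := free_cover_surj (Submodule yK : std_syzygy i.+1).
by exists x; rewrite /std_d /= ex.
Qed.

Lemma std_exactS i : exact_at (std_d i.+1) (std_d i).
Proof.
move=> y; split=> [y0|/(@std_exact i.+1 y) y0].
  by apply/(@std_exact i.+1 y)/val_inj.
by rewrite /std_d /= y0.
Qed.

Definition std_resolution : resolution M :=
  @Resolution M std_obj std_d (@free_cover M)
    (@free_cover_surj M) (@std_exact 0) std_exactS.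

End StandardResolution.

Section Cohomology.
Context {M} (F : resolution M) (N : lmodType R).

(* only 0 is a coboundary in degree 0 *)
Definition coboundary (i : nat) : pred (hom_module (F i) N) :=
  if i is i'.+1 then in_im (precomp (res_d F i') N) else pred1 0.

Definition cocycles (i : nat) : lmodType R := kernel (precomp (res_d F i) N).

Definition is_coboundary (i : nat) : pred (cocycles i) :=
  fun z => @coboundary i (val z).

Lemma is_coboundary_closed i : subsemimod_closed (@is_coboundary i).
Proof.
suff [[c0 cD] cZ] : subsemimod_closed (@coboundary i).
  split; first split.
  - exact: c0.
  - by move=> x y; apply: cD.
  - by move=> a x; apply: cZ.
case: i => [|i]; last exact: im_closed.
split; first split.
- by rewrite inE.
- by move=> x y /eqP-> /eqP->; rewrite addr0 inE.
- by move=> a x /eqP->; rewrite scaler0 inE.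
Qed.

HB.instance Definition _ i := GRing.isSubmodClosed.Build R (cocycles i)
  (@is_coboundary i) (@is_coboundary_closed i).

Definition cohomology (i : nat) : lmodType R := 
  quot_module (GRing.SubmodClosed.clone R (cocycles i) (@is_coboundary i) _).

End Cohomology.

Definition Ext (i : nat) M N : lmodType R := cohomology (std_resolution M) N i.

(* infimum of a set of natural numbers, None standing for infinity *)
Definition inf_nat (P : nat -> Prop) : option nat :=
  if pselect (exists n, `[< P n >]) is left exP then Some (ex_minn exP) else None.

Definition ltn_inf (n : nat) (x : option nat) : bool :=
  if x is Some k then (n < k)%N else true.

Definition grade M : option nat :=
  inf_nat (fun i => ~ zero_module (Ext i M R^o)).

(* None stands for infinity; by this definition the zero module has
   projective dimension 0 *)
Definition proj_dim M : option nat :=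
  inf_nat (fun n => exists F : resolution M,
    (forall i, projective (F i)) /\ length_le F n).

(* restriction of scalars along s: same group, with action r * x = s r *: x *)
Definition twist (s : {rmorphism R -> R}) M : Type := M.

Section Twist.
Context (s : {rmorphism R -> R}) (M : lmodType R).

HB.instance Definition _ := GRing.Zmodule.on (twist s M).

Definition twist_scale (r : R) (x : twist s M) : twist s M := s r *: (x : M).

Lemma twist_scaleA a b x :
  twist_scale a (twist_scale b x) = twist_scale (a * b) x.
Proof. by rewrite /twist_scale scalerA rmorphM. Qed.

Lemma twist_scale1 : left_id 1 twist_scale.
Proof. by move=> x; rewrite /twist_scale rmorph1 scale1r. Qed.

Lemma twist_scaleDr : right_distributive twist_scale +%R.
Proof. by move=> a x y; rewrite /twist_scale [LHS]scalerDr. Qed.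

Lemma twist_scaleDl x : {morph twist_scale^~ x : a b / a + b}.
Proof. by move=> a b; rewrite /twist_scale rmorphD [LHS]scalerDl. Qed.

HB.instance Definition _ := GRing.Zmodule_isLmodule.Build R (twist s M)
  twist_scaleA twist_scale1 twist_scaleDr twist_scaleDl.

End Twist.

Section TwistMap.
Context (s : {rmorphism R -> R}) {U V : lmodType R} (f : {linear U -> V}).

Definition twist_map : twist s U -> twist s V := f.

Lemma twist_map_linear : linear twist_map.
Proof. by move=> a x y; rewrite /twist_map [LHS]linearP. Qed.

HB.instance Definition _ :=
  GRing.isLinear.Build R (twist s U) (twist s V) _ twist_map twist_map_linear.
End TwistMap.

End Modules.
Arguments precomp {R U V} f N h.
Arguments twist_map {R} s {U V} f x.

Section Dagger.
Context {R : invRingType}.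
Implicit Types (U V M : lmodType R).

Definition conj_module M : lmodType R := twist bar M.

Definition dagger M : lmodType R := hom_module (conj_module M) R^o.

Definition dagger_map U V (f : {linear U -> V}) :
    {linear dagger V -> dagger U} :=
  precomp (twist_map bar f : {linear conj_module U -> conj_module V}) R^o.

(* The canonical map M -> M^dagger^dagger, x |-> (f |-> bar (f x)); the
   conjugation makes its values linear on the conjugate of M^dagger. *)
Section Bidual.
Context {M : lmodType R}.

Definition bidual_fun (x : M) (f : conj_module (dagger M)) : R^o :=
  bar ((f : dagger M) x).

Lemma bidual_fun_linear x : linear (bidual_fun x).
Proof.
move=> a f g; rewrite /bidual_fun.
by rewrite -[_ x]/(bar a * (f : dagger M) x + (g : dagger M) x)
  rmorphD rmorphM /= [X in X * _]barK.
Qed.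

HB.instance Definition _ x := GRing.isLinear.Build R
  (conj_module (dagger M)) R^o _ (bidual_fun x) (bidual_fun_linear x).

Definition bidual (x : M) : dagger (dagger M) := to_hom (bidual_fun x).

Lemma bidual_linear : linear bidual.
Proof.
move=> a x y; apply/val_inj/funext=> f.
rewrite -[LHS]/(bar ((f : dagger M) (a *: x + y))).
rewrite -[RHS]/(a * bar ((f : dagger M) x) + bar ((f : dagger M) y)).
have -> : a *: x + y = bar a *: (x : conj_module M) + (y : conj_module M).
  by rewrite -[RHS]/(bar (bar a) *: x + y) barK.
rewrite (@hom_linear _ (conj_module M) R^o f (bar a) x y) rmorphD.
by rewrite -[bar a *: _]/(bar a * _) rmorphM /= barK.
Qed.

HB.instance Definition _ :=
  GRing.isLinear.Build R M (dagger (dagger M)) _ bidual bidual_linear.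
End Bidual.

Section CSS.
Context {GX P GZ : lmodType R}.
Context (phiX : {linear GX -> P}) (phiZ : {linear GZ -> dagger P}).

Definition css_code :=
  [/\ finite_free GX, finite_free P, finite_free GZ &
      forall z, dagger_map phiX (phiZ z) = 0].

(* phiZ^dagger is defined on the bidual of P, which is identified with P
   through bidual *)
Definition topological :=
  exact_at phiX (dagger_map phiZ \o bidual) /\
  exact_at phiZ (dagger_map phiX).

Definition topological_css_code := css_code /\ topological.

Definition charge_module (l : nat) : lmodType R :=
  Ext l (conj_module (coker phiX)) R^o.

Definition realizes (E : lmodType R) (j : nat) :=
  [/\ topological_css_code, isomorphic (charge_module j) E &
      forall l, (0 < l)%N -> l <> j -> zero_module (charge_module l)].
End CSS.

Definition realizable (E : lmodType R) (j : nat) :=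
  exists (GX P GZ : lmodType R) (phiX : {linear GX -> P})
         (phiZ : {linear GZ -> dagger P}), realizes phiX phiZ E j.

End Dagger.

(* Main.v *)
(** The modules Ext^n are handled through syzygies: for a short exact sequence
0 -> K -> P -> M -> 0 with P projective, Ext^1(M, N) = Hom(K, N) / Hom(P, N) and
Ext^(n+2)(M, N) = Ext^(n+1)(K, N), whatever the choice of P, because K is unique up to
maps factoring through projectives.

Part (1) rests on the Auslander condition: for N finitely generated over
R = Z/p^m[Z^D], every submodule of Ext^n(N, R) has grade at least n.  (The cokernel C of
phiX embeds in a free module with quotient Q, so Ext^l(C, R) = Ext^(l+1)(Q, R).)  It is
proved by induction on D, together with Noetherianity.  Devissage reduces to N cyclic and
killed by p.  Either N = R/p, which has the periodic resolution by p and p^(m-1), or N is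
killed by some f whose nonzero coefficients are units.  In the second case a generic
weight Z^D -> Z separates the support of f and exhibits R as R'[t, 1/t] with
R' = Z/p^m[Z^(D-1)] and f as a polynomial in t with invertible extreme coefficients.  Then
R/f is a free Frobenius R'-algebra, so that Ext^(n+1)_R(M, R) = Ext^n_R'(M, R') for every
R-module M killed by f; this is applied both to N and to the submodules of Ext^n(N, R).

For (2) and (3), dualizing a free resolution G of E gives, as long as Ext^i(E, R) = 0, the
free resolution G_0^+ -> ... -> G_j^+ of the cokernel of phiX; dualizing it again gives
back G, hence E as its last cohomology. *)

From HB Require Import structures.
Require Import Defs.
From mathcomp Require Import all_boot all_order all_algebra finmap.
From mathcomp Require Import generic_quotient ring_quotient.
From mathcomp Require Import boolp functions.
From mathcomp Require Import zify ring.
From mathcomp.multinomials Require Import monalg.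

Set Implicit Arguments.
Unset Strict Implicit.
Unset Printing Implicit Defensive.

Import GRing.Theory.

Local Open Scope ring_scope.
Local Open Scope quotient_scope.

(** * Linear maps and short exact sequences *)

Section LinearMaps.
Context {R : comNzRingType}.
Implicit Types (U V W K P Q M N : lmodType R).

(** What replaces them is that an f with invertible extreme coefficients is regular in R, and that
    dividing by it removes one variable while lowering every Ext degree by one: a grade bound n over
    R' becomes n + 1 over R. No long exact sequence is built. The modules all of whose submodules
    have grade at least n form a Serre class, and so do the zero modules; half-exactness of Ext with
    respect to such classes is enough. For the same reason the change of rings is proved in one
    direction only: if Ext^n over R' lies in a Serre class, so does Ext^(n+1) over R. This needs a
    subquotient relation between the two, not an isomorphism. The weight must separate the support
    of f because its coefficients as a polynomial in t lie in R': one monomial with a unit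
    coefficient is invertible there, a sum of several need not be. Noetherianity follows from the
    same devissage; it serves to resolve E by finite free modules in (2). *)

Definition lin U V (f : U -> V) (fl : linear f) : {linear U -> V} :=
  HB.pack f (GRing.isLinear.Build R U V _ f fl).

Lemma linear_eq0_inj U V (f : {linear U -> V}) :
  (forall x, f x = 0 -> x = 0) -> injective f.
Proof.
by move=> f0 x y e; apply/eqP; rewrite -subr_eq0 (f0 (x - y)) ?linearB ?e ?subrr.
Qed.

Lemma bijP U V (f : U -> V) : injective f -> surjective f -> bijective f.
Proof.
move=> fi fs; pose g y := projT1 (cid (fs y)).
have gK : cancel g f by move=> y; rewrite /g; case: cid.
by exists g => // x; apply: fi; rewrite gK.
Qed.

Lemma bij_surj U V (f : U -> V) : bijective f -> surjective f.
Proof. by move=> [g _ gK] y; exists (g y). Qed.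

Lemma isomorphic_refl M : isomorphic M M.
Proof. by exists idfun; exists id. Qed.

Lemma isomorphic_sym M N : isomorphic M N -> isomorphic N M.
Proof.
move=> [f [g fK gK]]; have gl : linear g.
  by move=> a x y; apply: (can_inj fK); rewrite linearP !gK.
by exists (lin gl); exists f.
Qed.

Lemma isomorphic_trans M N P : isomorphic M N -> isomorphic N P -> isomorphic M P.
Proof.
move=> [f fb] [g gb]; exists (g \o f).
exact: bij_comp.
Qed.

Lemma isomorphic_zero M N : isomorphic M N -> zero_module M -> zero_module N.
Proof. by move=> [f [g fK gK]] M0 y; rewrite -(gK y) (M0 (g y)) linear0. Qed.

Lemma factor_surj U V W (g : {linear U -> V}) (h : {linear U -> W}) :
  surjective g -> (forall x, g x = 0 -> h x = 0) ->
  exists k : {linear V -> W}, forall x, k (g x) = h x.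
Proof.
move=> gs gh; pose s y := projT1 (cid (gs y)).
have sK y : g (s y) = y by rewrite /s; case: cid.
have hs x : h (s (g x)) = h x.
  by apply/eqP; rewrite -subr_eq0 -linearB gh // linearB sK subrr.
have kl : linear (h \o s).
  move=> a x y; have -> : a *: x + y = g (a *: s x + s y) by rewrite linearP !sK.
  by rewrite /= hs linearP.
by exists (lin kl) => x; apply: hs.
Qed.

Lemma factor_inj U V W (i : {linear U -> V}) (h : {linear W -> V}) :
  injective i -> (forall x, exists y, i y = h x) ->
  exists k : {linear W -> U}, forall x, i (k x) = h x.
Proof.
move=> ii ih; pose k x := projT1 (cid (ih x)).
have kK x : i (k x) = h x by rewrite /k; case: cid.
have kl : linear k by move=> a x y; apply: ii; rewrite linearP !kK linearP.
by exists (lin kl).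
Qed.

Definition ker_val U V (f : {linear U -> V}) : {linear kernel f -> U} :=
  (val : kernel f -> U).

Lemma ker_val_inj U V (f : {linear U -> V}) : injective (ker_val f).
Proof. exact: val_inj. Qed.

Lemma ker_val_exact U V (f : {linear U -> V}) : exact_at (ker_val f) f.
Proof.
move=> y; split=> [y0|[x <-]]; last by apply/eqP; case: x.
have yK : y \in in_ker f by apply/eqP.
by exists (Submodule yK : kernel f).
Qed.

Section QuotientMap.
Context {V : lmodType R} (S : submodClosed V).

Lemma quot_pi_linear : linear (\pi_(quot_module S) : V -> quot_module S).
Proof. by move=> a x y; rewrite quotient_piD -quotient_piZ. Qed.

Definition quot_pi : {linear V -> quot_module S} := lin quot_pi_linear.

Lemma quot_pi_surj : surjective quot_pi.
Proof. by move=> y; exists (repr y); apply: reprK. Qed.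

Lemma quot_pi_eq0 x : quot_pi x = 0 <-> x \in S.
Proof.
rewrite -(linear0 quot_pi) -[x in x \in S]subr0.
by split=> [/quotient_eqP|/quotient_eqP].
Qed.
End QuotientMap.

Definition coker_pi U V (f : {linear U -> V}) : {linear V -> coker f} :=
  quot_pi _.

Lemma coker_pi_surj U V (f : {linear U -> V}) : surjective (coker_pi f).
Proof. exact: quot_pi_surj. Qed.

Lemma coker_pi_exact U V (f : {linear U -> V}) : exact_at f (coker_pi f).
Proof.
move=> y; split=> [/quot_pi_eq0/asboolP//|ey].
by apply/quot_pi_eq0/asboolP.
Qed.

Lemma coker_pi_eq U V (f : {linear U -> V}) x y :
  coker_pi f x = coker_pi f y <-> exists z, f z = x - y.
Proof.
rewrite -coker_pi_exact linearB; split=> [->|/eqP]; first exact: subrr.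
by rewrite subr_eq0 => /eqP.
Qed.

Lemma image_ex U V (f : {linear U -> V}) :
  exists (I : lmodType R) (e : {linear U -> I}) (i : {linear I -> V}),
    [/\ surjective e, injective i & forall x, f x = i (e x)].
Proof.
have [e ei] : exists e : {linear U -> kernel (coker_pi f)},
    forall x, ker_val (coker_pi f) (e x) = f x.
  apply: factor_inj => [|x]; first exact: ker_val_inj.
  by apply/ker_val_exact/coker_pi_exact; exists x.
exists (kernel (coker_pi f)), e, (ker_val (coker_pi f)); split=> //.
  move=> y; have /coker_pi_exact [x ex] : coker_pi f (ker_val _ y) = 0.
    by apply/ker_val_exact; exists y.
  by exists x; apply: ker_val_inj; rewrite ei.
Qed.

Definition short_exact K P M (i : K -> P) (g : P -> M) :=
  [/\ injective i, exact_at i g & surjective g].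

Lemma exact_comp0 K P M (i : K -> P) (g : {linear P -> M}) x :
  exact_at i g -> g (i x) = 0.
Proof. by move=> e; apply/e; exists x. Qed.

Lemma short_exact_ker P M (g : {linear P -> M}) :
  surjective g -> short_exact (ker_val g) g.
Proof. by split; [exact: ker_val_inj | exact: ker_val_exact |]. Qed.

Lemma short_exact_coker K P (i : {linear K -> P}) :
  injective i -> short_exact i (coker_pi i).
Proof. by split; [| exact: coker_pi_exact | exact: coker_pi_surj]. Qed.

Lemma short_exact_ker_factor K P M (i : {linear K -> P}) (g : {linear P -> M})
    W (h : {linear W -> P}) :
  short_exact i g -> (forall x, g (h x) = 0) ->
  exists k : {linear W -> K}, forall x, i (k x) = h x.
Proof. by move=> [ii ig _] gh; apply: factor_inj => // x; apply/ig. Qed.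

Lemma short_exact_coker_factor K P M (i : {linear K -> P}) (g : {linear P -> M})
    W (h : {linear P -> W}) :
  short_exact i g -> (forall x, h (i x) = 0) ->
  exists k : {linear M -> W}, forall x, k (g x) = h x.
Proof. by move=> [_ ig gs] hi; apply: factor_surj => // x /ig[y <-]. Qed.

Definition malg_lift (K : choiceType) V (F : K -> V) (g : {malg R[K]}) : V :=
  \sum_(x <- msupp g) g@_x *: F x.

Lemma malg_liftw (K : choiceType) V (F : K -> V) (d : {fset K}) (g : {malg R[K]}) :
  (msupp g `<=` d)%fset -> malg_lift F g = \sum_(x <- d) g@_x *: F x.
Proof.
move=> le_d; apply: big_fset_incl => // x _ /mcoeff_outdom ->.
by rewrite scale0r.
Qed.

Lemma malg_lift_linear (K : choiceType) V (F : K -> V) : linear (malg_lift F).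
Proof.
move=> a g h; pose d := (msupp g `|` msupp h `|` msupp (a *: g + h))%fset.
rewrite (@malg_liftw _ _ _ d) ?fsubsetUr // (@malg_liftw _ _ _ d g); last first.
  by rewrite /d -fsetUA fsubsetUl.
rewrite (@malg_liftw _ _ _ d h); last first.
  by rewrite /d [X in (X `|` _)%fset]fsetUC -fsetUA fsubsetUl.
rewrite scaler_sumr -big_split; apply: eq_bigr => x _ /=.
by rewrite mcoeffD mcoeffZ scalerDl scalerA.
Qed.

HB.instance Definition _ (K : choiceType) V (F : K -> V) :=
  GRing.isLinear.Build R {malg R[K]} V _ (malg_lift F) (malg_lift_linear F).

Lemma malg_liftU (K : choiceType) V (F : K -> V) x : malg_lift F << x >> = F x.
Proof. by rewrite (malg_liftw _ msuppU_le) big_seq_fset1 mcoeffUU scale1r. Qed.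

Lemma malgUZ (K : choiceType) (c : R) (x : K) : << c *g x >> = c *: << x >>.
Proof. by apply/malgP=> k; rewrite mcoeffZ !mcoeffU mulrnAr mulr1. Qed.

Lemma malg_ind (K : choiceType) (P : {malg R[K]} -> Prop) :
  P 0 -> (forall c x g, P g -> P (c *: << x >> + g)) -> forall g, P g.
Proof.
move=> P0 PD g; rewrite [g]monalgE; elim: (enum_fset _) => [|k r IH].
  by rewrite big_nil.
by rewrite big_cons malgUZ; apply: PD.
Qed.

Lemma malg_lin_ext (K : choiceType) V (f g : {linear {malg R[K]} -> V}) :
  (forall x, f << x >> = g << x >>) -> forall y, f y = g y.
Proof.
move=> fg y; elim/malg_ind: y => [|c x y IH]; first by rewrite !linear0.
by rewrite !linearP fg IH.
Qed.

Lemma malg_projective (K : choiceType) : projective {malg R[K]}.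
Proof.
move=> V W g f gs; pose s y := projT1 (cid (gs y)).
have sK y : g (s y) = y by rewrite /s; case: cid.
exists (malg_lift (fun x => s (f << x >>))).
apply: (malg_lin_ext (f := g \o malg_lift _)) => x.
by rewrite /= malg_liftU sK.
Qed.

Lemma projective_iso M N : isomorphic M N -> projective M -> projective N.
Proof.
move=> MN Mp V W g f gs; have [a [b _ _]] := isomorphic_sym MN.
have [k [l kK lK]] := MN.
have [h hE] := Mp V W g (f \o k) gs.
have ll : linear l by move=> c x y; apply: (can_inj kK); rewrite linearP !lK.
by exists (h \o lin ll) => x; rewrite /= hE /= lK.
Qed.

Lemma free_projective M : free_module M -> projective M.
Proof. by move=> [K KM]; apply: projective_iso KM (@malg_projective K). Qed.

Lemma row_free_module n : isomorphic {malg R['I_n]} 'rV[R]_n.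
Proof.
exists (malg_lift (fun i => delta_mx 0 i)); apply: bijP.
  apply: linear_eq0_inj => g g0; apply/malgP => i; rewrite mcoeff0.
  suff <- : (malg_lift (fun i => delta_mx 0 i) g : 'rV[R]_n) 0 i = g@_i by rewrite g0 mxE.
  elim/malg_ind: g {g0} => [|c x g IH]; first by rewrite linear0 mxE mcoeff0.
  rewrite linearP /= malg_liftU !mxE IH mcoeffD mcoeffZ mcoeffU eqxx eq_sym.
  by case: eqP.
move=> v; exists (\sum_i v 0 i *: << i >>).
rewrite linear_sum [RHS]row_sum_delta; apply: eq_bigr => i _.
by rewrite linearZ /= malg_liftU.
Qed.

Lemma finite_free_free M : finite_free M -> free_module M.
Proof.
by move=> [n nM]; exists 'I_n; apply: isomorphic_trans (row_free_module n) nM.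
Qed.

Lemma finite_free_projective M : finite_free M -> projective M.
Proof. by move/finite_free_free/free_projective. Qed.

Lemma row_projective n : projective 'rV[R]_n.
Proof. exact: projective_iso (row_free_module n) (@malg_projective _). Qed.

Lemma regular_projective : projective (R^o : lmodType R).
Proof.
move=> V W g f gs; have [v ev] := gs (f 1).
have hl : linear (fun a : R^o => a *: v : V).
  by move=> a x y; rewrite scalerDl scalerA.
by exists (lin hl) => x; rewrite /= linearZ_LR ev -linearZ_LR /= [_ *: _]mulr1.
Qed.

Lemma free_cover_short_exact M :
  short_exact (ker_val (@free_cover R M)) (@free_cover R M).
Proof. exact/short_exact_ker/free_cover_surj. Qed.

End LinearMaps.

(** * Ext through syzygies *)

Section Syzygies.
Context {R : comNzRingType}.
Implicit Types (U V W K P Q M N L : lmodType R).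

(** [phi] is a bare function, so that differences such as [psi (phi x) - x] need no bundling as
    linear maps. *)
Definition stably_zero M N (phi : M -> N) :=
  exists Q (a : {linear M -> Q}) (b : {linear Q -> N}),
    projective Q /\ forall x, phi x = b (a x).

Definition stably_equivalent M N :=
  exists (phi : {linear M -> N}) (psi : {linear N -> M}),
    stably_zero (fun x => psi (phi x) - x) /\ stably_zero (fun x => phi (psi x) - x).

Lemma stably_equivalent_refl M : stably_equivalent M M.
Proof.
have z : stably_zero (fun x : M => x - x).
  exists (R^o : lmodType R), \0, \0.
  by split=> [|x]; [exact: regular_projective | rewrite subrr].
by exists idfun, idfun.
Qed.

Lemma stably_zero_syzygy K P M K' P' M' (i : {linear K -> P}) (g : {linear P -> M})
    (i' : {linear K' -> P'}) (g' : {linear P' -> M'})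
    (phi : M -> M') (Phi : P -> P') (psi : K -> K') :
  short_exact i g -> short_exact i' g' -> linear Phi ->
  (forall x, g' (Phi x) = phi (g x)) -> (forall x, i' (psi x) = Phi (i x)) ->
  stably_zero phi -> exists h : {linear P -> K'}, forall x, psi x = h (i x).
Proof.
move=> ig ig' Phil ePhi epsi [Q [a [b [Qp ephi]]]]; have [ii' _ gs'] := ig'.
have [c ec] := Qp _ _ g' b gs'.
have dl : linear (fun x => Phi x - c (a (g x))).
  by move=> r x y; rewrite Phil !linearP scalerDr addrACA.
have [h eh] : exists h : {linear P -> K'}, forall x, i' (h x) = lin dl x.
  by apply: short_exact_ker_factor ig' _ => x; rewrite linearB ePhi ephi ec subrr.
exists h => x; apply: ii'; rewrite eh /= epsi.
by have [_ eig _] := ig; rewrite (exact_comp0 x eig) !linear0 addr0.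
Qed.

Lemma syzygy_lift K P M K' P' M' (i : {linear K -> P}) (g : {linear P -> M})
    (i' : {linear K' -> P'}) (g' : {linear P' -> M'}) (phi : {linear M -> M'}) :
  projective P -> short_exact i g -> short_exact i' g' ->
  exists (Phi : {linear P -> P'}) (psi : {linear K -> K'}),
    (forall x, g' (Phi x) = phi (g x)) /\ (forall x, i' (psi x) = Phi (i x)).
Proof.
move=> Pp [_ ig _] ig'; have [_ _ gs'] := ig'.
have [Phi ePhi] := Pp _ _ g' (phi \o g) gs'.
have [psi epsi] : exists psi : {linear K -> K'}, forall x, i' (psi x) = (Phi \o i) x.
  apply: short_exact_ker_factor ig' _ => x.
  by rewrite /= ePhi /= (exact_comp0 x ig) linear0.
by exists Phi, psi.
Qed.

(* Ext^1(coker i, N), when i is injective and P is projective. *)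
Definition hom_coker K P (i : {linear K -> P}) N : lmodType R :=
  coker (precomp i N).

Definition hom_coker_pi K P (i : {linear K -> P}) N (u : {linear K -> N}) :
  hom_coker i N := coker_pi _ (to_hom u).

Lemma hom_coker_pi_surj K P (i : {linear K -> P}) N (e : hom_coker i N) :
  exists u : {linear K -> N}, hom_coker_pi i u = e.
Proof.
have [u <-] := coker_pi_surj e; exists u.
by congr (coker_pi _ _); apply/val_inj.
Qed.

Lemma hom_coker_pi_eq0 K P (i : {linear K -> P}) N (u : {linear K -> N}) :
  hom_coker_pi i u = 0 <-> exists w : {linear P -> N}, forall x, u x = w (i x).
Proof.
split=> [/coker_pi_exact[w ew]|[w ew]].
  by exists w => x; have /(congr1 (fun h : hom_module _ _ => h x)) := ew.
apply/coker_pi_exact; exists (to_hom w); apply/val_inj/funext => x.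
by rewrite /= ew.
Qed.

(** Schanuel's lemma in stable form: the defects from the identity are stably zero on M and M', so
    their lifts to K and K' factor through P and P'. *)
Lemma stably_equivalent_syzygy K P M K' P' M'
    (i : {linear K -> P}) (g : {linear P -> M})
    (i' : {linear K' -> P'}) (g' : {linear P' -> M'}) :
  projective P -> projective P' -> short_exact i g -> short_exact i' g' ->
  stably_equivalent M M' -> stably_equivalent K K'.
Proof.
move=> Pp Pp' ig ig' [phi [psi [z z']]].
have [Phi [phi1 [ePhi ephi1]]] := syzygy_lift phi Pp ig ig'.
have [Psi [psi1 [ePsi epsi1]]] := syzygy_lift psi Pp' ig' ig.
exists phi1, psi1; split.
  have [|x|x|h eh] := @stably_zero_syzygy _ _ _ _ _ _ i g i g _
    (fun x => Psi (Phi x) - x) (fun x => psi1 (phi1 x) - x) ig ig _ _ _ z.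
  - by move=> a x y; rewrite !linearP scalerDr addrACA.
  - by rewrite linearB ePsi ePhi.
  - by rewrite linearB epsi1 ephi1.
  by exists P, i, h.
have [|x|x|h eh] := @stably_zero_syzygy _ _ _ _ _ _ i' g' i' g' _
  (fun x => Phi (Psi x) - x) (fun x => phi1 (psi1 x) - x) ig' ig' _ _ _ z'.
- by move=> a x y; rewrite !linearP scalerDr addrACA.
- by rewrite linearB ePhi ePsi.
- by rewrite linearB ephi1 epsi1.
by exists P', i', h.
Qed.

(** Precomposition with the lift of [psi] is an isomorphism, with inverse induced by the lift of
    [phi]. Stable equivalence of K and K' alone does not suffice: a map out of K is trivial in
    [hom_coker i N] only if it extends along [i], so the homotopies [h] and [h'] must start from P
    and P' themselves. *)
Lemma hom_coker_stable K P M K' P' M'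
    (i : {linear K -> P}) (g : {linear P -> M})
    (i' : {linear K' -> P'}) (g' : {linear P' -> M'}) N :
  projective P -> projective P' -> short_exact i g -> short_exact i' g' ->
  stably_equivalent M M' -> isomorphic (hom_coker i N) (hom_coker i' N).
Proof.
move=> Pp Pp' ig ig' [phi [psi [z z']]].
have [Phi [phi1 [ePhi ephi1]]] := syzygy_lift phi Pp ig ig'.
have [Psi [psi1 [ePsi epsi1]]] := syzygy_lift psi Pp' ig' ig.
have [|x|x|h eh] := @stably_zero_syzygy _ _ _ _ _ _ i g i g _
    (fun x => Psi (Phi x) - x) (fun x => psi1 (phi1 x) - x) ig ig _ _ _ z.
- by move=> a x y; rewrite !linearP scalerDr addrACA.
- by rewrite linearB ePsi ePhi.
- by rewrite linearB epsi1 ephi1.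
have [|x|x|h' eh'] := @stably_zero_syzygy _ _ _ _ _ _ i' g' i' g' _
  (fun x => Phi (Psi x) - x) (fun x => phi1 (psi1 x) - x) ig' ig' _ _ _ z'.
- by move=> a x y; rewrite !linearP scalerDr addrACA.
- by rewrite linearB ePhi ePsi.
- by rewrite linearB ephi1 epsi1.
have [f ef] : exists f : {linear hom_coker i N -> hom_coker i' N},
    forall u, f (coker_pi _ u) = (coker_pi _ \o precomp psi1 N) u.
  apply: factor_surj => [|u]; first exact: coker_pi_surj.
  move=> /coker_pi_exact[w ew]; apply/coker_pi_exact; exists (precomp Psi N w).
  by rewrite -ew; apply/val_inj/funext => x /=; rewrite epsi1.
exists f; apply: bijP.
  apply: linear_eq0_inj => e.
  have [u <-] := hom_coker_pi_surj e; rewrite ef /= => /coker_pi_exact[w ew].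
  apply/hom_coker_pi_eq0; exists ((w \o Phi) \- (u \o h)) => x.
  have := congr1 (fun k : hom_module _ _ => k (phi1 x)) ew.
  by rewrite /= -eh ephi1 linearB => ->; rewrite opprB addrC subrK.
move=> e; have [u <-] := hom_coker_pi_surj e.
exists (hom_coker_pi i (u \o phi1)); rewrite ef.
apply/coker_pi_eq.
by exists (to_hom (u \o h')); apply/val_inj/funext => x /=; rewrite -eh' linearB.
Qed.

(** A relation and not a function: the projectives stay arbitrary, and [syzygy_stable] compares any
    choice with the standard one. *)
Fixpoint syzygy (n : nat) M K : Prop :=
  if n is n'.+1 then
    exists L P (i : {linear K -> P}) (g : {linear P -> L}),
      [/\ syzygy n' M L, projective P & short_exact i g]
  else M = K.

Lemma syzygyS n M K P L (i : {linear K -> P}) (g : {linear P -> M}) :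
  projective P -> short_exact i g -> syzygy n K L -> syzygy n.+1 M L.
Proof.
move=> Pp ig; elim: n L => [|n IH] L.
  by move=> <- /=; exists M, P, i, g.
by move=> [L' [P' [i' [g' [/IH s Pp' ig']]]]]; exists L', P', i', g'.
Qed.

Lemma syzygy_stable n M M' K K' : stably_equivalent M M' ->
  syzygy n M K -> syzygy n M' K' -> stably_equivalent K K'.
Proof.
move=> MM'; elim: n K K' => [|n IH] K K' /=; first by move=> <- <-.
move=> [L [P [i [g [s Pp ig]]]]] [L' [P' [i' [g' [s' Pp' ig']]]]].
exact: stably_equivalent_syzygy Pp Pp' ig ig' (IH _ _ s s').
Qed.

Lemma syzygy_std n M : syzygy n M (std_syzygy M n).
Proof.
elim: n => [|n IH] //=; exists (std_syzygy M n), (std_obj M n).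
exists (ker_val (@free_cover R _)), (@free_cover R _).
by split; [| exact: malg_projective | exact: free_cover_short_exact].
Qed.

(** A cocycle in degree n + 1 vanishes on boundaries, hence factors through [c]; it is a coboundary
    exactly when the factor extends along [i]. *)
Lemma cohomology_hom_coker M (F : resolution M) N n K
    (c : {linear F n.+1 -> K}) (i : {linear K -> F n}) :
  surjective c -> exact_at (res_d F n.+1) c -> (forall x, res_d F n x = i (c x)) ->
  isomorphic (hom_coker i N) (cohomology F N n.+1).
Proof.
move=> cs dc dE.
have [p ep] : exists p : {linear hom_module K N -> cocycles F N n.+1},
    forall u, ker_val _ (p u) = precomp c N u.
  apply: factor_inj => [|u]; first exact: ker_val_inj.
  apply/ker_val_exact/val_inj/funext => x /=.
  by rewrite (exact_comp0 x dc) linear0.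
have pS z : exists u : {linear K -> N}, p (to_hom u) = z.
  have [x cx|u eu] := @factor_surj _ _ _ _ c (ker_val _ z) cs.
    have [/(_ cx)[y <-] _] := dc x.
    have : precomp (res_d F n.+1) N (ker_val _ z) = 0.
      by apply/ker_val_exact; exists z.
    by move/(congr1 (fun h : hom_module _ _ => h y)).
  exists u; apply: ker_val_inj; rewrite ep.
  by apply/val_inj/funext => x; rewrite /= eu.
have [f ef] : exists f : {linear hom_coker i N -> cohomology F N n.+1},
    forall u, f (coker_pi _ u) = (quot_pi _ \o p) u.
  apply: factor_surj => [|u]; first exact: coker_pi_surj.
  move=> /coker_pi_exact[w ew]; apply/quot_pi_eq0/asboolP; exists w.
  by rewrite [RHS]ep -ew; apply/val_inj/funext => x; rewrite /= dE.
exists f; apply: bijP.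
  apply: linear_eq0_inj => e; have [u <-] := hom_coker_pi_surj e.
  rewrite ef => /quot_pi_eq0/asboolP[w /esym].
  rewrite [LHS]ep => ew; apply/hom_coker_pi_eq0; exists w => y.
  have [x <-] := cs y; rewrite -dE.
  exact: (congr1 (fun h : hom_module _ _ => h x) ew).
move=> e; have [z <-] := quot_pi_surj e; have [u <-] := pS z.
by exists (coker_pi _ (to_hom u)); rewrite ef.
Qed.

Lemma Ext_std n M N :
  isomorphic (hom_coker (ker_val (@free_cover R (std_syzygy M n))) N) (Ext n.+1 M N).
Proof.
apply: (@cohomology_hom_coker _ (std_resolution M) _ _ _ (@free_cover R _)) => //.
- exact: free_cover_surj.
- exact: (@std_exact _ M n.+1).
Qed.

Lemma Ext0_hom M N : isomorphic (hom_module M N) (Ext 0 M N).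
Proof.
have [s0 sd sE] : [/\ surjective (res_aug (std_resolution M)),
  exact_at (res_d (std_resolution M) 0) (res_aug (std_resolution M)) & True].
  by split=> //; [exact: res_aug_surj | exact: res_exact0].
rewrite /Ext; move: (std_resolution M) s0 sd {sE} => F cs dc.
have [p ep] : exists p : {linear hom_module M N -> cocycles F N 0},
    forall u, ker_val _ (p u) = precomp (res_aug F) N u.
  apply: factor_inj => [|u]; first exact: ker_val_inj.
  apply/ker_val_exact/val_inj/funext => x /=.
  by rewrite (exact_comp0 x dc) linear0.
exists (quot_pi _ \o p); apply: bijP.
  apply: linear_eq0_inj => u /quot_pi_eq0; rewrite unfold_in => /eqP pu0.
  have {}pu0 : ker_val _ (p u) = 0 by [].
  apply/val_inj/funext => y; have [x <-] := cs y.
  have /(congr1 (fun h : hom_module _ _ => h x)) := ep u.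
  by rewrite pu0 /= => <-.
move=> e; have [z <-] := quot_pi_surj e.
have [x cx|u eu] := @factor_surj _ _ _ _ (res_aug F) (ker_val _ z) cs.
  have [/(_ cx)[y <-] _] := dc x.
  have : precomp (res_d F 0) N (ker_val _ z) = 0.
    by apply/ker_val_exact; exists z.
  by move/(congr1 (fun h : hom_module _ _ => h y)).
exists (to_hom u); congr (quot_pi _ _); apply: ker_val_inj; rewrite ep.
by apply/val_inj/funext => x; rewrite /= eu.
Qed.

Lemma Ext_syzygy n M K P L (i : {linear K -> P}) (g : {linear P -> L}) N :
  syzygy n M L -> projective P -> short_exact i g ->
  isomorphic (hom_coker i N) (Ext n.+1 M N).
Proof.
move=> s Pp ig; apply: isomorphic_trans (Ext_std n M N).
apply: (hom_coker_stable _ Pp _ ig (free_cover_short_exact _)).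
  exact: malg_projective.
exact: syzygy_stable (stably_equivalent_refl M) s (syzygy_std n M).
Qed.

Lemma Ext1_hom_coker M K P (i : {linear K -> P}) (g : {linear P -> M}) N :
  projective P -> short_exact i g -> isomorphic (hom_coker i N) (Ext 1 M N).
Proof. by move=> Pp ig; apply: (@Ext_syzygy 0 M) Pp ig. Qed.

Lemma Ext_shift n M K P (i : {linear K -> P}) (g : {linear P -> M}) N :
  projective P -> short_exact i g -> isomorphic (Ext n.+1 K N) (Ext n.+2 M N).
Proof.
move=> Pp ig; apply: isomorphic_trans (isomorphic_sym (Ext_std n K N)) _.
apply: Ext_syzygy (syzygyS Pp ig (syzygy_std n K)) _ (free_cover_short_exact _).
exact: malg_projective.
Qed.

(** M is presented by 0 -> 0 -> M -> M -> 0, whose syzygy 0 is again projective, so shifting reduces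
    every degree to the first. *)
Lemma Ext_projective n M N : projective M -> zero_module (Ext n.+1 M N).
Proof.
elim: n M => [|n IH] M Mp.
all: have S0 : zero_module 'rV[R]_0 by move=> x; apply/rowP; case.
all: have ig : short_exact (\0 : {linear 'rV[R]_0 -> M}) idfun.
1,3: split; [by move=> x y _; rewrite (S0 x) (S0 y) | move=> y | by move=> y; exists y].
1,2: by split=> [/= ->|[x <-]] //; exists 0.
  apply: isomorphic_zero (Ext1_hom_coker N Mp ig) _ => e.
  have [u <-] := hom_coker_pi_surj e; apply/hom_coker_pi_eq0.
  by exists \0 => x; rewrite (S0 x) !linear0.
exact: isomorphic_zero (Ext_shift n N Mp ig) (IH _ (@row_projective R 0)).
Qed.

End Syzygies.

(** * Serre classes and half-exactness *)

Section SerreClasses.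
Context {R : comNzRingType}.
Implicit Types (A B U V W K P Q M N L X Y Z : lmodType R) (C : lmodType R -> Prop).

(** The third closure property takes sequences that are exact in the middle only, the form in which
    half-exactness delivers them. Closure under isomorphism is a case of the second. *)
Definition serre_class C :=
  [/\ forall X Y (f : {linear X -> Y}), injective f -> C Y -> C X,
      forall X Y (f : {linear X -> Y}), surjective f -> C X -> C Y &
      forall X Y Z (f : {linear X -> Y}) (g : {linear Y -> Z}),
        exact_at f g -> C X -> C Z -> C Y].

(** Y is a quotient of the image of [a], hence a subquotient of X. No map between X and Y is
    required, and V need not belong to the class. *)
Lemma serre_rel C X Y V (a : {linear V -> X}) (b : {linear V -> Y}) :
  serre_class C -> surjective b -> (forall v, a v = 0 -> b v = 0) -> C X -> C Y.
Proof.
move=> [Csub Cquot _] bs ab CX; have [I [e [i [es ii ei]]]] := image_ex a.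
have [k ek] : exists k : {linear I -> Y}, forall v, k (e v) = b v.
  by apply: factor_surj es _ => v ev; apply: ab; rewrite ei ev linear0.
apply: (Cquot _ _ k) (Csub _ _ _ ii CX) => y.
by have [v <-] := bs y; exists (e v).
Qed.

Lemma serre_iso C X Y : serre_class C -> isomorphic X Y -> C X -> C Y.
Proof. by move=> [_ Cquot _] [f /bij_surj fs]; apply: Cquot fs. Qed.

Lemma serre_zero C X Z : serre_class C -> zero_module Z -> C X -> C Z.
Proof.
move=> [_ Cquot _] Z0; apply: (Cquot _ _ \0) => z.
by exists 0; rewrite (Z0 z).
Qed.

Lemma zero_serre : serre_class (@zero_module R).
Proof.
split=> [X Y f fi Y0 x|X Y f fs X0 y|X Y Z f g fg X0 Z0 y].
- by apply: fi; rewrite (Y0 (f x)) (Y0 (f 0)).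
- by have [x <-] := fs y; rewrite (X0 x) linear0.
- by have /fg[x <-] : g y = 0 by []; rewrite (X0 x) linear0.
Qed.

Lemma pair_projective P Q : projective P -> projective Q -> projective (P * Q)%type.
Proof.
move=> Pp Qp V W g f gs.
have l1 : linear (fun x : P => f (x, 0)).
  by move=> a x y; rewrite -[RHS]linearP; congr (f _); apply: injective_projections; rewrite /= ?scaler0 ?addr0.
have l2 : linear (fun x : Q => f (0, x)).
  by move=> a x y; rewrite -[RHS]linearP; congr (f _); apply: injective_projections; rewrite /= ?scaler0 ?addr0.
have [h1 e1] := Pp _ _ g (lin l1) gs; have [h2 e2] := Qp _ _ g (lin l2) gs.
have hl : linear (fun x : P * Q => h1 x.1 + h2 x.2).
  by move=> a x y; rewrite /= !linearP scalerDr addrACA.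
exists (lin hl) => -[x y] /=; rewrite linearD e1 e2 /= -linearD.
by congr (f _); apply: injective_projections; rewrite /= ?addr0 ?add0r.
Qed.

Lemma horseshoe A B M (i : {linear A -> B}) (g : {linear B -> M})
    (KA PA : lmodType R) (iA : {linear KA -> PA}) (gA : {linear PA -> A})
    (KM PM : lmodType R) (iM : {linear KM -> PM}) (gM : {linear PM -> M}) :
  short_exact i g -> projective PM ->
  short_exact iA gA -> short_exact iM gM ->
  exists (KB : lmodType R) (iB : {linear KB -> (PA * PM)%type}) (gB : {linear (PA * PM)%type -> B})
    (k : {linear KA -> KB}) (l : {linear KB -> KM}),
    [/\ short_exact iB gB, short_exact k l, forall x, iB (k x) = (iA x, 0) &
        forall x, iM (l x) = (iB x).2].
Proof.
move=> [ii ig gs] PMp [iiA igA gsA] sM; have [iiM igM gsM] := sM.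
have [s es] := PMp _ _ g gM gs.
have gBl : linear (fun x : PA * PM => i (gA x.1) + s x.2).
  by move=> a x y; rewrite /= !linearP scalerDr addrACA.
pose gB := lin gBl.
have gBs : surjective gB.
  move=> b; have [y ey] := gsM (g b).
  have /ig[a ea] : g (b - s y) = 0 by rewrite linearB es ey subrr.
  have [x ex] := gsA a; exists (x, y).
  by rewrite /= ex ea subrK.
have kl0 : linear (fun x => (iA x, 0 : PM)).
  by move=> a x y; rewrite linearP; apply: injective_projections; rewrite /= ?scaler0 ?addr0.
have l0 : linear (fun x : kernel gB => (ker_val gB x).2).
  by move=> a x y; rewrite linearP.
have sB := short_exact_ker gBs.
have [k ek] : exists k : {linear KA -> kernel gB},
    forall x, ker_val gB (k x) = lin kl0 x.
  apply: short_exact_ker_factor sB _ => x.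
  by rewrite /= (exact_comp0 x igA) !linear0 addr0.
have [l el] : exists l : {linear kernel gB -> KM}, forall x, iM (l x) = lin l0 x.
  apply: short_exact_ker_factor sM _ => x /=.
  have : gB (ker_val gB x) = 0 by apply/ker_val_exact; exists x.
  move/(congr1 g); rewrite linear0 /= linearD (exact_comp0 _ ig) add0r es; exact.
exists (kernel gB), (ker_val gB), gB, k, l; split=> //.
split.
- apply: linear_eq0_inj => x kx; apply: iiA; rewrite linear0.
  by have := ek x; rewrite kx linear0 => -[].
- move=> z; split=> [lz|[x <-]]; last first.
    by apply: iiM; rewrite el linear0; have /(congr1 snd) := ek x.
  have z2 : (ker_val gB z).2 = 0 by have := el z; rewrite lz linear0 => /esym.
  have : gB (ker_val gB z) = 0 by apply/ker_val_exact; exists z.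
  rewrite /= z2 linear0 addr0 => e0.
  have /igA[x ex] : gA (ker_val gB z).1 = 0 by apply: ii; rewrite e0 linear0.
  exists x; apply: ker_val_inj; rewrite ek.
  by apply: injective_projections; rewrite /= ?ex -?z2.
- move=> x.
  have /ig[a ea] : g (- s (iM x)) = 0.
    by rewrite linearN es (exact_comp0 _ igM) oppr0.
  have [y ey] := gsA a.
  have /ker_val_exact[z ez] : gB (y, iM x) = 0 by rewrite /= ey ea addNr.
  by exists z; apply: iiM; rewrite el -[RHS]/((y, iM x).2) -ez.
Qed.

(** The horseshoe construction gives a short exact sequence of syzygies, which reduces degree n + 2
    to degree n + 1. In degree 1 the exactness of Ext(M) -> Ext(B) -> Ext(A) at Ext(B) is checked by
    hand. *)
Lemma Ext_middle C n A B M (i : {linear A -> B}) (g : {linear B -> M}) N :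
  serre_class C -> short_exact i g ->
  C (Ext n.+1 A N) -> C (Ext n.+1 M N) -> C (Ext n.+1 B N).
Proof.
move=> Cs; elim: n A B M i g => [|n IH] A B M i g ig CA CM.
all: have sA := free_cover_short_exact A.
all: have sM := free_cover_short_exact M.
all: have PA := @malg_projective R A.
all: have PM := @malg_projective R M.
all: have [KB [iB [gB [k [l [sB kl ek el]]]]]] := horseshoe ig PM sA sM.
all: have PB := pair_projective PA PM.
  have {}CA := serre_iso Cs (isomorphic_sym (Ext1_hom_coker N PA sA)) CA.
  have {}CM := serre_iso Cs (isomorphic_sym (Ext1_hom_coker N PM sM)) CM.
  apply: (serre_iso Cs (Ext1_hom_coker N PB sB)); have [_ _ Cext] := Cs.
  have [f ef] : exists f : {linear hom_coker (ker_val (@free_cover R M)) N ->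
      hom_coker iB N}, forall u, f (coker_pi _ u) = (coker_pi _ \o precomp l N) u.
    apply: factor_surj => [|u]; first exact: coker_pi_surj.
    move=> /coker_pi_exact[w ew]; apply/coker_pi_exact.
    have sl : linear (fun x : {malg R[A]} * {malg R[M]} => w x.2).
      by move=> a x y; rewrite linearP.
    exists (to_hom (lin sl)); apply/val_inj/funext => x /=.
    by rewrite -ew /= -el.
  have [h eh] : exists h : {linear hom_coker iB N ->
      hom_coker (ker_val (@free_cover R A)) N},
      forall u, h (coker_pi _ u) = (coker_pi _ \o precomp k N) u.
    apply: factor_surj => [|u]; first exact: coker_pi_surj.
    move=> /coker_pi_exact[w ew]; apply/coker_pi_exact.
    have sl : linear (fun x : {malg R[A]} => w (x, 0)).
      by move=> a x y; rewrite -[RHS]linearP; congr (w _); apply: injective_projections; rewrite /= ?scaler0 ?addr0.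
    exists (to_hom (lin sl)); apply/val_inj/funext => x /=.
    by rewrite -ew /= ek.
  apply: (Cext _ _ _ f h _ CM CA) => e; split=> [|[e' <-]]; last first.
    have [u <-] := hom_coker_pi_surj e'; rewrite ef eh.
    apply/coker_pi_exact; exists 0; apply/val_inj/funext => x /=.
    have [_ kl0 _] := kl.
    by rewrite (exact_comp0 x kl0) linear0.
  have [u <-] := hom_coker_pi_surj e.
  rewrite eh => /coker_pi_exact[w ew].
  (* [w] extends [u] after [k] to the cover of A. Subtracting [w] of the first coordinate from [u]
     leaves a map that vanishes on the syzygy of A, so comes from the syzygy of M; the subtracted
     term extends to the whole cover and is trivial in Ext. *)
  have sl : linear (fun x : {malg R[A]} * {malg R[M]} => w x.1).
    by move=> a x y; rewrite linearP.
  have [v ev] : exists v : {linear kernel (@free_cover R M) -> N},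
      forall x, v (l x) = (u \- (lin sl \o iB)) x.
    apply: short_exact_coker_factor kl _ => x.
    have /= := congr1 (fun h : hom_module _ _ => h x) ew.
    by rewrite /= ek /= => ->; rewrite subrr.
  exists (hom_coker_pi _ v); rewrite ef; apply/esym/coker_pi_eq.
  exists (to_hom (lin sl)); apply/val_inj/funext => x.
  by rewrite -[RHS]/(u x - v (l x)) ev /= opprB addrC subrK.
have {}CA := serre_iso Cs (isomorphic_sym (Ext_shift n N PA sA)) CA.
have {}CM := serre_iso Cs (isomorphic_sym (Ext_shift n N PM sM)) CM.
exact: serre_iso Cs (Ext_shift n N PB sB) (IH _ _ _ k l kl CA CM).
Qed.

End SerreClasses.

(** * Grade, the Auslander condition and Noetherian modules *)

Section GradeClasses.
Context {R : comNzRingType}.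
Implicit Types (A B E I U V W K P Q M N L X Y Z : lmodType R).
Implicit Types (C : lmodType R -> Prop).

Lemma Ext0_eq0 M N :
  zero_module (Ext 0 M N) <-> forall (u : {linear M -> N}) x, u x = 0.
Proof.
split=> [M0 u x|M0].
  have /(_ (to_hom u)) := isomorphic_zero (isomorphic_sym (Ext0_hom M N)) M0.
  by move/(congr1 (fun h : hom_module _ _ => h x)).
apply: isomorphic_zero (Ext0_hom M N) _ => u.
by apply/val_inj/funext => x; apply: M0.
Qed.

Lemma Ext_zero_middle n A B M (i : {linear A -> B}) (g : {linear B -> M}) N :
  short_exact i g -> zero_module (Ext n A N) -> zero_module (Ext n M N) ->
  zero_module (Ext n B N).
Proof.
case: n => [|n] ig; last exact: Ext_middle zero_serre ig.
move=> /Ext0_eq0 A0 /Ext0_eq0 M0; apply/Ext0_eq0 => u x.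
have [k ek] : exists k : {linear M -> N}, forall x, k (g x) = u x.
  by apply: short_exact_coker_factor ig _ => y; rewrite -[LHS]/((u \o i) y) A0.
by rewrite -ek M0.
Qed.

(** Substitute for the connecting map. For a free cover [c] of B, the kernel of [g] after [c] is a
    syzygy of M and an extension of A by [kernel c], a syzygy of B. Shifting thus turns the right
    end of the sequence into a middle term. *)
Lemma Ext_zero_right n A B M (i : {linear A -> B}) (g : {linear B -> M}) N :
  short_exact i g -> zero_module (Ext n A N) -> zero_module (Ext n.+1 B N) ->
  zero_module (Ext n.+1 M N).
Proof.
move=> [ii ig gs] A0 B0.
have sB := free_cover_short_exact B; have [_ cE cs] := sB.
have PB := @malg_projective R B; pose c := @free_cover R B.
have ws : surjective (g \o c).
  by move=> m; have [b <-] := gs m; have [x <-] := cs b; exists x.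
have sM := short_exact_ker ws.
have [k ek] : exists k : {linear kernel c -> kernel (g \o c)},
    forall x, ker_val _ (k x) = ker_val c x.
  apply: short_exact_ker_factor sM _ => x.
  have c0 : c (ker_val c x) = 0 by apply: exact_comp0 cE.
  by rewrite -[LHS]/(g (c _)) c0 linear0.
have [l el] : exists l : {linear kernel (g \o c) -> A},
    forall x, i (l x) = (c \o ker_val _) x.
  by apply: factor_inj => // x; apply/ig/(ker_val_exact (g \o c)); exists x.
have kl : short_exact k l.
  split.
  - by apply: linear_eq0_inj => x kx; apply: ker_val_inj; rewrite -ek kx !linear0.
  - move=> y; split=> [ly|[x <-]].
      have /cE[x ex] : c (ker_val _ y) = 0 by rewrite -[LHS]el ly linear0.
      by exists x; apply: ker_val_inj; rewrite ek.
    apply: ii; rewrite linear0 el -[LHS]/(c (ker_val _ (k x))) ek.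
    exact: exact_comp0 cE.
  - move=> a; have [x ex] := cs (i a).
    have /ker_val_exact[y ey] : (g \o c) x = 0 by rewrite -[LHS]/(g (c x)) [c x]ex (exact_comp0 a ig).
    by exists y; apply: ii; rewrite el -[LHS]/(c (ker_val _ y)) ey.
case: n A0 B0 => [/Ext0_eq0 A0|n A0] B0; last first.
  apply: isomorphic_zero (Ext_shift n N PB sM) _.
  apply: Ext_zero_middle kl _ A0.
  exact: isomorphic_zero (isomorphic_sym (Ext_shift n N PB sB)) B0.
apply: isomorphic_zero (Ext1_hom_coker N PB sM) _ => e.
have [u <-] := hom_coker_pi_surj e; apply/hom_coker_pi_eq0.
have {}B0 := isomorphic_zero (isomorphic_sym (Ext1_hom_coker N PB sB)) B0.
have /hom_coker_pi_eq0[w ew] := B0 (hom_coker_pi _ (u \o k)).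
have [v ev] : exists v : {linear A -> N}, forall x, v (l x) = (u \- (w \o ker_val _)) x.
  by apply: short_exact_coker_factor kl _ => x;
     rewrite -[LHS]/(u (k x) - w (ker_val _ (k x))) ek -ew subrr.
by exists w => x; apply/eqP; rewrite -subr_eq0 -[X in X == _]ev A0.
Qed.

Definition grade_ge (n : nat) E :=
  forall i, (i < n)%N -> zero_module (Ext i E R^o).

(* For a finitely generated module over a Noetherian ring this says no more
   than that the grade is at least n, but in this form it is visibly inherited by
   submodules. *)
Definition submodules_grade_ge (n : nat) X :=
  forall E (f : {linear E -> X}), injective f -> grade_ge n E.

Lemma submodules_grade_ge_self n X : submodules_grade_ge n X -> grade_ge n X.
Proof. by move/(_ X idfun); apply. Qed.

Lemma submodules_grade_ge_sub n X Y (f : {linear X -> Y}) :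
  injective f -> submodules_grade_ge n Y -> submodules_grade_ge n X.
Proof. by move=> fi Yn E g gi; apply: (Yn _ (f \o g)); apply: inj_comp. Qed.

(** A submodule E of Y is the quotient of its preimage in X by the kernel of the induced map. Both
    are submodules of X, and [Ext_zero_right] passes the vanishing to E. *)
Lemma submodules_grade_ge_quot n X Y (q : {linear X -> Y}) :
  surjective q -> submodules_grade_ge n X -> submodules_grade_ge n Y.
Proof.
move=> qs Xn E f fi [|i] lti.
  apply/Ext0_eq0 => u x.
  pose r := coker_pi f \o q; have [y ey] := qs (f x).
  have [l el] : exists l : {linear kernel r -> E},
      forall x, f (l x) = (q \o ker_val r) x.
    apply: factor_inj => // z; apply/coker_pi_exact.
    by apply/(ker_val_exact r); exists z.
  have /Ext0_eq0 X0 := Xn _ (ker_val r) (@ker_val_inj _ _ _ r) 0%N lti.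
  have /ker_val_exact[z ez] : r y = 0.
    by rewrite /r /= ey; apply/coker_pi_exact; exists x.
  have -> : x = l z by apply: fi; rewrite el -ey -ez.
  by rewrite -[LHS]/((u \o l) z) X0.
pose r := coker_pi f \o q.
have [l el] : exists l : {linear kernel r -> E},
    forall x, f (l x) = (q \o ker_val r) x.
  apply: factor_inj => // z; apply/coker_pi_exact.
  by apply/(ker_val_exact r); exists z.
have ls : surjective l.
  move=> x; have [y ey] := qs (f x).
  have /ker_val_exact[z ez] : r y = 0.
    by rewrite /r /= ey; apply/coker_pi_exact; exists x.
  by exists z; apply: fi; rewrite el -ey -ez.
have r_inj := @ker_val_inj _ _ _ r.
apply: Ext_zero_right (short_exact_ker ls) _ _.
  apply: (Xn _ (ker_val r \o ker_val l)) (ltnW lti).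
  by apply: inj_comp; [|exact: ker_val_inj].
exact: Xn r_inj _ lti.
Qed.

Lemma submodules_grade_ge_serre n : serre_class (submodules_grade_ge n).
Proof.
split=> [X Y f|X Y f|X Y Z f g fg Xn Zn].
- exact: submodules_grade_ge_sub.
- exact: submodules_grade_ge_quot.
move=> E h hi i lti.
have [I [e [j [es ji ej]]]] := image_ex f.
have In : submodules_grade_ge n I by apply: submodules_grade_ge_quot es Xn.
have [G [d [k [ds ki ek]]]] := image_ex (g \o h).
have [m em] : exists m : {linear kernel d -> I}, forall x, j (m x) = (h \o ker_val d) x.
  apply: factor_inj => // x.
  have /fg[y ey] : g (h (ker_val d x)) = 0.
    rewrite -[LHS]/((g \o h) _) ek; have [_ dE _] := short_exact_ker ds.
    by rewrite (exact_comp0 x dE) linear0.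
  by exists (e y); rewrite -ej.
have mi : injective m.
  apply: linear_eq0_inj => x mx; apply: ker_val_inj; apply: hi.
  by rewrite -[LHS]em mx !linear0.
apply: Ext_zero_middle (short_exact_ker ds) _ _.
  exact: In mi _ lti.
exact: Zn ki _ lti.
Qed.

Definition auslander N :=
  forall n, submodules_grade_ge n (Ext n N R^o).

Lemma auslander_extension A B M (i : {linear A -> B}) (g : {linear B -> M}) :
  short_exact i g -> auslander A -> auslander M -> auslander B.
Proof.
move=> ig Aa Ma [|n]; first by move=> E f _ [].
exact: Ext_middle (submodules_grade_ge_serre n.+1) ig (Aa _) (Ma _).
Qed.

Lemma auslander_Ext_zero N :
  (forall n, zero_module (Ext n.+1 N R^o)) -> auslander N.
Proof.
move=> N0 [|n] E f fi i lti //; have E0 : zero_module E.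
  by move=> x; apply: fi; rewrite (N0 n (f x)) linear0.
case: i lti => [|i] lti.
  by apply/Ext0_eq0 => u x; rewrite (E0 x) linear0.
apply: Ext_projective => V W g h gs.
by exists \0 => x; rewrite (E0 x) !linear0.
Qed.

Lemma finitely_generated_quot X Y (f : {linear X -> Y}) :
  surjective f -> finitely_generated X -> finitely_generated Y.
Proof.
move=> fs [n [g gs]]; exists n, (f \o g) => y.
by have [x <-] := fs y; have [v <-] := gs x; exists v.
Qed.

Lemma finite_free_fg M : finite_free M -> finitely_generated M.
Proof. by move=> [n [f /bij_surj fs]]; exists n, f. Qed.

Lemma finitely_generated_extension A B M (i : {linear A -> B}) (g : {linear B -> M}) :
  short_exact i g -> finitely_generated A -> finitely_generated M ->
  finitely_generated B.
Proof.
move=> [ii ig gs] [a [f fs]] [m [h hs]].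
have [k ek] := row_projective h gs; exists (a + m)%N.
have fl : linear (fun v : 'rV[R]_(a + m) => i (f (lsubmx v)) + k (rsubmx v)).
  by move=> r x y; rewrite !linearP scalerDr addrACA.
exists (lin fl) => b; have [w ew] := hs (g b).
have /ig[x ex] : g (b - k w) = 0 by rewrite linearB ek ew subrr.
have [v ev] := fs x; exists (row_mx v w).
by rewrite /= row_mxKl row_mxKr ev ex subrK.
Qed.

Definition noetherian N :=
  forall E (f : {linear E -> N}), injective f -> finitely_generated E.

Lemma noetherian_extension A B M (i : {linear A -> B}) (g : {linear B -> M}) :
  short_exact i g -> noetherian A -> noetherian M -> noetherian B.
Proof.
move=> [ii ig gs] An Mn E f fi.
have [G [d [k [ds ki ek]]]] := image_ex (g \o f).
have [m em] : exists m : {linear kernel d -> A}, forall x, i (m x) = (f \o ker_val d) x.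
  apply: factor_inj => // x; apply/ig.
  rewrite -[LHS]/((g \o f) _) ek; have [_ dE _] := short_exact_ker ds.
  by rewrite (exact_comp0 x dE) linear0.
have mi : injective m.
  apply: linear_eq0_inj => x mx; apply: ker_val_inj; apply: fi.
  by rewrite -[LHS]em mx !linear0.
exact: finitely_generated_extension (short_exact_ker ds) (An _ _ mi) (Mn _ _ ki).
Qed.

Definition generator N (x : N) := forall y, exists a, y = a *: x.

Definition cyclic N := exists x : N, generator x.

Lemma scale_linear (a : R) N : linear (fun x : N => a *: x).
Proof. by move=> b x y; rewrite scalerDr !scalerA mulrC. Qed.

Lemma mul_linear N (x : N) : linear (fun a : R^o => a *: x : N).
Proof. by move=> b a c; rewrite scalerDl scalerA. Qed.

Lemma cyclic_quot X Y (f : {linear X -> Y}) : surjective f -> cyclic X -> cyclic Y.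
Proof.
move=> fs [x xg]; exists (f x) => y; have [z <-] := fs y.
by have [a ->] := xg z; exists a; rewrite linearZ.
Qed.

(** A cyclic N is an extension of N/pN by pN, both cyclic, and pN is killed by one power of p less.
    A module with n + 1 generators is an extension of one with n generators by a cyclic one. *)
Lemma fg_devissage C (p : R) (e : nat) : p ^+ e = 0 ->
  (forall A B M (i : {linear A -> B}) (g : {linear B -> M}),
     short_exact i g -> C A -> C M -> C B) ->
  (forall N, cyclic N -> (forall x : N, p *: x = 0) -> C N) ->
  forall N, finitely_generated N -> C N.
Proof.
move=> pe Cext Cp.
have Cc : forall k N, cyclic N -> (forall x : N, p ^+ k *: x = 0) -> C N.
  elim=> [|k IH] N Nc pN.
    by apply: Cp => // x; have := pN x; rewrite scale1r => ->; rewrite scaler0.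
  have [I [d [j [ds ji ej]]]] := image_ex (lin (@scale_linear p N)).
  have sj := short_exact_coker ji.
  apply: Cext sj (IH _ (cyclic_quot ds Nc) _) (Cp _ (cyclic_quot (@coker_pi_surj _ _ _ j) Nc) _).
    move=> y; have [x <-] := ds y; apply: ji.
    by rewrite linearZ_LR -ej /= scalerA -exprSr pN linear0.
  move=> y; have [x <-] := @coker_pi_surj _ _ _ j y; rewrite -linearZ_LR /=.
  by apply/coker_pi_exact; exists (d x); rewrite -ej.
move=> N [n]; elim: n N => [|n IH] N [f fs].
  apply: Cp => [|x]; last first.
    by have [v <-] := fs x; rewrite (_ : v = 0) ?linear0 ?scaler0 //; apply/rowP; case.
  exists 0 => x; exists 0; have [v <-] := fs x.
  by rewrite scaler0 (_ : v = 0) ?linear0 //; apply/rowP; case.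
pose x := f (row_mx (1%:M : 'rV_1) 0 : 'rV_(1 + n)).
have [I [d [j [ds ji ej]]]] := image_ex (lin (mul_linear x)).
apply: Cext (short_exact_coker ji) (Cc e _ _ _) (IH _ _).
- apply: cyclic_quot ds _; exists 1 => a; exists a.
  by rewrite -[RHS]/(a * 1) mulr1.
- by move=> y; rewrite pe scale0r.
have rl a (u v : 'rV[R]_n) :
    row_mx 0 (a *: u + v) = a *: row_mx 0 u + row_mx 0 v :> 'rV_(1 + n).
  by rewrite scale_row_mx add_row_mx scaler0 addr0.
have hl : linear (fun v : 'rV[R]_n => coker_pi j (f (row_mx (0 : 'rV_1) v : 'rV_(1 + n)))).
  move=> a u v; rewrite -[RHS]linearP; congr (coker_pi _ _).
  rewrite -[RHS]linearP; congr (f _); exact: rl.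
exists (lin hl) => y; have [z <-] := @coker_pi_surj _ _ _ j y.
have [v <-] := fs z; exists (rsubmx (v : 'rV_(1 + n))) => /=.
have ev : v = (lsubmx (v : 'rV_(1 + n))) 0 0 *: row_mx 1%:M 0 +
    row_mx 0 (rsubmx (v : 'rV_(1 + n))) :> 'rV_(1 + n).
  rewrite scale_row_mx add_row_mx scaler0 add0r addr0 scale_scalar_mx mulr1.
  by rewrite -mx11_scalar hsubmxK.
apply/esym/coker_pi_eq; exists (d ((lsubmx (v : 'rV_(1 + n))) 0 0)).
rewrite -ej /= {2}ev.
by rewrite [X in _ = X - _]linearP addrK.
Qed.

(* R/a has the periodic resolution ... -a-> R -b-> R -a-> R. *)
Lemma Ext_exact_pair n (a b : R) N (x : N) :
  (forall c, a * c = 0 <-> exists d, c = b * d) ->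
  (forall c, b * c = 0 <-> exists d, c = a * d) ->
  generator x -> (forall c, c *: x = 0 <-> exists d, c = a * d) ->
  zero_module (Ext n.+1 N R^o).
Proof.
elim: n a b N x => [|n IH] a b N x annA annB xg annx.
all: have gs : surjective (lin (mul_linear x)).
1,3: by move=> y; have [c ->] := xg y; exists c.
all: have sx := short_exact_ker gs.
all: have Rp := @regular_projective R.
all: have /ker_val_exact[y ey] : lin (mul_linear x) a = 0.
1,3: by apply/annx; exists 1; rewrite mulr1.
all: have yg : generator y.
1,3: move=> z; have /annx[c ec] : (ker_val (lin (mul_linear x)) z : R) *: x = 0.
1,3: by apply/(ker_val_exact (lin (mul_linear x))); exists z.
1,2: exists c; apply: ker_val_inj; rewrite linearZ_LR ey ec; exact: mulrC.
  apply: isomorphic_zero (Ext1_hom_coker R^o Rp sx) _ => e.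
  have [u <-] := hom_coker_pi_surj e; apply/hom_coker_pi_eq0.
  have [c ec] : exists c, u y = a * c.
    apply/annB; rewrite -[LHS]/(b *: u y) -linearZ_LR /=.
    suff -> : b *: y = 0 by rewrite linear0.
    apply: ker_val_inj; rewrite linearZ_LR ey linear0.
    by apply/annB; exists 1; rewrite mulr1.
  exists (lin (mul_linear (c : R^o))) => z; have [d ->] := yg z.
  have ed : ker_val (lin (mul_linear x)) (d *: y) = d * a by rewrite linearZ_LR ey.
  by rewrite ed linearZ_LR ec; apply: mulrA.
apply: isomorphic_zero (Ext_shift n R^o Rp sx) _.
apply: (IH b a _ y) => // c; rewrite -annA; split=> [cy|ca].
  have := congr1 (ker_val _) cy.
  by rewrite linearZ_LR ey linear0 mulrC.
apply: ker_val_inj; rewrite linearZ_LR ey linear0.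
by rewrite -[LHS]/(c * a) mulrC.
Qed.

End GradeClasses.

(** * Change of rings along a Frobenius quotient *)

(** The underlying type is M itself, so maps, kernels and exactness pass between R and R' by
    conversion. *)
Definition restr {R' R : comNzRingType} (iota : {rmorphism R' -> R})
  (M : lmodType R) : Type := M.

Section Restriction.
Context {R' R : comNzRingType} (iota : {rmorphism R' -> R}).
Local Notation restr M := (restr iota M).

Section Module.
Context (M : lmodType R).

HB.instance Definition _ := GRing.Zmodule.on (restr M).

Definition restr_scale (r : R') (x : restr M) : restr M := iota r *: (x : M).

Lemma restr_scaleA a b x : restr_scale a (restr_scale b x) = restr_scale (a * b) x.
Proof. by rewrite /restr_scale scalerA rmorphM. Qed.

Lemma restr_scale1 : left_id 1 restr_scale.
Proof. by move=> x; rewrite /restr_scale rmorph1 scale1r. Qed.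

Lemma restr_scaleDr : right_distributive restr_scale +%R.
Proof. by move=> a x y; rewrite /restr_scale [LHS]scalerDr. Qed.

Lemma restr_scaleDl x : {morph restr_scale^~ x : a b / a + b}.
Proof. by move=> a b; rewrite /restr_scale rmorphD [LHS]scalerDl. Qed.

HB.instance Definition _ := GRing.Zmodule_isLmodule.Build R' (restr M)
  restr_scaleA restr_scale1 restr_scaleDr restr_scaleDl.
End Module.

Section Map.
Context {U V : lmodType R} (f : {linear U -> V}).

Definition restr_fun : restr U -> restr V := f.

Lemma restr_fun_linear : linear restr_fun.
Proof. by move=> a x y; rewrite /restr_fun [LHS]linearP. Qed.

Definition restr_map : {linear restr U -> restr V} := lin restr_fun_linear.
End Map.

Lemma restr_short_exact (A B M : lmodType R) (i : {linear A -> B}) (g : {linear B -> M}) :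
  short_exact i g -> short_exact (restr_map i) (restr_map g).
Proof. by []. Qed.

Lemma restr_serre (C : lmodType R' -> Prop) :
  serre_class C -> serre_class (fun X => C (restr X)).
Proof.
move=> [Csub Cquot Cext]; split=> [X Y f|X Y f|X Y Z f g].
- exact: Csub (restr_map f).
- exact: Cquot (restr_map f).
- exact: Cext (restr_map f) (restr_map g).
Qed.

Lemma restr_finitely_generated (M : lmodType R) :
  finitely_generated (restr M : lmodType R') -> finitely_generated M.
Proof.
move=> [n [h hs]]; exists n.
have gl : linear (fun v : 'rV[R]_n => \sum_i v 0 i *: (h (delta_mx 0 i) : M)).
  move=> a u v; rewrite scaler_sumr -big_split; apply: eq_bigr => i _.
  by rewrite !mxE scalerDl scalerA.
exists (lin gl) => x; have [v <-] := hs x; exists (\row_i iota (v 0 i)).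
rewrite /= [in RHS](row_sum_delta v) linear_sum; apply: eq_bigr => i _.
by rewrite mxE linearZ_LR.
Qed.

Lemma restr_noetherian (M : lmodType R) :
  noetherian (restr M : lmodType R') -> noetherian M.
Proof.
move=> Mn E f fi; apply: restr_finitely_generated.
exact: Mn (restr_map f) fi.
Qed.

(* R/f is a free R'-module on e_1, ..., e_d with coordinate functions fq_coord,
   and fq_trace generates Hom_R'(R/f, R') freely over R/f. *)
Record frobenius_quotient := FrobeniusQuotient {
  fq_rel : R;
  fq_reg : forall a, fq_rel * a = 0 -> a = 0;
  fq_dim : nat;
  fq_basis : 'I_fq_dim -> R;
  fq_coord : {linear restr R^o -> 'rV[R']_fq_dim};
  fq_coord_rel : forall a, fq_coord (fq_rel * a) = 0;
  fq_coordP : forall a, exists b,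
    a = \sum_i iota (fq_coord a 0 i) * fq_basis i + fq_rel * b;
  fq_trace : {linear restr R^o -> R'^o};
  fq_trace_rel : forall a, fq_trace (fq_rel * a) = 0;
  fq_trace_nondegenerate : forall a, (forall b, fq_trace (b * a) = 0) ->
    exists c, a = fq_rel * c;
  fq_trace_generates : forall phi : {linear restr R^o -> R'^o},
    (forall a, phi (fq_rel * a) = 0) -> exists s, forall a, phi a = fq_trace (a * s)
}.

End Restriction.
Arguments fq_reg {R' R iota} f [a].
Arguments fq_basis {R' R iota} f i.
Arguments fq_coord {R' R iota} f.
Arguments fq_coord_rel {R' R iota} f a.
Arguments fq_coordP {R' R iota} f a.
Arguments fq_trace_rel {R' R iota} f a.
Arguments fq_trace_nondegenerate {R' R iota} f [a].
Arguments fq_trace_generates {R' R iota} f [phi].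

Section ChangeOfRings.
Context {R' R : comNzRingType} (iota : {rmorphism R' -> R}).
Context (fq : frobenius_quotient iota).
Local Notation f := (fq_rel fq).
Local Notation lam := (fq_trace fq).
Local Notation res M := (restr iota M).
Local Notation resm h := (restr_map iota h).
Implicit Types (M N K L E : lmodType R).

Let killed M := forall x : M, f *: x = 0.

Lemma restr_cyclic_fg N : cyclic N -> killed N -> finitely_generated (res N : lmodType R').
Proof.
move=> [x xg] fN; exists (fq_dim fq).
have gl : linear (fun v : 'rV[R']_(fq_dim fq) =>
    \sum_i v 0 i *: (fq_basis fq i *: x : res N)).
  move=> a u v; rewrite scaler_sumr -big_split; apply: eq_bigr => i _.
  by rewrite !mxE scalerDl scalerA.
exists (lin gl) => y; have [a ->] := xg y; exists (fq_coord fq a).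
have [b eb] := fq_coordP fq a.
rewrite [X in _ = X *: x]eb scalerDl -scalerA fN addr0 scaler_suml.
by apply: eq_bigr => i _; rewrite -scalerA.
Qed.

Section FreeQuotient.
Context (X : choiceType).
Local Notation P := {malg R[X]}.

Definition rel_mul : {linear P -> P} := lin (@scale_linear R f P).

Lemma rel_mul_inj : injective rel_mul.
Proof.
apply: linear_eq0_inj => p /= fp; apply/malgP => x; rewrite mcoeff0.
by apply: (fq_reg fq); rewrite -mcoeffZ fp mcoeff0.
Qed.

(** Over R' the module P is a direct sum of copies of R, not of R'; a map out of it is given by one
    R'-linear map on each copy, where [malg_lift] takes one vector. *)
Lemma malg_sum_linear (V : lmodType R') (G : X -> {linear res R^o -> V}) :
  linear (fun p : res P => \sum_(x <- msupp (p : P)) G x ((p : P)@_x)).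
Proof.
have Gw (d : {fset X}) (p : P) : (msupp p `<=` d)%fset ->
    \sum_(x <- msupp p) G x p@_x = \sum_(x <- d) G x p@_x.
  move=> le_d; apply: big_fset_incl => // x _ /mcoeff_outdom ->.
  by rewrite linear0.
move=> a p q; pose d := (msupp (p : P) `|` msupp (q : P) `|` msupp (a *: p + q : P))%fset.
rewrite (Gw d) ?fsubsetUr // (Gw d p); last first.
  by rewrite /d -fsetUA fsubsetUl.
rewrite (Gw d q); last first.
  by rewrite /d [Y in (Y `|` _)%fset]fsetUC -fsetUA fsubsetUl.
rewrite scaler_sumr -big_split; apply: eq_bigr => x _ /=.
rewrite -linearP; congr (G x _).
by rewrite -[a *: p]/(iota a *: (p : P)) mcoeffD mcoeffZ.
Qed.

Lemma malg_sumU (V : lmodType R') (G : X -> {linear res R^o -> V}) (c : R) x :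
  lin (malg_sum_linear G) (c *: << x >> : P) = G x c.
Proof.
rewrite /= -malgUZ msuppU; case: eqP => [->|_].
  by rewrite big_seq_fset0 linear0.
by rewrite big_seq_fset1 mcoeffUU.
Qed.

Lemma restr_malg_ext (V : lmodType R') (u v : {linear res P -> V}) :
  (forall c x, u (c *: << x >> : P) = v (c *: << x >> : P)) -> forall p, u p = v p.
Proof.
move=> uv; apply: (@malg_ind R X (fun p => u p = v p)) => [|c x p IH].
  exact: etrans (linear0 u) (esym (linear0 v)).
apply: etrans (linearD u _ _) (etrans _ (esym (linearD v _ _))).
by rewrite uv IH.
Qed.

(** P/fP is a direct sum of copies of R/f, hence free over R' on the products of [fq_basis] with the
    generators of P. The lift is prescribed on these products. *)
Lemma restr_free_quotient_projective : projective (res (coker rel_mul) : lmodType R').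
Proof.
move=> V W g phi gs; pose s y := projT1 (cid (gs y)).
have sK y : g (s y) = y by rewrite /s; case: cid.
pose v x i := s (phi (coker_pi rel_mul (fq_basis fq i *: << x >>))).
have Gl x : linear (fun a : res R^o => \sum_i fq_coord fq a 0 i *: v x i).
  move=> a b c; rewrite linearP scaler_sumr -big_split; apply: eq_bigr => i _.
  by rewrite !mxE scalerDl scalerA.
pose h0 := lin (malg_sum_linear (fun x => lin (Gl x))).
have [h eh] : exists h : {linear res (coker rel_mul) -> V},
    forall p : P, h (coker_pi rel_mul p) = h0 p.
  apply: (@factor_surj _ _ _ _ (resm (coker_pi rel_mul)) h0).
    exact: coker_pi_surj.
  move=> p /(@coker_pi_exact _ _ _ rel_mul)[q <-].
  pose h1 := h0 \o resm rel_mul.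
  suff e : forall p, h1 p = (\0 : {linear res P -> V}) p by apply: e.
  apply: restr_malg_ext => c x.
  rewrite -[LHS]/(h0 (f *: (c *: << x >>))) scalerA malg_sumU /=.
  by rewrite (fq_coord_rel fq); apply: big1 => i _; rewrite mxE scale0r.
exists h => y; have [p <-] := @coker_pi_surj _ _ _ rel_mul y.
rewrite eh; pose pi := resm (coker_pi rel_mul).
suff e : forall p, (g \o h0) p = (phi \o pi) p by apply: e.
apply: restr_malg_ext => c x.
rewrite -[LHS]/(g (h0 _)) malg_sumU -[RHS]/(phi (coker_pi rel_mul (c *: << x >>))).
rewrite -[LHS]/(g (\sum_i fq_coord fq c 0 i *: v x i)) linear_sum.
have [b eb] := fq_coordP fq c.
have -> : coker_pi rel_mul (c *: << x >>) =
    coker_pi rel_mul (\sum_i (iota (fq_coord fq c 0 i) * fq_basis fq i) *: << x >>).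
  apply/coker_pi_eq; exists (b *: << x >>).
  by rewrite -scaler_suml -scalerBl {1}eb addrAC subrr add0r -scalerA.
rewrite -[RHS]/((phi \o pi) _) linear_sum; apply: eq_bigr => i _.
rewrite linearZ_LR /v sK -scalerA.
rewrite -[RHS]/((phi \o pi) (fq_coord fq c 0 i *: (fq_basis fq i *: << x >> : res P))).
by rewrite [RHS]linearZ_LR.
Qed.

(** The trace identifies Hom over R' from R/f to R' with R/f. Applied on each generator of P, this
    represents [phi] by an R-linear map. *)
Lemma trace_lift (phi : {linear res (coker rel_mul) -> R'^o}) :
  exists w : {linear P -> R^o}, forall p, lam (w p) = phi (coker_pi rel_mul p).
Proof.
pose pi := resm (coker_pi rel_mul).
have sx x : exists s, forall a, phi (coker_pi rel_mul (a *: << x >>)) = lam (a * s).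
  have pl : linear (fun a : res R^o => phi (coker_pi rel_mul (a *: << x >> : P)) : R'^o).
    move=> a b c; rewrite -[RHS]linearP; congr (phi _).
    rewrite -[RHS](linearP pi); congr (coker_pi _ _).
    by rewrite scalerDl -scalerA.
  apply: (fq_trace_generates fq (phi := lin pl)) => a /=.
  rewrite -[RHS](linear0 phi); congr (phi _); apply/coker_pi_exact.
  by exists (a *: << x >>); rewrite /= scalerA.
pose w := malg_lift (fun x => projT1 (cid (sx x)) : R^o) : {linear P -> R^o}.
exists w => p.
suff e : forall p, (lam \o resm w) p = (phi \o pi) p by apply: e.
apply: restr_malg_ext => c x.
rewrite -[LHS]/(lam (w (c *: << x >>))) linearZ_LR /= malg_liftU.
by case: cid => s es /=; rewrite -es.
Qed.
End FreeQuotient.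

(** By linearity the trace kills every multiple of [u x], so nondegeneracy puts [u x] in fR;
    regularity of f makes the quotient unique, hence linear. *)
Lemma trace_divisible M (u : {linear M -> R^o}) :
  (forall x, lam (u x) = 0) -> exists v : {linear M -> R^o}, forall x, u x = f * v x.
Proof.
move=> u0; have fl := @scale_linear R f R^o.
have [|x|v ev] := @factor_inj _ _ _ _ (lin fl) u.
- apply: linear_eq0_inj => a; exact: (fq_reg fq).
- have [b|c ec] := fq_trace_nondegenerate fq (a := u x).
    by rewrite -[b * _]/(b *: u x) -linearZ_LR u0.
  by exists c.
by exists v => x; rewrite -ev.
Qed.

End ChangeOfRings.

(** * Annihilators of Ext modules *)

Section ScalarAction.
Context {R : comNzRingType}.
Implicit Types (M N : lmodType R).

Lemma stably_zero_scale (c : R) (K P M : lmodType R) (i : {linear K -> P})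
    (g : {linear P -> M}) :
  short_exact i g -> stably_zero (fun x : M => c *: x) ->
  exists h : {linear P -> K}, forall x, c *: x = h (i x).
Proof.
move=> ig; apply: (stably_zero_syzygy (Phi := fun x => c *: x) ig ig) => [|x|x].
- exact: scale_linear.
- by rewrite linearZ_LR.
- by rewrite linearZ_LR.
Qed.

(** The syzygies of M are not killed by c, but multiplication by c is stably zero on M, hence on
    each of them; on the last one it extends to the free cover, which makes c times any class
    trivial. *)
Lemma Ext_scale0 n (c : R) M N : (forall x : M, c *: x = 0) ->
  forall e : Ext n.+1 M N, c *: e = 0.
Proof.
move=> cM; have [h hb] := Ext_std n M N => e; have [e' <-] := bij_surj hb e.
rewrite -linearZ_LR; have [u <-] := hom_coker_pi_surj e'.
have sc : stably_zero (fun x : std_syzygy M n => c *: x).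
  elim: n {h hb e e' u} => [|n IH] /=.
    exists (R^o : lmodType R), \0, \0.
    by split=> [|x]; [exact: regular_projective | rewrite cM].
  have [k ek] := stably_zero_scale (free_cover_short_exact (std_syzygy M n)) IH.
  exists (std_obj M n), (ker_val (@free_cover R _)), k.
  by split=> //; exact: malg_projective.
have [k ek] := stably_zero_scale (free_cover_short_exact (std_syzygy M n)) sc.
suff -> : c *: hom_coker_pi (ker_val (@free_cover R (std_syzygy M n))) u = 0.
  by rewrite linear0.
apply: (etrans (esym (linearZ_LR (coker_pi _) c (to_hom u)))).
apply/coker_pi_exact; exists (to_hom (u \o k)); apply/val_inj/funext => x.
by rewrite -[LHS]/(u (k _)) -ek linearZ_LR.
Qed.

End ScalarAction.

(** * Comparison of Ext over R and over R' for modules killed by f *)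

Section ChangeOfRingsExt.
Context {R' R : comNzRingType} (iota : {rmorphism R' -> R}).
Context (fq : frobenius_quotient iota).
Local Notation f := (fq_rel fq).
Local Notation lam := (fq_trace fq).
Local Notation res M := (restr iota M).
Local Notation resm h := (restr_map iota h).
Implicit Types (M N K L E P Q : lmodType R).

Local Notation killed M := (forall x : M, f *: x = 0).

Lemma hom_factor_family (A : comNzRingType) (T U V W : lmodType A)
    (g : {linear U -> V}) (H : {linear T -> hom_module U W}) :
  surjective g -> (forall t x, g x = 0 -> H t x = 0) ->
  exists k : {linear T -> hom_module V W}, forall t x, k t (g x) = H t x.
Proof.
move=> gs gH; have [||k ek] := @factor_inj _ _ _ _ (precomp g W) H.
- apply: linear_eq0_inj => u u0; apply/val_inj/funext => y.
  by have [x <-] := gs y; have := congr1 (fun h : hom_module _ _ => h x) u0.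
- move=> t; have [w ew] := factor_surj gs (gH t).
  by exists (to_hom w); apply/val_inj/funext => x; rewrite /= ew.
by exists k => t x; have := congr1 (fun h : hom_module _ _ => h x) (ek t).
Qed.

Lemma trace_family L Q (t : {linear Q -> L}) :
  exists H : {linear res (hom_module L R^o) -> hom_module (res Q) R'^o},
    forall (u : hom_module L R^o) z, H u z = lam (u (t z)).
Proof.
have hl (u : hom_module L R^o) : linear (fun z : res Q => lam (u (t z)) : R'^o).
  move=> a x y; rewrite -[RHS]linearP; congr (lam _).
  by rewrite -[a *: x]/(iota a *: (x : Q)) !linearP.
have Hl : linear (fun u : res (hom_module L R^o) => to_hom (lin (hl u))).
  move=> a u v; apply/val_inj/funext => z.
  by rewrite -[RHS]/(a *: lam ((u : hom_module L R^o) (t z)) +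
    lam ((v : hom_module L R^o) (t z))) -[RHS]linearP.
by exists (lin Hl).
Qed.

Lemma killed_mul N K P (i : {linear K -> P}) (g : {linear P -> N}) :
  killed N -> short_exact i g ->
  exists m : {linear P -> K}, forall x, i (m x) = f *: x.
Proof.
move=> fN ig; apply: (short_exact_ker_factor (h := lin (@scale_linear R f P)) ig) => x.
by rewrite linearZ_LR fN.
Qed.

Lemma restr_iso M N : isomorphic M N -> isomorphic (res M : lmodType R') (res N).
Proof. by move=> [h hb]; exists (resm h). Qed.

(* For L the kernel of P -> N with P free, the class of u : L -> R in Ext^1_R(N, R)
   goes to the functional induced on N by x |-> lam (u (f x)). *)
Lemma restr_Ext1 C N : serre_class C -> killed N ->
  C (Ext 0 (res N) R'^o) -> C (res (Ext 1 N R^o)).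
Proof.
move=> Cs fN /(serre_iso Cs (isomorphic_sym (Ext0_hom _ _))) CN.
have sN := free_cover_short_exact N; have [ii ie es] := sN.
have Pp := @malg_projective R N.
apply: (serre_iso Cs (restr_iso (Ext1_hom_coker R^o Pp sN))).
have [m em] := killed_mul fN sN.
have [H eH] := trace_family m.
have [||k ek] := @hom_factor_family _ _ _ _ _ (resm (@free_cover R N)) H.
- exact: es.
- move=> u x /ie[l el]; rewrite eH.
  have -> : m x = f *: l by apply: ii; rewrite em linearZ_LR el.
  by rewrite linearZ_LR fq_trace_rel.
apply: (serre_rel (a := k) (b := resm (coker_pi _))) Cs _ _ CN.
  exact: coker_pi_surj.
move=> u ku0; have u0 x : lam ((u : hom_module _ R^o) (m x)) = 0.
  by rewrite -eH -ek ku0.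
(* On the kernel of the free cover, [m] is multiplication by f. There [u] after [m] equal to f [v]
   reads f [u] = f [v], so [v] extends [u] once f is cancelled. *)
have [v ev] := trace_divisible (u := (u : hom_module _ R^o) \o m) u0.
apply/(@coker_pi_exact _ _ _ (precomp _ _)); exists (to_hom v); apply/val_inj/funext => l.
apply/eqP; rewrite -subr_eq0; apply/eqP/(fq_reg fq).
have e : m (ker_val (@free_cover R N) l) = f *: l by apply: ii; rewrite em linearZ_LR.
rewrite mulrBr -[X in X - _]ev -[X in X - _]/((u : hom_module _ R^o) (m _)) e.
by rewrite linearZ_LR subrr.
Qed.

(* Let F = P/fP and K = ker (F -> N).  For a free cover q : Q -> L and a lift
   theta : P -> Q of f : P -> L, the functional z |-> lam (u (f z - theta (q z))) on Q,
   where u : ker q -> R represents a class of Ext^2_R(N, R), descends to K. *)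
Lemma restr_Ext2 C N : serre_class C -> killed N ->
  C (Ext 1 (res N) R'^o) -> C (res (Ext 2 N R^o)).
Proof.
move=> Cs fN CN.
pose P := {malg R[N]} : lmodType R; pose eps := @free_cover R N : {linear P -> N}.
have Pp : projective P := @malg_projective R N.
have sN : short_exact (ker_val eps) eps := free_cover_short_exact N.
have [ii ie es] := sN; pose L := kernel eps.
apply: (serre_iso Cs (restr_iso (Ext_shift 0 R^o Pp sN))).
pose Q := {malg R[L]} : lmodType R; pose q := @free_cover R L : {linear Q -> L}.
have sL : short_exact (ker_val q) q := free_cover_short_exact L.
have Qp : projective Q := @malg_projective R L.
have [ij je qs] := sL.
apply: (serre_iso Cs (restr_iso (Ext1_hom_coker R^o Qp sL))).
pose F := coker (@rel_mul R' R iota fq N).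
pose pi : {linear P -> F} := coker_pi _.
have pis : surjective pi by apply: coker_pi_surj.
have [g eg] : exists g : {linear F -> N}, forall x, g (pi x) = eps x.
  apply: factor_surj => // x /coker_pi_exact[y <-].
  by rewrite linearZ_LR fN.
have gs : surjective g.
  by move=> y; have [x <-] := es y; exists (pi x).
have sF := short_exact_ker gs.
have Fp : projective (res F) := restr_free_quotient_projective (X := N).
have {}CN := serre_iso Cs (isomorphic_sym (Ext1_hom_coker R'^o Fp (restr_short_exact iota sF))) CN.
have [m em] := killed_mul fN sN.
have [theta eth] := Pp _ _ q m qs.
have [t et] : exists t : {linear Q -> kernel q},
    forall z, ker_val q (t z) = f *: z - theta (ker_val eps (q z)).
  apply: (short_exact_ker_factor
    (h := lin (@scale_linear R f Q) \- (theta \o ker_val eps \o q)) sL) => z.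
  rewrite -[LHS]/(q (f *: z - theta (ker_val eps (q z)))) linearB linearZ_LR eth; apply/eqP; rewrite subr_eq0; apply/eqP.
  by apply: ii; rewrite em linearZ_LR.
have [p ep] : exists p : {linear Q -> kernel g},
    forall z, ker_val g (p z) = pi (ker_val eps (q z)).
  apply: (short_exact_ker_factor (h := pi \o ker_val eps \o q) sF) => z /=.
  rewrite eg; exact: exact_comp0 ie.
have ps : surjective p.
  move=> y; have [x ex] := pis (ker_val g y).
  have /ie[l el] : eps x = 0.
    by rewrite -eg ex; have [_ gE _] := sF; apply: exact_comp0 gE.
  by have [z ez] := qs l; exists z; apply: ker_val_inj; rewrite ep ez el.
have tj l : t (ker_val q l) = f *: l.
  apply: ij; rewrite et linearZ_LR (_ : q (ker_val q l) = 0) ?linear0 ?addr0 //.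
  exact: exact_comp0 je.
have tth x : t (theta x) = 0.
  apply: ij; rewrite et linear0 eth em linearZ_LR; exact: subrr.
have [H eH] := trace_family t.
have [||k ek] := @hom_factor_family _ _ _ _ _ (resm p) H.
- exact: ps.
- move=> u z pz; rewrite eH.
  have /coker_pi_exact[x ex] : pi (ker_val eps (q z)) = 0.
    by rewrite -ep [p z]pz linear0.
  have /je[l el] : q (z - theta x) = 0.
    apply/eqP; rewrite linearB subr_eq0; apply/eqP; apply: ii.
    by rewrite eth em -ex.
  have -> : z = theta x + ker_val q l by rewrite el addrC subrK.
  by rewrite linearD tth add0r tj linearZ_LR fq_trace_rel.
pose a : {linear res (hom_module (kernel q) R^o) ->
  hom_coker (resm (ker_val g)) R'^o} := coker_pi _ \o k.
apply: (serre_rel (a := a) (b := resm (coker_pi _))) Cs _ _ CN.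
  exact: coker_pi_surj.
move=> u /coker_pi_exact[phi ephi].
(* [phi] extends the functional of [u] from [kernel g] to F, and [w] represents it through the
   trace. So [u] after [t], minus the term in [w], has zero trace and is f times some [v]. On the
   kernel of [q] the term in [w] vanishes and [t] is multiplication by f: cancelling f, [v] extends
   [u]. *)
have [w ew] := @trace_lift R' R iota fq N (hom_val (phi : hom_module (res F) R'^o)).
have u0 z : lam (((u : hom_module _ R^o) \o t \- (w \o ker_val eps \o q)) z) = 0.
  rewrite linearB ew; apply/eqP; rewrite subr_eq0; apply/eqP.
  rewrite -[LHS]/(lam ((u : hom_module _ R^o) (t z))) -eH -ek.
  have := congr1 (fun h : hom_module (res (kernel g)) R'^o => h (p z)) ephi.
  rewrite -[X in _ = X]/(k u (p z)) => <-.
  by rewrite -[LHS]/(phi (ker_val g (p z))) ep.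
have [v ev] := trace_divisible u0.
apply/(@coker_pi_exact _ _ _ (precomp _ _)); exists (to_hom v); apply/val_inj/funext => l.
apply/eqP; rewrite -subr_eq0; apply/eqP/(fq_reg fq).
have := ev (ker_val q l).
rewrite mulrBr => <-; rewrite -[X in X - _]/((u : hom_module _ R^o) (t (ker_val q l)) -
   w (ker_val eps (q (ker_val q l)))) tj.
rewrite (_ : q (ker_val q l) = 0); last exact: exact_comp0 je.
by rewrite !linear0 addr0 linearZ_LR subrr.
Qed.

(** Over R', shift along F = P/fP -> N, whose kernel is again killed by f. Over R, shift along P ->
    N, whose kernel is an extension of the former kernel by fP, a copy of P, and P is invisible to
    Ext in positive degree. The shift over R' starts at Ext^1, which is why Ext^1 and Ext^2 over R
    are both base cases. *)
Lemma restr_Ext C n N : serre_class C -> killed N ->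
  C (Ext n (res N) R'^o) -> C (res (Ext n.+1 N R^o)).
Proof.
case: n => [|n] Cs; first exact: restr_Ext1.
elim: n N => [|n IH] N fN CN; first exact: restr_Ext2.
have sN := free_cover_short_exact N; have [ii ie es] := sN.
have Pp := @malg_projective R N.
pose F := coker (@rel_mul R' R iota fq N).
pose pi : {linear {malg R[N]} -> F} := coker_pi _.
have pis : surjective pi by apply: coker_pi_surj.
have [g eg] : exists g : {linear F -> N}, forall x, g (pi x) = free_cover x.
  apply: factor_surj => // x /coker_pi_exact[y <-].
  by rewrite linearZ_LR fN.
have gs : surjective g.
  by move=> y; have [x <-] := es y; exists (pi x).
have sF := short_exact_ker gs.
have Fp : projective (res F) := restr_free_quotient_projective (X := N).
have [m em] := killed_mul fN sN.
have fK : killed (kernel g).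
  move=> y; apply: ker_val_inj; rewrite linearZ_LR linear0.
  have [x <-] := pis (ker_val g y); rewrite -linearZ_LR; apply/coker_pi_exact.
  by exists x.
have [p ep] : exists p : {linear kernel (@free_cover R N) -> kernel g},
    forall l, ker_val g (p l) = pi (ker_val _ l).
  apply: (short_exact_ker_factor (h := pi \o ker_val _) sF) => z /=.
  rewrite eg; exact: exact_comp0 ie.
have smp : short_exact m p.
  split.
  - apply: linear_eq0_inj => x mx; apply: (@rel_mul_inj _ _ _ fq).
    by rewrite linear0 -[LHS]em mx linear0.
  - move=> l; split=> [pl|[x <-]].
      have /coker_pi_exact[x ex] : pi (ker_val _ l) = 0 by rewrite -ep pl linear0.
      by exists x; apply: ii; rewrite em.
    apply: ker_val_inj; rewrite linear0 ep em; apply/coker_pi_exact.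
    by exists x.
  - move=> y; have [x ex] := pis (ker_val g y).
    have /ie[l el] : free_cover x = 0.
      by rewrite -eg ex; have [_ gE _] := sF; apply: exact_comp0 gE.
    by exists l; apply: ker_val_inj; rewrite ep el.
have Rs := restr_serre iota Cs.
have {}CN := serre_iso Cs (isomorphic_sym (Ext_shift n R'^o Fp (restr_short_exact iota sF))) CN.
have CK := IH _ fK CN.
apply: (serre_iso Rs (Ext_shift n.+1 R^o Pp sN)).
apply: (Ext_middle Rs smp _ CK).
exact: (@serre_zero _ (fun X => C (res X)) _ _ Rs (@Ext_projective _ n.+1 _ R^o Pp) CK).
Qed.

(** A submodule E of Ext^(n+1) over R is killed by f and lies over R' in a module whose submodules
    have grade at least n. Applying the comparison to E raises the bound to n + 1; the remaining
    degree 0 holds because f is regular and kills E. *)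
Lemma restr_auslander N : killed N ->
  auslander (res N : lmodType R') -> auslander N.
Proof.
move=> fN Na [|n] E h hi i lti //.
have fE : killed E.
  by move=> x; apply: hi; rewrite linearZ_LR (Ext_scale0 fN) linear0.
have En := restr_Ext (submodules_grade_ge_serre n) fN (Na n).
case: i lti => [|i] lti.
  apply/Ext0_eq0 => u x; apply: (fq_reg fq).
  by rewrite -[LHS]/(f *: u x) -linearZ_LR fE linear0.
exact: (restr_Ext (zero_serre (R := R')) fE) (En _ (resm h) hi i lti).
Qed.

End ChangeOfRingsExt.

(** * Division by Laurent polynomials with invertible extreme coefficients *)

Section LaurentExtension.
Context {R' R : comNzRingType} (iota : {rmorphism R' -> R}).
Context (t tV : R) (coef : int -> R -> R').
(** The ring R'[t, 1/t] is described by its coefficient functions, so that one group algebra can be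
    read as a Laurent ring along any suitable direction. *)
Hypotheses (tK : t * tV = 1)
  (coefP : forall i c a b, coef i (iota c * a + b) = c * coef i a + coef i b)
  (coef_t : forall i a, coef i (t * a) = coef (i - 1) a)
  (coef1 : forall i, coef i 1 = (i == 0)%:R)
  (coef_ext : forall a, (forall i, coef i a = 0) -> a = 0)
  (coef_bound : forall a, exists n : nat, forall i, (n < `|i|)%N -> coef i a = 0).

Lemma coefD i a b : coef i (a + b) = coef i a + coef i b.
Proof. by rewrite -[a in LHS]mul1r -[1 in LHS](rmorph1 iota) coefP mul1r. Qed.

Lemma coef0 i : coef i 0 = 0.
Proof. by apply: (addrI (coef i 0)); rewrite -coefD !addr0. Qed.

Lemma coefZ i c a : coef i (iota c * a) = c * coef i a.
Proof. by rewrite -[in LHS](addr0 (iota c * a)) coefP coef0 addr0. Qed.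

Lemma coefN i a : coef i (- a) = - coef i a.
Proof. by apply: (addrI (coef i a)); rewrite -coefD !subrr coef0. Qed.

Lemma coef_sum i (I : Type) (r : seq I) (P : pred I) (F : I -> R) :
  coef i (\sum_(j <- r | P j) F j) = \sum_(j <- r | P j) coef i (F j).
Proof. exact: (big_morph _ (coefD i) (coef0 i)). Qed.

Lemma coef_eq a b : (forall i, coef i a = coef i b) -> a = b.
Proof.
move=> ab; apply/eqP; rewrite -subr_eq0; apply/eqP/coef_ext => i.
by rewrite coefD coefN ab subrr.
Qed.

Lemma coef_tX i k a : coef i (t ^+ k * a) = coef (i - k%:Z) a.
Proof.
elim: k i => [|k IH] i; first by rewrite mul1r subr0.
by rewrite exprS -mulrA coef_t IH; congr (coef _ a); lia.
Qed.

Lemma coef_tV i a : coef i (tV * a) = coef (i + 1) a.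
Proof. by rewrite -[a in RHS]mul1r -tK -mulrA coef_t addrK. Qed.

Lemma coef_tVX i k a : coef i (tV ^+ k * a) = coef (i + k%:Z) a.
Proof.
elim: k i => [|k IH] i; first by rewrite mul1r addr0.
by rewrite exprS -mulrA coef_tV IH; congr (coef _ a); lia.
Qed.

Lemma laurent_ind (X : R -> Prop) :
  X 0 -> X 1 -> (forall c a b, X a -> X b -> X (iota c * a + b)) ->
  (forall a, X a -> X (t * a)) -> (forall a, X a -> X (tV * a)) -> forall a, X a.
Proof.
move=> X0 X1 XP Xt XV a.
have XD x y : X x -> X y -> X (x + y).
  by move=> Xx Xy; have := XP 1 _ _ Xx Xy; rewrite rmorph1 mul1r.
have XZ c x : X x -> X (iota c * x).
  by move=> Xx; rewrite -[_ * x]addr0; apply: XP.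
have XVX k : X (tV ^+ k) by elim: k => [|k IH] //; rewrite exprS; apply: XV.
have [n an] := coef_bound a.
(* With n bounding the support, the exponents from -n to n are shifted by n to be indexed by
   naturals. *)
have -> : a = \sum_(k < (n + n).+1) iota (coef (k%:Z - n%:Z) a) * (t ^+ k * tV ^+ n).
  apply: coef_eq => i; rewrite coef_sum.
  under eq_bigr => k _ do rewrite coefZ coef_tX -[tV ^+ n]mulr1 coef_tVX coef1.
  case: (ltnP n `|i|) => [lti|lei].
    rewrite an // big1 // => k _.
    by rewrite (_ : _ == _ = false) ?mulr0 //; have := ltn_ord k; lia.
  have ltk : (`|(i + n%:Z)%R| < (n + n).+1)%N by lia.
  rewrite (bigD1 (Ordinal ltk)) //= gez0_abs; last by lia.
  rewrite (_ : _ - _ + _ == 0); last by lia.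
  rewrite mulr1 addrK big1 ?addr0 // => k nk.
  rewrite (_ : _ == _ = false) ?mulr0 //; apply: contraNF nk => e.
  by rewrite -val_eqE /=; lia.
apply: big_ind => // k _; apply: XZ; elim: (nat_of_ord k) => [|k' IH].
  by rewrite mul1r.
by rewrite exprS -mulrA; apply: Xt.
Qed.

Lemma coef_top (a : R) : a != 0 ->
  exists T, coef T a != 0 /\ forall i, (T < i)%R -> coef i a = 0.
Proof.
move=> a0; have [n an] := coef_bound a.
have ex : exists k, coef (k%:Z - n%:Z) a != 0.
  apply: contrapT => nex; move/eqP: a0; apply; apply: coef_ext => i.
  case: (ltnP n `|i|) => [/an//|lei]; apply: contrapT => ci.
  apply: nex; exists `|(i + n%:Z)%R|%N; rewrite gez0_abs ?addrK; last by lia.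
  exact/eqP.
have bd k : coef (k%:Z - n%:Z) a != 0 -> (k <= n + n)%N.
  move=> ck; rewrite leqNgt; apply: contra ck => lek.
  by rewrite an //; lia.
case: (ex_maxnP ex bd) => k ck kmax; exists (k%:Z - n%:Z); split=> // i lti.
apply/eqP; apply: contraTT lti => ci.
have : (`|(i + n%:Z)%R| <= k)%N.
  apply: kmax; rewrite gez0_abs ?addrK //.
  by case: (ltnP n `|i|) => [/an|]; [move/eqP; rewrite (negPf ci) | lia].
by rewrite -Order.TotalTheory.leNgt; lia.
Qed.

Lemma coef_bottom (a : R) : a != 0 ->
  exists B, coef B a != 0 /\ forall i, (i < B)%R -> coef i a = 0.
Proof.
move=> a0; have [n an] := coef_bound a.
have ex : exists k, coef (n%:Z - k%:Z) a != 0.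
  apply: contrapT => nex; move/eqP: a0; apply; apply: coef_ext => i.
  case: (ltnP n `|i|) => [/an//|lei]; apply: contrapT => ci.
  apply: nex; exists `|(n%:Z - i)%R|%N; rewrite gez0_abs; last by lia.
  by rewrite opprB addrC subrK; exact/eqP.
have bd k : coef (n%:Z - k%:Z) a != 0 -> (k <= n + n)%N.
  move=> ck; rewrite leqNgt; apply: contra ck => lek.
  by rewrite an //; lia.
case: (ex_maxnP ex bd) => k ck kmax; exists (n%:Z - k%:Z); split=> // i lti.
apply/eqP; apply: contraTT lti => ci.
have : (`|(n%:Z - i)%R| <= k)%N.
  apply: kmax; rewrite gez0_abs; first by rewrite opprB addrC subrK.
  by case: (ltnP n `|i|) => [/an|]; [move/eqP; rewrite (negPf ci) | lia].
by rewrite -Order.TotalTheory.leNgt; lia.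
Qed.

(** * Euclidean division by f and the Frobenius structure of the quotient *)

Section MonicDivision.
Context (d : nat) (c : nat -> R') (u0 ud : R').
Hypotheses (d_gt0 : (0 < d)%N) (c0K : u0 * c 0%N = 1) (cdK : ud * c d = 1).

Definition laurent_poly : R := \sum_(j < d.+1) iota (c j) * t ^+ j.
Local Notation f := laurent_poly.

Definition low (r : R) := forall i, ~~ (0 <= i < d%:Z)%R -> coef i r = 0.

Lemma coef_poly_mul i b : coef i (f * b) = \sum_(j < d.+1) c j * coef (i - j%:Z) b.
Proof.
rewrite mulr_suml coef_sum; apply: eq_bigr => j _.
by rewrite -mulrA coefZ coef_tX.
Qed.

Lemma coef_poly i : coef i f = if i is Posz j then if (j <= d)%N then c j else 0 else 0.
Proof.
rewrite -[f]mulr1 coef_poly_mul; under eq_bigr => j _ do rewrite coef1 subr_eq0.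
have out : (forall j : 'I_d.+1, i != j%:Z) -> \sum_(j < d.+1) c j * (i == j%:Z)%:R = 0.
  by move=> ij; apply: big1 => j _; rewrite (negPf (ij j)) mulr0.
case: i out => [k|k] out; last by rewrite out.
case: (leqP k d) => [lek|ltk]; last first.
  by rewrite out // => j; have := ltn_ord j; lia.
have ltk : (k < d.+1)%N by [].
rewrite (bigD1 (Ordinal ltk)) //= eqxx mulr1 big1 ?addr0 // => j nj.
rewrite (_ : _ == _ = false) ?mulr0 //; apply: contraNF nj => /eqP[e].
by rewrite -val_eqE /= e.
Qed.

Lemma lowD a b : low a -> low b -> low (a + b).
Proof. by move=> la lb i hi; rewrite coefD la ?lb ?addr0. Qed.

Lemma lowZ x a : low a -> low (iota x * a).
Proof. by move=> la i hi; rewrite coefZ la ?mulr0. Qed.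

Lemma low0 : low 0.
Proof. by move=> i _; apply: coef0. Qed.

Lemma low_tX k : (k < d)%N -> low (t ^+ k).
Proof.
move=> ltk i hi; rewrite -[t ^+ k]mulr1 coef_tX coef1 subr_eq0.
by case: eqP hi => // ->; rewrite ltz_nat ltk.
Qed.

(** Multiplying a remainder by t overflows only at exponent d, where the leading coefficient of f
    cancels the excess; dividing by t underflows only at -1, where the constant coefficient does.
    Hence both must be invertible. *)
Lemma divide a : exists r b, low r /\ a = r + f * b.
Proof.
elim/laurent_ind: a => [||x a a' [r [b [lr ->]]] [r' [b' [lr' ->]]]|a [r [b [lr ->]]]|a [r [b [lr ->]]]].
- by exists 0, 0; split; [exact: low0 | rewrite mulr0 addr0].
- by exists 1, 0; split; [exact: (low_tX d_gt0) | rewrite mulr0 addr0].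
- exists (iota x * r + r'), (iota x * b + b'); split.
    by apply: lowD => //; apply: lowZ.
  by rewrite !mulrDr addrACA mulrCA.
- pose e := iota (coef (d%:Z - 1) r * ud).
  exists (t * r - e * f), (t * b + e); split; last first.
    by clearbody e; ring.
  move=> i hi; rewrite coefD coefN coefZ coef_t coef_poly.
  case: i hi => [k|k] hi; last by rewrite mulr0 subr0 lr.
  have [->|nk] := eqVneq k d; first by rewrite leqnn -mulrA cdK mulr1 subrr.
  by rewrite leqNgt (_ : (d < k)%N) /= ?mulr0 ?subr0 ?lr //; lia.
- pose e := iota (coef 0 r * u0).
  exists (tV * r - e * (tV * f)), (tV * b + e * tV); split; last first.
    by clearbody e; ring.
  move=> i hi; rewrite coefD coefN coefZ !coef_tV coef_poly.
  have [ei|ni] := eqVneq i (-1).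
    by rewrite ei addNr /= -mulrA c0K mulr1 subrr.
  rewrite lr; last by lia.
  case ei : (i + 1) => [k|k]; last by rewrite mulr0 subr0.
  by rewrite leqNgt (_ : (d < k)%N) /= ?mulr0 ?subr0 //; lia.
Qed.

(** If b has top exponent T and bottom exponent B, invertible extreme coefficients give [f * b] a
    nonzero coefficient at T + d and at B. Being low then forces T < 0 <= B, against B <= T. *)
Lemma low_multiple b : low (f * b) -> b = 0.
Proof.
move=> lfb; apply/eqP; apply: contraT => b0.
have [T [T0 bT]] := coef_top b0; have [B [B0 bB]] := coef_bottom b0.
have eT : coef (T + d%:Z) (f * b) = c d * coef T b.
  rewrite coef_poly_mul big_ord_recr /= addrK big1 ?add0r // => j _.
  by rewrite bT ?mulr0 //; have := ltn_ord j; lia.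
have eB : coef B (f * b) = c 0%N * coef B b.
  rewrite coef_poly_mul big_ord_recl /= subr0 big1 ?addr0 // => j _.
  by rewrite bB ?mulr0 // /bump; lia.
have T_lt0 : (T < 0)%R.
  rewrite Order.TotalTheory.ltNge; apply: contra T0 => T_ge0.
  have e0 : c d * coef T b = 0 by rewrite -eT lfb //; lia.
  by rewrite -[coef T b]mul1r -cdK -mulrA e0 mulr0.
have B_ge0 : (0 <= B)%R.
  rewrite Order.TotalTheory.leNgt; apply: contra B0 => B_lt0.
  have e0 : c 0%N * coef B b = 0 by rewrite -eB lfb //; lia.
  by rewrite -[coef B b]mul1r -c0K -mulrA e0 mulr0.
by move: T0; rewrite bB ?eqxx //; lia.
Qed.

Lemma poly_regular a : f * a = 0 -> a = 0.
Proof. by move=> fa; apply: low_multiple; rewrite fa; apply: low0. Qed.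

Definition remainder a := projT1 (cid (divide a)).

Lemma remainder_low a : low (remainder a).
Proof. by rewrite /remainder; case: cid => r [b []]. Qed.

Lemma remainderP a : exists b, a = remainder a + f * b.
Proof. by rewrite /remainder; case: cid => r [b [_ e]] /=; exists b. Qed.

Lemma remainder_unique a r b : low r -> a = r + f * b -> remainder a = r.
Proof.
move=> lr ea; have [b' eb'] := remainderP a; have lr' := remainder_low a.
have e : remainder a - r = f * (b - b').
  have {}eb' : remainder a = r + f * b - f * b' by rewrite -ea {2}eb' addrK.
  by rewrite eb'; ring.
have /low_multiple z : low (f * (b - b')).
  rewrite -e; apply: lowD => //.
  by move=> i hi; rewrite coefN lr ?oppr0.
by apply/eqP; rewrite -subr_eq0 e z mulr0.
Qed.

Lemma remainder_id r : low r -> remainder r = r.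
Proof. by move=> lr; apply: (remainder_unique (b := 0)); rewrite ?mulr0 ?addr0. Qed.

Lemma remainder_mul b : remainder (f * b) = 0.
Proof. by apply: (remainder_unique (b := b)); [exact: low0 | rewrite add0r]. Qed.

Lemma remainderL x a b :
  remainder (iota x * a + b) = iota x * remainder a + remainder b.
Proof.
have [a' ea] := remainderP a; have [b' eb] := remainderP b.
apply: (remainder_unique (b := iota x * a' + b')).
  by apply: lowD (remainder_low b); apply: lowZ; apply: remainder_low.
by rewrite {1}ea {1}eb !mulrDr addrACA mulrCA.
Qed.

Lemma low_sum r : low r -> r = \sum_(i < d) iota (coef i%:Z r) * t ^+ i.
Proof.
move=> lr; apply: coef_eq => i; rewrite coef_sum.
under eq_bigr => k _ do rewrite coefZ -[t ^+ k]mulr1 coef_tX coef1 subr_eq0.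
have [/andP[i_ge0 lti]|ni] := boolP (0 <= i < d%:Z)%R; last first.
  rewrite lr // big1 // => k _; rewrite (_ : _ == _ = false) ?mulr0 //.
  by have := ltn_ord k; lia.
case: i i_ge0 lti => // k _; rewrite ltz_nat => ltk.
rewrite (bigD1 (Ordinal ltk)) //= eqxx mulr1 big1 ?addr0 // => j nj.
rewrite (_ : _ == _ = false) ?mulr0 //; apply: contraNF nj => /eqP[e].
by rewrite -val_eqE /= e.
Qed.

Lemma remainder_coord_linear :
  linear (fun a : restr iota R^o => \row_(i < d) coef i%:Z (remainder a)).
Proof.
move=> x a b; apply/rowP => i; rewrite !mxE.
rewrite -[x *: a]/(iota x * (a : R)).
by rewrite remainderL coefD coefZ.
Qed.

(** The residue functional: it reads the coefficient of t^(d-1). On the products t^i t^j it is 0 for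
    i + j < d - 1 and 1 for i + j = d - 1, so its Gram matrix is antitriangular with unit
    antidiagonal, whence the Frobenius property. *)
Lemma remainder_trace_linear :
  linear (fun a : restr iota R^o => coef (d%:Z - 1) (remainder a) : R'^o).
Proof.
move=> x a b; rewrite -[x *: a]/(iota x * (a : R)).
by rewrite remainderL coefD coefZ.
Qed.

Local Notation trace := (lin remainder_trace_linear).

Lemma trace_nondegenerate a : (forall b, trace (b * a) = 0) -> exists b, a = f * b.
Proof.
move=> tra; have [b eb] := remainderP a; have lr := remainder_low a.
suff r0 : remainder a = 0 by exists b; rewrite {1}eb r0 add0r.
apply/eqP; apply: contraT => r0; have [T [T0 rT]] := coef_top r0.
have /andP[T_ge0 ltT] : (0 <= T < d%:Z)%R by apply: contraR T0 => /lr ->.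
(* This power moves the top coefficient of the remainder to exponent d - 1 and keeps all exponents
   below d, so no reduction occurs and the trace is that coefficient. *)
have := tra (t ^+ `|(d%:Z - 1 - T)%R|); rewrite /= (remainder_unique
   (r := t ^+ `|(d%:Z - 1 - T)%R| * remainder a)
   (b := t ^+ `|(d%:Z - 1 - T)%R| * b)).
- rewrite coef_tX gez0_abs; last by lia.
  by rewrite opprB addrC subrK => /eqP; rewrite (negPf T0).
- move=> i hi; rewrite coef_tX; have [lti|lei] := Order.TotalTheory.ltP T (i - `|(d%:Z - 1 - T)%R|%:Z).
    exact: rT.
  by apply: lr; lia.
- by rewrite {1}eb mulrDr mulrCA.
Qed.

Lemma trace_generates (phi : {linear restr iota R^o -> R'^o}) :
  (forall a, phi (f * a) = 0) -> exists s, forall a, phi a = trace (a * s).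
Proof.
move=> phif.
have traceL x a b : trace (iota x * a + b) = x * trace a + trace b.
  by rewrite /= remainderL coefD coefZ.
suff [s es] : exists s, forall i, (i < d)%N -> phi (t ^+ i) = trace (t ^+ i * s).
  have ml : linear (fun a : restr iota R^o => trace ((a : R) * s) : R'^o).
    move=> x a b; rewrite -[x *: a]/(iota x * (a : R)) mulrDl -mulrA.
    exact: traceL.
  exists s => a; have [b eb] := remainderP a.
  rewrite -[RHS]/(lin ml a) [in LHS]eb [in RHS]eb.
  rewrite [LHS](linearD phi) [RHS](linearD (lin ml)) phif.
  rewrite -[X in _ = _ + X]/(trace (f * b * s)) -mulrA /= remainder_mul coef0 !addr0.
  rewrite (low_sum (remainder_low a)) [LHS](linear_sum phi) [RHS](linear_sum (lin ml)).
  apply: eq_bigr => i _; set x := coef _ _.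
  rewrite -[iota x * _]/(x *: (t ^+ i : restr iota R^o)) !linearZ_LR.
  by rewrite es.
suff : forall e, (e <= d)%N ->
    exists s, forall i, (i < e)%N -> phi (t ^+ i) = trace (t ^+ i * s) by apply.
elim=> [|e IH] led; first by exists 0.
have [s es] := IH (ltnW led); pose x := phi (t ^+ e) - trace (t ^+ e * s).
(* Times t^i with i <= e, the new term has exponent d - 1 - (e - i). The trace sees it only for i =
   e, so the values already matched are kept. *)
exists (iota x * t ^+ (d - e.+1) + s) => i; rewrite ltnS => lei.
rewrite mulrDr mulrCA -exprD traceL.
have tr k : (k < d)%N -> trace (t ^+ k) = (k == d.-1)%:R.
  move=> ltk; rewrite /= remainder_id; last exact: low_tX.
  by rewrite -[t ^+ k]mulr1 coef_tX coef1 subr_eq0; congr _%:R; apply/eqP/eqP; lia.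
rewrite tr; last by lia.
have [ei|ni] := eqVneq i e.
  by rewrite (_ : _ == _) ?mulr1 ?ei ?subrK //; lia.
rewrite (_ : _ == _ = false) ?mulr0 ?add0r ?es //; lia.
Qed.

Definition laurent_frobenius : frobenius_quotient iota.
Proof.
apply: (@FrobeniusQuotient _ _ iota f poly_regular d (fun i => t ^+ i)
  (lin remainder_coord_linear) _ _ trace _ trace_nondegenerate trace_generates).
- by move=> a; apply/rowP => i; rewrite !mxE remainder_mul coef0.
- move=> a; have [b eb] := remainderP a; exists b; rewrite [LHS]eb.
  congr (_ + _); rewrite [LHS](low_sum (remainder_low a)).
  by apply: eq_bigr => i _; rewrite mxE.
- by move=> a; rewrite /= remainder_mul coef0.
Defined.

Lemma laurent_frobenius_rel : fq_rel laurent_frobenius = f.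
Proof. by []. Qed.

End MonicDivision.

End LaurentExtension.

(** * Group algebras *)

Section GroupAlgebraConstants.
Context {A : comNzRingType} {G : zmodType}.
Local Notation AG := (group_algebra A G).

Lemma ga_mulUUE (c1 c2 : A) (k1 k2 : G) :
  (<< c1 *g k1 >> : AG) * << c2 *g k2 >> = << c1 * c2 *g k1 + k2 >>.
Proof. exact: ga_mulUU. Qed.

Definition ga_const (c : A) : AG := << c *g 0 >>.

Lemma ga_constE c (g : AG) k : (ga_const c * g)@_k = c * g@_k.
Proof.
elim/ga_ind: g => [d l|g g' IH IH']; last by rewrite mulrDr !mcoeffD IH IH' mulrDr.
by rewrite ga_mulUUE add0r !mcoeffU mulrnAr.
Qed.

Lemma ga_constX c k : ga_const c ^+ k = ga_const (c ^+ k).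
Proof.
by elim: k => [|k IH] //; rewrite !exprS IH [LHS]ga_mulUUE addr0.
Qed.

Lemma malg_choice (P : A -> A -> Prop) (g : AG) :
  P 0 0 -> (forall k, exists d, P g@_k d) -> exists h : AG, forall k, P g@_k h@_k.
Proof.
move=> P0 Pg; pose d k := projT1 (cid (Pg k)).
have dP k : P g@_k (d k) by rewrite /d; case: cid.
exists [malg k in msupp g => d k] => k; rewrite mcoeffE.
by case: ifPn => // /mcoeff_outdom ->.
Qed.

Lemma ga_const_dvd (b : A) (g : AG) :
  (forall k, exists d, g@_k = b * d) -> exists h, g = ga_const b * h.
Proof.
move=> gb; have [|h hE] := @malg_choice (fun x d => x = b * d) g _ gb.
  by rewrite mulr0.
by exists h; apply/malgP => k; rewrite ga_constE -hE.
Qed.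

Lemma ga_const_exact (a b : A) : (forall c, a * c = 0 <-> exists d, c = b * d) ->
  forall g : AG, ga_const a * g = 0 <-> exists h, g = ga_const b * h.
Proof.
move=> ab g; split=> [ag|[h ->]].
  by apply: ga_const_dvd => k; apply/ab; rewrite -ga_constE ag mcoeff0.
apply/malgP => k; rewrite !ga_constE mcoeff0; apply/ab.
by exists h@_k.
Qed.

(** Each coefficient of g divisible by p is replaced by 0. The others are units, and one remains
    because p does not divide g. On a module killed by p, f and g act alike. *)
Lemma ga_unit_part (p : A) (g : AG) :
  (forall c : A, (exists d, c = p * d) \/ (exists u, u * c = 1)) ->
  ~ (exists h, g = ga_const p * h) ->
  exists f h : AG, [/\ g = f + ga_const p * h, f != 0 &
    forall k, f@_k = 0 \/ exists u, u * f@_k = 1].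
Proof.
move=> pu ng.
pose P (x y : A) := (exists e, x - y = p * e) /\ (y = 0 \/ exists u, u * y = 1).
have [||f fP] := @malg_choice P g.
- by split; [exists 0; rewrite mulr0 subrr | left].
- move=> k; case: (pu g@_k) => [[d e]|[u e]].
    by exists 0; split; [exists d; rewrite subr0 | left].
  by exists g@_k; split; [exists 0; rewrite mulr0 subrr | right; exists u].
have [h eh] : exists h, g - f = ga_const p * h.
  by apply: ga_const_dvd => k; rewrite mcoeffB; case: (fP k).
exists f, h; split; first by rewrite -eh addrC subrK.
  by apply/eqP => f0; apply: ng; exists h; rewrite -eh f0 subr0.
by move=> k; case: (fP k).
Qed.

Lemma ga_trivial_unit (f : AG) : (forall k : G, k = 0) -> f != 0 ->
  (forall k, f@_k = 0 \/ exists u, u * f@_k = 1) -> exists u, u * f = 1.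
Proof.
move=> G0 f0 fu; have ef : f = ga_const f@_0.
  by apply/malgP => k; rewrite (G0 k) mcoeffUU.
case: (fu 0) ef => [-> ef|[u]]; first by rewrite ef monalgU_eq0 eqxx in f0.
move: f@_0 => c uc ->; exists (ga_const u).
by rewrite ga_mulUUE uc addr0.
Qed.

End GroupAlgebraConstants.

(** * The group algebra of Z x G' as a Laurent ring over that of G' *)

Section GroupSplitting.
Context {A : comNzRingType} {G G' : zmodType}.
Context (h : {additive G -> int}) (w : {additive G -> G'}) (s : int -> G' -> G).
Hypotheses (hs : forall i l, h (s i l) = i) (ws : forall i l, w (s i l) = l)
  (s_hw : forall k, s (h k) (w k) = k).
Local Notation AG := (group_algebra A G).
Local Notation AG' := (group_algebra A G').

Lemma splitting_eqP (k l : G) : h k = h l -> w k = w l -> k = l.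
Proof. by move=> eh ew; rewrite -(s_hw k) -(s_hw l) eh ew. Qed.

Lemma splitting_s0D (k l : G') : s 0 (k + l) = s 0 k + s 0 l.
Proof. by apply: splitting_eqP; rewrite !raddfD /= ?hs ?ws ?addr0. Qed.

Definition split_embed (g : AG') : AG := malg_lift (fun l => << s 0 l >> : AG) g.

Lemma split_embedU c l : split_embed << c *g l >> = << c *g s 0 l >>.
Proof. by rewrite malgUZ /split_embed linearZ_LR /= malg_liftU -malgUZ. Qed.

Lemma split_embed_linear : linear split_embed.
Proof. exact: malg_lift_linear. Qed.

HB.instance Definition _ := GRing.isLinear.Build A AG' AG _ split_embed split_embed_linear.

Lemma split_embed_monoid_morphism : monoid_morphism split_embed.
Proof.
have s00 : s 0 0 = 0 by apply: splitting_eqP; rewrite ?hs ?ws ?raddf0.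
split=> [|g g']; first by rewrite [LHS]split_embedU s00.
elim/ga_ind: g g' => [c k|g1 g2 IH IH'] g'; last by rewrite mulrDl !raddfD /= mulrDl IH IH'.
elim/ga_ind: g' => [d l|g1 g2 IH IH']; last by rewrite mulrDr !raddfD /= mulrDr IH IH'.
by rewrite ga_mulUUE !split_embedU splitting_s0D [RHS]ga_mulUUE.
Qed.

HB.instance Definition _ :=
  GRing.isMonoidMorphism.Build AG' AG split_embed split_embed_monoid_morphism.

(** With [h] as the degree in t and [s 0] as the inclusion of G', this is the coefficient of t^i;
    the power t^i itself is [split_mon i]. *)
Definition split_coef (i : int) (g : AG) : AG' :=
  malg_lift (fun k => if h k == i then << w k >> else 0 : AG') g.

Lemma split_coef_linear i : linear (split_coef i).
Proof. exact: malg_lift_linear. Qed.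

HB.instance Definition _ i :=
  GRing.isLinear.Build A AG AG' _ (split_coef i) (split_coef_linear i).

Lemma split_coefU i c k :
  split_coef i << c *g k >> = if h k == i then << c *g w k >> else 0.
Proof.
rewrite malgUZ /split_coef linearZ_LR /= malg_liftU.
by case: eqP => _; rewrite ?scaler0 // -malgUZ.
Qed.

Lemma split_coefE i g l : (split_coef i g)@_l = g@_(s i l).
Proof.
elim/ga_ind: g => [c k|g g' IH IH']; last by rewrite raddfD /= !mcoeffD IH IH'.
rewrite split_coefU mcoeffU; case: eqP => [<-|hk].
  rewrite mcoeffU; congr (_ *+ _); congr nat_of_bool; apply/eqP/eqP => [<-|->].
    by rewrite s_hw.
  by rewrite ws.
by rewrite mcoeff0 (_ : _ == _ = false) //; apply/eqP => ek; apply: hk; rewrite ek hs.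
Qed.

Definition split_mon (i : int) : AG := << s i 0 >>.

Lemma split_mon_mulU i c k :
  split_mon i * << c *g k >> = << c *g s (h k + i) (w k) >>.
Proof.
rewrite /split_mon ga_mulUUE mul1r; congr << _ *g _ >>; apply: splitting_eqP.
  by rewrite raddfD /= !hs addrC.
by rewrite raddfD /= !ws add0r.
Qed.

Lemma split_coef_mon i j g : split_coef i (split_mon j * g) = split_coef (i - j) g.
Proof.
elim/ga_ind: g => [c k|g g' IH IH']; last by rewrite mulrDr !raddfD /= IH IH'.
rewrite split_mon_mulU !split_coefU hs ws.
by rewrite -[in LHS](can_eq (addrK (- j))) addrK.
Qed.

Lemma split_coefP i c (a b : AG) :
  split_coef i (split_embed c * a + b) = c * split_coef i a + split_coef i b.
Proof.
rewrite raddfD /=; congr (_ + _).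
elim/ga_ind: c => [x l|c c' IH IH']; last by rewrite raddfD /= !mulrDl raddfD /= IH IH'.
elim/ga_ind: a => [y k|a a' IH IH']; last by rewrite mulrDr !raddfD /= mulrDr IH IH'.
rewrite split_embedU ga_mulUUE !split_coefU raddfD /= hs add0r.
by case: eqP => _; rewrite ?mulr0 // ga_mulUUE raddfD /= ws.
Qed.

Lemma split_coef1 i : split_coef i 1 = (i == 0)%:R.
Proof. by rewrite split_coefU !raddf0 eq_sym; case: eqP. Qed.

Lemma split_coef_ext g : (forall i, split_coef i g = 0) -> g = 0.
Proof.
by move=> g0; apply/malgP => k; rewrite -(s_hw k) -split_coefE g0 !mcoeff0.
Qed.

Lemma split_coef_bound g : exists n : nat, forall i, (n < `|i|)%N -> split_coef i g = 0.
Proof.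
elim/ga_ind: g => [c k|g g' [n ng] [n' ng']].
  exists `|h k|%N => i lti; rewrite split_coefU.
  by case: eqP => // e; rewrite e ltnn in lti.
exists (maxn n n') => i; rewrite gtn_max => /andP[lti lti'].
by rewrite raddfD /= ng // ng' // addr0.
Qed.

Lemma split_monK : split_mon 1 * split_mon (-1) = 1.
Proof.
rewrite [X in _ * X]/split_mon split_mon_mulU hs ws addNr.
congr << _ *g _ >>; apply: splitting_eqP; by rewrite ?hs ?ws ?raddf0.
Qed.

Lemma split_coef_t i g : split_coef i (split_mon 1 * g) = split_coef (i - 1) g.
Proof. exact: split_coef_mon. Qed.

Lemma split_coef_single (f : AG) (k : G) :
  (forall k l, f@_k != 0 -> f@_l != 0 -> h k = h l -> k = l) -> f@_k != 0 ->
  split_coef (h k) f = << f@_k *g w k >>.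
Proof.
move=> hinj fk; apply/malgP => l; rewrite split_coefE mcoeffU.
case: eqP => [<-|kl]; first by rewrite s_hw.
apply/eqP; apply: contraT => fs; case: kl.
by rewrite (hinj k _ fk fs) ?ws // hs.
Qed.

(** As [h] separates the support, the coefficients of f in highest degree T and lowest degree B are
    monomials with unit coefficient, hence invertible. If T = B, f is itself such a monomial;
    otherwise t^(-B) f is a polynomial of degree T - B > 0 fit for division. *)
Lemma split_relation (f : AG) : f != 0 ->
  (forall k, f@_k = 0 \/ exists u, u * f@_k = 1) ->
  (forall k l, f@_k != 0 -> f@_l != 0 -> h k = h l -> k = l) ->
  (exists u, u * f = 1) \/
  exists (fq : frobenius_quotient (split_embed : {rmorphism AG' -> AG})) b,
    fq_rel fq = b * f.
Proof.
move=> f0 fu hinj.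
have cP := split_coefP; have cT := split_coef_t; have c1 := split_coef1.
have cE := split_coef_ext; have cB := split_coef_bound; have tK := split_monK.
have [T [T0 fT]] := coef_top (coef := split_coef) cE cB f0.
have [B [B0 fB]] := coef_bottom (coef := split_coef) cE cB f0.
have unit_at i : split_coef i f != 0 ->
    exists (k : G) (u : A),
      [/\ f@_k != 0, h k = i & (<< u *g - w k >> : AG') * split_coef i f = 1].
  move=> ci; have [l fl] : exists l, f@_(s i l) != 0.
    apply: contrapT => nl; move/eqP: ci; apply; apply/malgP => l.
    rewrite split_coefE mcoeff0; apply: contrapT => fl.
    by apply: nl; exists l; apply/eqP.
  case: (fu (s i l)) => [e|[u eu]]; first by rewrite e eqxx in fl.
  exists (s i l), u; split=> //.
  by rewrite -[X in split_coef X f](hs i l) split_coef_single // ga_mulUUE eu addNr.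
have [k [u [fk hk ek]]] := unit_at _ B0.
have [k' [u' [fk' hk' ek']]] := unit_at _ T0.
have [TB|TB] := eqVneq T B.
  left; exists (<< u *g - k >> : AG).
  have -> : f = << f@_k *g k >> :> AG.
    apply/malgP => l; rewrite mcoeffU; case: eqP => [->//|kl].
    apply/eqP; apply: contraT => fl; case: kl; apply: hinj => //.
    rewrite hk; have hl : split_coef (h l) f != 0.
      apply/eqP => e; have := split_coefE (h l) f (w l).
      by rewrite e mcoeff0 s_hw => e'; rewrite -e' eqxx in fl.
    apply/eqP; rewrite Order.POrderTheory.eq_le; apply/andP; split.
      rewrite Order.TotalTheory.leNgt; apply: contra hl => hl.
      by rewrite fB.
    rewrite Order.TotalTheory.leNgt -TB; apply: contra hl => hl.
    by rewrite fT.
  case: (fu k) => [e|[v ev]]; first by rewrite e eqxx in fk.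
  have -> : u = v.
    move: ek; rewrite -hk split_coef_single // ga_mulUUE => /malgP/(_ 0).
    rewrite addNr !mcoeffUU => euk.
    by rewrite -[u]mulr1 -ev [v * _]mulrC mulrA euk mul1r.
  by rewrite ga_mulUUE ev addNr.
have ltBT : (B < T)%R.
  rewrite Order.POrderTheory.lt_neqAle eq_sym TB Order.TotalTheory.leNgt.
  by apply: contra B0 => lt; rewrite fT.
right; pose d := `|(T - B)%R|%N; pose c j := split_coef (B + j%:Z) f.
have d0 : (0 < d)%N by rewrite /d; lia.
have ed : B + d%:Z = T by rewrite /d; lia.
clearbody d.
have c0K : (<< u *g - w k >> : AG') * c 0%N = 1 by rewrite /c addr0.
have cdK : (<< u' *g - w k' >> : AG') * c d = 1.
  by rewrite /c ed.
exists (laurent_frobenius tK cP cT c1 cE cB d0 c0K cdK), (split_mon (- B)).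
rewrite laurent_frobenius_rel; apply: (coef_eq (coef := split_coef) cP cE) => i.
rewrite (coef_poly (coef := split_coef) cP cT c1) // split_coef_mon opprK.
case: i => [j|j]; last by rewrite fB //; lia.
case: leqP => [le_jd|lt_dj]; first by rewrite /c addrC.
by rewrite fT //; lia.
Qed.

End GroupSplitting.

(** * Generic weights on integer vectors *)

Section IntegerVectors.

(** With vectors read as polynomials, the product of all nonzero differences is a nonzero
    polynomial, so some natural number is not a root. *)
Lemma separating_point n (S : seq 'rV[int]_n) :
  exists B : int, forall u v, u \in S -> v \in S ->
    (rVpoly u).[B] = (rVpoly v).[B] -> u = v.
Proof.
pose T := [seq (u, v) | u <- S, v <- S].
pose P : {poly int} := \prod_(x <- T | x.1 != x.2) rVpoly (x.1 - x.2).
have P0 : P != 0.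
  rewrite prodf_seq_neq0; apply/allP => x _; apply/implyP; apply: contraNneq => e.
  by rewrite -subr_eq0 -[_ - _]rVpolyK e linear0.
have [k Pk] : exists k : nat, P.[k%:Z] != 0.
  apply: contrapT => nk.
  have : (size [seq k%:Z | k <- iota 0 (size P)] < size P)%N.
    apply: max_poly_roots => //; last by rewrite map_inj_uniq ?iota_uniq // => a b [].
    apply/allP => _ /mapP[k _ ->]; rewrite rootE; apply: contraT => Pk.
    by case: nk; exists k.
  by rewrite size_map size_iota ltnn.
exists k%:Z => u v uS vS e; apply/eqP; apply: contraT => uv.
case/negP: Pk; rewrite horner_prod prodf_seq_eq0; apply/hasP; exists (u, v).
  by apply/allpairsP; exists (u, v).
by rewrite /= uv linearB /= hornerD hornerN e subrr.
Qed.

Context (D : nat) (B : int).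
Implicit Types (v : 'rV[int]_D.+1) (l : 'rV[int]_D).

(** The sum of v_j B^j. Since v_0 has coefficient 1, [weight] and [tail] together are an isomorphism
    onto Z x Z^D for every B, with inverse [unweight]. *)
Definition weight v : int := (rVpoly v).[B].

Lemma weight_linear : linear (weight : _ -> int^o).
Proof. by move=> a u v; rewrite /weight linearP /= hornerD hornerZ. Qed.

HB.instance Definition _ :=
  GRing.isLinear.Build int 'rV[int]_D.+1 int^o _ weight weight_linear.

Definition tail v : 'rV[int]_D := \row_j v 0 (lift ord0 j).

Lemma tail_linear : linear tail.
Proof. by move=> a u v; apply/rowP => j; rewrite !mxE. Qed.

HB.instance Definition _ :=
  GRing.isLinear.Build int 'rV[int]_D.+1 'rV[int]_D _ tail tail_linear.

Definition pad l : 'rV[int]_D.+1 := \row_j oapp (l 0) 0 (unlift ord0 j).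

Definition unweight (i : int) l : 'rV[int]_D.+1 :=
  pad l + (i - weight (pad l)) *: delta_mx 0 0.

Lemma weight_pad l (a : int) : weight (pad l + a *: delta_mx 0 0) = weight (pad l) + a.
Proof.
by rewrite /weight linearD linearZ /= rVpoly_delta expr0 hornerD hornerZ hornerC mulr1.
Qed.

Lemma weight_unweight i l : weight (unweight i l) = i.
Proof. by rewrite weight_pad addrC subrK. Qed.

Lemma tail_unweight i l : tail (unweight i l) = l.
Proof.
by apply/rowP => j; rewrite !mxE liftK /= mulr0 addr0.
Qed.

Lemma unweight_tail v : unweight (weight v) (tail v) = v.
Proof.
have e : v = pad (tail v) + v 0 0 *: delta_mx 0 0.
  apply/rowP => j; rewrite !mxE; case: unliftP => [k ->|->] /=.
    by rewrite mxE mulr0 addr0.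
  by rewrite mulr1 add0r.
have ew : weight v = weight (pad (tail v)) + v 0 0 by rewrite {1}e weight_pad.
by rewrite /unweight ew [RHS]e addrAC subrr add0r.
Qed.

End IntegerVectors.

(** * Units and annihilators in Z/p^m *)

Section PrimePowerRing.
Context (p m : nat) (p_prime : prime p) (m_gt0 : (0 < m)%N).
Local Notation A := 'Z_(p ^ m).

Lemma prime_power_gt1 : (1 < p ^ m)%N.
Proof. by rewrite -{1}(expn0 p) ltn_exp2l // prime_gt1. Qed.

Lemma Zp_eq0 (n : nat) : (n%:R == 0 :> A) = (p ^ m %| n)%N.
Proof. by rewrite -val_eqE /= val_Zp_nat ?prime_power_gt1. Qed.

Lemma Zp_unit_or_dvd (c : A) : (exists d, c = p%:R * d) \/ (exists u, u * c = 1).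
Proof.
case: (boolP (p %| (c : nat))%N) => [/dvdnP[k ek]|pc].
  by left; exists k%:R; rewrite -natrM mulnC -ek natr_Zp.
right; exists c^-1; apply: mulVr.
rewrite -[c]natr_Zp unitZpE ?prime_power_gt1 //.
by rewrite coprimeXl // prime_coprime.
Qed.

Lemma Zp_exact k : (k <= m)%N -> forall c : A,
  p%:R ^+ k * c = 0 <-> exists d, c = p%:R ^+ (m - k) * d.
Proof.
move=> le_km c; split=> [|[d ->]]; last first.
  rewrite mulrA -exprD subnKC // -natrX; apply/eqP.
  by rewrite (_ : _%:R = 0) ?mul0r //; apply/eqP; rewrite Zp_eq0.
rewrite -{1}[c]natr_Zp -natrX -natrM => /eqP; rewrite Zp_eq0.
rewrite -{1}(subnKC le_km) expnD dvdn_pmul2l ?expn_gt0 ?prime_gt0 //.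
by move=> /dvdnP[d ed]; exists d%:R; rewrite -natrX -natrM mulnC -ed natr_Zp.
Qed.

End PrimePowerRing.

(** * Finitely generated modules over Laurent polynomial rings *)

Section GoodModules.
Context {R : comNzRingType}.
Implicit Types N : lmodType R.

Definition good N := auslander N /\ noetherian N.

Lemma zero_projective N : zero_module N -> projective N.
Proof. by move=> N0 V W g f _; exists \0 => x; rewrite (N0 x) !linear0. Qed.

Lemma zero_finitely_generated N : zero_module N -> finitely_generated N.
Proof. by move=> N0; exists 0%N, \0 => x; exists 0; rewrite (N0 x). Qed.

Lemma zero_good N : zero_module N -> good N.
Proof.
move=> N0; split=> [|E f fi].
  by apply: auslander_Ext_zero => n; apply/Ext_projective/zero_projective.
apply: zero_finitely_generated => x; apply: fi.
by rewrite linear0; apply: N0.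
Qed.

Lemma good_extension (X Y Z : lmodType R) (i : {linear X -> Y}) (g : {linear Y -> Z}) :
  short_exact i g -> good X -> good Z -> good Y.
Proof.
move=> ig [Xa Xn] [Za Zn]; split; first exact: auslander_extension ig Xa Za.
exact: noetherian_extension ig Xn Zn.
Qed.

Lemma cyclic_finitely_generated N : cyclic N -> finitely_generated N.
Proof.
move=> [x xg]; have gl : linear (fun v : 'rV[R]_1 => v 0 0 *: x).
  by move=> a u v; rewrite !mxE scalerDl scalerA.
exists 1%N, (lin gl) => y; have [a ->] := xg y.
by exists (a%:M); rewrite /= mxE eqxx.
Qed.

(** A cyclic module killed by p either has annihilator exactly pR, so that its positive Ext modules
    vanish, or is killed by some a outside pR, the case left to the hypothesis. *)
Lemma good_devissage (p q : R) (e : nat) : p ^+ e = 0 ->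
  (forall c, p * c = 0 <-> exists d, c = q * d) ->
  (forall c, q * c = 0 <-> exists d, c = p * d) ->
  (forall N a, cyclic N -> (forall x : N, p *: x = 0) -> (forall x : N, a *: x = 0) ->
    ~ (exists d, a = p * d) -> good N) ->
  forall N, finitely_generated N -> good N.
Proof.
move=> pe annp annq Gtors; apply: (fg_devissage pe) => [|N Nc pN].
  by move=> X Y Z i g; apply: good_extension.
have [x xg] := Nc.
case: (pselect (exists2 a, a *: x = 0 & ~ exists d, a = p * d)) => [[a ax na]|nt].
  apply: (Gtors N a) => // y; have [b ->] := xg y.
  by rewrite scalerA mulrC -scalerA ax scaler0.
have annx c : c *: x = 0 <-> exists d, c = p * d.
  split=> [cx|[d ->]]; last by rewrite -scalerA pN.
  by apply: contrapT => nd; apply: nt; exists c.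
split.
  by apply: auslander_Ext_zero => n; apply: Ext_exact_pair annp annq xg annx.
(* A nonzero E contains some y sent to a x with a outside pR. The quotient of N by this multiple of
   x is killed by a, hence Noetherian by hypothesis, and E/Ry embeds in it. *)
move=> E f fi; case: (pselect (zero_module E)) => [|nE].
  exact: zero_finitely_generated.
have [y y0] : exists y : E, y <> 0.
  by apply: contrapT => ny; apply: nE => y; apply: contrapT => y0; apply: ny; exists y.
have [a ea] := xg (f y).
have na : ~ exists d, a = p * d.
  by move/annx => ax; apply: y0; apply: fi; rewrite ea ax linear0.
have [I [d [j [ds ji ej]]]] := image_ex (lin (mul_linear y)).
have sj := short_exact_coker ji.
pose c := coker_pi (f \o j).
have [k ek] : exists k : {linear coker j -> coker (f \o j)},
    forall z, k (coker_pi j z) = (c \o f) z.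
  apply: factor_surj => [|z]; first exact: coker_pi_surj.
  by move=> /coker_pi_exact[t <-]; apply/coker_pi_exact; exists t.
have kinj : injective k.
  apply: linear_eq0_inj => z'; have [z <-] := coker_pi_surj z'.
  rewrite ek => /coker_pi_exact[t /= et]; apply/coker_pi_exact.
  by exists t; apply: fi.
have cs : surjective c by apply: coker_pi_surj.
have [_ cn] : good (coker (f \o j)).
  apply: (Gtors _ a) => // [|z'|z']; first exact: cyclic_quot cs Nc.
    by have [z <-] := cs z'; rewrite -linearZ_LR pN linear0.
  have [z <-] := cs z'; rewrite -linearZ_LR; apply/coker_pi_exact.
  have [b ->] := xg z; exists (b *: d 1).
  rewrite linearZ_LR -[X in b *: X]/(f (j (d 1))) -ej /= scale1r ea !scalerA.
  by rewrite mulrC.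
apply: finitely_generated_extension sj _ (cn _ k kinj).
apply: cyclic_finitely_generated; apply: cyclic_quot ds _.
by exists 1 => b; exists b; rewrite -[RHS]/(b * 1) mulr1.
Qed.

End GoodModules.

Lemma restr_good (R' R : comNzRingType) (iota : {rmorphism R' -> R})
    (fq : frobenius_quotient iota) (N : lmodType R) :
  (forall x : N, fq_rel fq *: x = 0) -> good (restr iota N : lmodType R') -> good N.
Proof.
move=> fN [Na Nn]; split; first exact: restr_auslander fN Na.
exact: restr_noetherian Nn.
Qed.

(** * Induction on the number of variables *)

Section LaurentModules.
Context (p m : nat) (p_prime : prime p) (m_gt0 : (0 < m)%N).
Local Notation A := 'Z_(p ^ m).
Local Notation L D := (group_algebra A 'rV[int]_D).

Lemma laurent_unit_or_frobenius D (f : L D.+1) : f != 0 ->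
  (forall k, f@_k = 0 \/ exists u, u * f@_k = 1) ->
  (exists u, u * f = 1) \/
  exists (iota : {rmorphism L D -> L D.+1}) (fq : frobenius_quotient iota) b,
    fq_rel fq = b * f.
Proof.
move=> f0 fu; have [B Binj] := separating_point (enum_fset (msupp f)).
have [|u|[fq [b e]]] := @split_relation A _ _ (@weight D B) (@tail D) (@unweight D B)
  (weight_unweight B) (tail_unweight B) (unweight_tail B) f f0 fu.
- move=> k l fk fl; apply: Binj; by rewrite -mcoeff_neq0.
- by left.
by right; exists _, fq, b.
Qed.

Lemma laurent_devissage D :
  (forall (N : lmodType (L D)) (f : L D), cyclic N -> f != 0 ->
     (forall k, f@_k = 0 \/ exists u, u * f@_k = 1) ->
     (forall x : N, f *: x = 0) -> good N) ->
  forall N : lmodType (L D), finitely_generated N -> good N.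
Proof.
move=> Gf; pose P : L D := ga_const p%:R.
have P_nilp : P ^+ m = 0.
  rewrite ga_constX /ga_const -natrX (_ : _%:R = 0) ?monalgU0 //.
  by apply/eqP; rewrite Zp_eq0.
apply: (good_devissage (p := P) (q := ga_const (p%:R ^+ m.-1)) P_nilp).
- apply: ga_const_exact => c.
  by have := Zp_exact p_prime m_gt0 m_gt0 c; rewrite subn1 expr1.
- apply: ga_const_exact => c.
  have := Zp_exact p_prime m_gt0 (leq_pred m) c.
  by rewrite (_ : (m - m.-1 = 1)%N) ?expr1 //; case: (m) m_gt0 => // k _; rewrite subSnn.
move=> N a Nc pN aN na.
have [f [h [ea f0 fu]]] := ga_unit_part (Zp_unit_or_dvd p_prime m_gt0) na.
apply: (Gf N f) => // x; have := aN x.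
by rewrite ea scalerDl mulrC -scalerA pN scaler0 addr0.
Qed.

Theorem laurent_good D (N : lmodType (L D)) : finitely_generated N -> good N.
Proof.
have unit_good D' (N' : lmodType (L D')) (f u : L D') :
    u * f = 1 -> (forall x : N', f *: x = 0) -> good N'.
  move=> uf fN; apply: zero_good => x.
  by rewrite -[x]scale1r -uf -scalerA fN scaler0.
elim: D N => [|D IH] N; apply: laurent_devissage => {}N f Nc f0 fu fN.
  (* For D = 0 the group is trivial, f is a unit and N vanishes. *)
  have [|u uf] := ga_trivial_unit _ f0 fu; first by move=> k; apply/rowP; case.
  exact: unit_good uf fN.
case: (laurent_unit_or_frobenius f0 fu) => [[u uf]|[iota [fq [b e]]]].
  exact: unit_good uf fN.
have fqN (x : N) : fq_rel fq *: x = 0 by rewrite e -scalerA fN scaler0.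
apply: (restr_good fqN); apply: IH.
exact: restr_cyclic_fg Nc fqN.
Qed.

End LaurentModules.

(** * Free resolutions *)

Section Resolutions.
Context {R : comNzRingType}.
Implicit Types (M N K P W : lmodType R).

(** The resolution is given by its components because the induction passes to the shifted complex,
    which resolves the kernel of [aug]. *)
Lemma projective_exact_extend N n (F : nat -> lmodType R)
    (d : forall i, {linear F i.+1 -> F i}) M (aug : {linear F 0%N -> M}) :
  (forall i, projective (F i)) -> surjective aug -> exact_at (d 0%N) aug ->
  (forall i, exact_at (d i.+1) (d i)) -> zero_module (Ext n.+1 M N) ->
  forall u : {linear F n.+1 -> N}, (forall x, u (d n.+1 x) = 0) ->
  exists w : {linear F n -> N}, forall x, u x = w (d n x).
Proof.
elim: n F d M aug => [|n IH] F d M aug Fp augs dE dES M0 u ud.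
all: have saug := short_exact_ker augs.
all: have [c ec] : exists c : {linear F 1%N -> kernel aug},
  forall x, ker_val aug (c x) = d 0%N x.
1,3: by apply: (short_exact_ker_factor saug) => x; apply: exact_comp0 dE.
all: have cs : surjective c.
1,3: move=> y; have /dE[x ex] : aug (ker_val aug y) = 0.
1,3: by apply/ker_val_exact; exists y.
1,2: by exists x; apply: ker_val_inj; rewrite ec.
all: have cE : exact_at (d 1%N) c.
1,3: move=> y; split=> [cy|[x <-]]; last apply: ker_val_inj.
1,3: by apply/dES; rewrite -ec cy linear0.
1,2: by rewrite ec linear0; apply: exact_comp0 (dES 0%N).
  have [v ev] : exists v : {linear kernel aug -> N}, forall x, v (c x) = u x.
    by apply: factor_surj => // x /cE[y <-].
  have /hom_coker_pi_eq0[w ew] : hom_coker_pi (ker_val aug) v = 0.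
    exact: isomorphic_zero (isomorphic_sym (Ext1_hom_coker N (Fp 0%N) saug)) M0 _.
  by exists w => x; rewrite -ev ew ec.
apply: (IH (fun i => F i.+1) (fun i => d i.+1) _ c) => //.
exact: isomorphic_zero (isomorphic_sym (Ext_shift n N (Fp 0%N) saug)) M0.
Qed.

Lemma exact_surj_comp W K P M (a : {linear W -> K}) (i : {linear K -> P})
    (g : {linear P -> M}) :
  surjective a -> exact_at i g -> exact_at (i \o a) g.
Proof.
move=> as_ ig y; rewrite (ig y); split=> [[x <-]|[x <-]]; last by exists (a x).
by have [z <-] := as_ x; exists z.
Qed.

Lemma exact_comp_inj W P K M (d : {linear W -> P}) (a : {linear P -> K})
    (i : {linear K -> M}) :
  injective i -> exact_at d a -> exact_at d (i \o a).
Proof.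
move=> ii da y; rewrite -(da y) /=; split=> [ia|->]; last exact: linear0.
by apply: ii; rewrite ia linear0.
Qed.

Section Splice.
Context {K P M : lmodType R} (i : {linear K -> P}) (g : {linear P -> M}).
Context (ig : short_exact i g) (F : resolution K).

Definition splice_obj (n : nat) : lmodType R := if n is n'.+1 then F n' else P.

Definition splice_d (n : nat) : {linear splice_obj n.+1 -> splice_obj n} :=
  if n is n'.+1 return {linear splice_obj n.+1 -> splice_obj n}
  then res_d F n' else i \o res_aug F.

Lemma splice_exact0 : exact_at (splice_d 0) g.
Proof. by have [_ ie _] := ig; apply: exact_surj_comp (res_aug_surj F) ie. Qed.

Lemma splice_exactS n : exact_at (splice_d n.+1) (splice_d n).
Proof.
have [ii _ _] := ig; case: n => [|n]; last exact: res_exactS.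
exact: (@exact_comp_inj _ _ _ _ (res_d F 0) (res_aug F) i ii (@res_exact0 _ _ F)).
Qed.

Lemma splice_surj : surjective g.
Proof. by case: ig. Qed.

Definition splice : resolution M :=
  @Resolution R M splice_obj splice_d g splice_surj splice_exact0 splice_exactS.

End Splice.

Lemma zero_resolution_exact : exact_at (\0 : {linear 'rV[R]_0 -> 'rV[R]_0})
  (\0 : {linear 'rV[R]_0 -> 'rV[R]_0}).
Proof. by move=> y; split=> // _; exists 0; apply/rowP; case. Qed.

Lemma zero_resolution_surj : surjective (\0 : {linear 'rV[R]_0 -> 'rV[R]_0}).
Proof. by move=> y; exists 0; apply/rowP; case. Qed.

Definition zero_resolution : resolution ('rV[R]_0 : lmodType R) :=
  @Resolution R 'rV[R]_0 (fun=> 'rV[R]_0) (fun=> \0) \0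
    zero_resolution_surj zero_resolution_exact (fun=> zero_resolution_exact).

Lemma splice_free K P M (i : {linear K -> P}) (g : {linear P -> M}) n :
  short_exact i g -> free_module P ->
  (exists F : resolution K, (forall l, free_module (F l)) /\ length_le F n) ->
  exists F : resolution M, (forall l, free_module (F l)) /\ length_le F n.+1.
Proof.
move=> ig Pf [F [Ff Fn]]; exists (splice ig F).
split=> [[|l]|[|l] ltl] //; first exact: Ff.
exact: Fn.
Qed.

Lemma free_resolution0 M : free_module M ->
  exists F : resolution M, (forall l, free_module (F l)) /\ length_le F 0.
Proof.
move=> Mf; have V0 : zero_module 'rV[R]_0 by move=> x; apply/rowP; case.
have ig : short_exact (\0 : {linear 'rV[R]_0 -> M}) idfun.
  split; [by move=> x y _; rewrite (V0 x) (V0 y) | move=> y | by move=> y; exists y].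
  by split=> [/= ->|[x <-]] //; exists 0.
exists (splice ig zero_resolution).
by split=> [[|l]|[|l] ltl] //; exists 'I_0; apply: row_free_module.
Qed.

(** * Resolutions by finite free modules over a Noetherian ring *)

Section FiniteFreeResolution.
Hypothesis noeth : forall M, finitely_generated M -> noetherian M.

Definition cover_rank M (Mfg : finitely_generated M) : nat := projT1 (cid Mfg).

Definition cover_map M (Mfg : finitely_generated M) :
  {linear 'rV[R]_(cover_rank Mfg) -> M} := projT1 (cid (projT2 (cid Mfg))).

Lemma cover_map_surj M (Mfg : finitely_generated M) : surjective (cover_map Mfg).
Proof. exact: (projT2 (cid (projT2 (cid Mfg)))). Qed.

Lemma cover_kernel_fg M (Mfg : finitely_generated M) :
  finitely_generated (kernel (cover_map Mfg)).
Proof.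
apply: (noeth (M := 'rV[R]_(cover_rank Mfg))) (@ker_val_inj _ _ _ (cover_map Mfg)).
by exists (cover_rank Mfg), idfun => x; exists x.
Qed.

Context (E : lmodType R) (Efg : finitely_generated E).

(** Each syzygy carries its finite generation, from which the next cover is chosen. *)
Fixpoint ff_syzygy (n : nat) : {M : lmodType R | finitely_generated M} :=
  if n is n'.+1 then
    exist _ (kernel (cover_map (projT2 (ff_syzygy n'))))
      (cover_kernel_fg (projT2 (ff_syzygy n')))
  else exist _ E Efg.

Definition ff_obj n : lmodType R := 'rV[R]_(cover_rank (projT2 (ff_syzygy n))).

Definition ff_cover n : {linear ff_obj n -> projT1 (ff_syzygy n)} :=
  cover_map (projT2 (ff_syzygy n)).

Definition ff_d n : {linear ff_obj n.+1 -> ff_obj n} :=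
  ker_val (ff_cover n) \o ff_cover n.+1.

Lemma ff_cover_surj n : surjective (ff_cover n).
Proof. exact: (cover_map_surj (projT2 (ff_syzygy n))). Qed.

Lemma ff_exact n : exact_at (ff_d n) (ff_cover n).
Proof.
apply: exact_surj_comp (@ker_val_exact _ _ _ (ff_cover n)).
exact: ff_cover_surj.
Qed.

Lemma ff_exactS n : exact_at (ff_d n.+1) (ff_d n).
Proof.
exact: (@exact_comp_inj _ _ _ _ (ff_d n.+1) (ff_cover n.+1) (ker_val (ff_cover n))
  (@ker_val_inj _ _ _ (ff_cover n)) (@ff_exact n.+1)).
Qed.

Lemma finite_free_resolution_ex :
  exists F : resolution E, forall i, finite_free (F i).
Proof.
exists (@Resolution R E ff_obj ff_d
  (ff_cover 0) (@ff_cover_surj 0) (@ff_exact 0) ff_exactS).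
by move=> n; exists (cover_rank (projT2 (ff_syzygy n))); apply: isomorphic_refl.
Qed.

End FiniteFreeResolution.

Lemma ltn_inf_natP n (P : nat -> Prop) :
  ltn_inf n (inf_nat P) <-> forall i, (i <= n)%N -> ~ P i.
Proof.
rewrite /inf_nat; case: pselect => [ex|nex] /=; last first.
  by split=> // _ i _ Pi; apply: nex; exists i; apply/asboolP.
case: ex_minnP => k /asboolP Pk kmin; split=> [ltnk i lein Pi|nP].
  have := kmin i; rewrite asboolT // => /(_ isT) leki.
  by have := leq_trans ltnk (leq_trans leki lein); rewrite ltnn.
by rewrite ltnNge; apply/negP => /nP.
Qed.

Lemma inf_natP n (P : nat -> Prop) :
  P n -> (forall i, (i < n)%N -> ~ P i) -> inf_nat P = Some n.
Proof.
move=> Pn nP; rewrite /inf_nat; case: pselect => [ex|nex]; last first.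
  by case: nex; exists n; apply/asboolP.
congr Some; case: ex_minnP => k /asboolP Pk kmin; apply/eqP.
rewrite eqn_leq kmin ?asboolT //= leqNgt; apply/negP => /nP; exact.
Qed.

Lemma ltn_gradeP n M : ltn_inf n (grade M) <-> grade_ge n.+1 M.
Proof.
rewrite ltn_inf_natP; split=> M0 i lei; last by case; apply: M0.
by apply: contrapT; apply: M0.
Qed.

End Resolutions.

(** * Conjugate duals *)

Section Conjugation.
Context {R : invRingType}.
Implicit Types (U V M N K P : lmodType R).

Definition conj_map U V (f : {linear U -> V}) :
  {linear conj_module U -> conj_module V} := twist_map bar f.

Lemma conj_scale M a (x : M) : a *: (x : conj_module M) = bar a *: x.
Proof. by []. Qed.

Lemma conj_short_exact K P M (i : {linear K -> P}) (g : {linear P -> M}) :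
  short_exact i g -> short_exact (conj_map i) (conj_map g).
Proof. by []. Qed.

Lemma conj_projective M : projective M -> projective (conj_module M).
Proof.
move=> Mp V W g u gs.
have cul : linear ((u : conj_module M -> W) : M -> conj_module W).
  move=> a x y; rewrite conj_scale -linearP; congr (u _); congr (_ + _).
  by rewrite conj_scale barK.
have [h hE] := Mp _ _ (conj_map g) (lin cul) gs.
have hl : linear ((h : M -> conj_module V) : conj_module M -> V).
  move=> a x y; rewrite conj_scale; apply: etrans (linearP h _ _ _) _.
  by congr (_ + _); rewrite conj_scale barK.
by exists (lin hl).
Qed.

Lemma conj_finitely_generated M : finitely_generated M ->
  finitely_generated (conj_module M).
Proof.
move=> [n [f fs]]; exists n.
have gl : linear (fun v : 'rV[R]_n => f (map_mx bar v) : conj_module M).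
  move=> a u v; rewrite map_mxD map_mxZ; exact: linearP.
exists (lin gl) => x; have [v <-] := fs x; exists (map_mx bar v).
by rewrite /= -map_mx_comp map_mx_id // => a /=; rewrite barK.
Qed.

(** Composing with [bar] turns elements of [dagger M] into ordinary functionals on M; this is how
    Ext of the untwisted E governs the conjugate dual of its resolution. *)
Lemma bar_linear M (u : {linear conj_module M -> R^o}) :
  linear (fun x : M => bar (u x) : R^o).
Proof.
move=> a x y; have -> : a *: x = bar a *: (x : conj_module M) by rewrite conj_scale barK.
by rewrite linearP rmorphD; congr (_ + _); rewrite [LHS]rmorphM barK.
Qed.

Lemma unbar_linear M (u : {linear M -> R^o}) :
  linear (fun x : conj_module M => bar (u x) : R^o).
Proof.
move=> a x y; rewrite conj_scale linearP rmorphD; congr (_ + _).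
by rewrite [LHS]rmorphM barK.
Qed.

Lemma conj_linear_sum M (u : {linear conj_module M -> R^o}) (I : Type) (r : seq I)
    (F : I -> R) (G : I -> M) :
  u (\sum_(i <- r) F i *: G i) = \sum_(i <- r) bar (F i) * u (G i).
Proof.
elim: r => [|i r IH]; first by rewrite !big_nil; apply: (linear0 u).
rewrite !big_cons -IH -[F i in LHS]barK.
exact: (linearP u (bar (F i)) (G i)).
Qed.

Section FiniteFree.
Context (M : lmodType R) (n : nat) (f : {linear 'rV[R]_n -> M})
  (g : {linear M -> 'rV[R]_n}) (fK : cancel f g) (gK : cancel g f).

Lemma dual_coord_linear (v : 'rV[R]_n) :
  linear (fun x : conj_module M => \sum_i v 0 i * bar (g x 0 i) : R^o).
Proof.
move=> a x y; rewrite scaler_sumr -big_split; apply: eq_bigr => i _ /=.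
rewrite conj_scale linearP !mxE rmorphD rmorphM barK mulrDr.
by congr (_ + _); rewrite mulrCA.
Qed.

Definition dual_coord (v : 'rV[R]_n) : dagger M := to_hom (lin (dual_coord_linear v)).

Lemma dual_coordE v (x : M) : dual_coord v x = \sum_i v 0 i * bar (g x 0 i).
Proof. by []. Qed.

Lemma dual_coord_is_linear : linear dual_coord.
Proof.
move=> a u v; apply/val_inj/funext => x.
rewrite -[RHS]/(a * dual_coord u x + dual_coord v x) !dual_coordE.
rewrite mulr_sumr -big_split; apply: eq_bigr => i _ /=.
by rewrite !mxE mulrDl mulrA.
Qed.

Lemma dual_coord_basis v j : dual_coord v (f (delta_mx 0 j)) = v 0 j.
Proof.
rewrite dual_coordE fK (bigD1 j) //= mxE !eqxx rmorph1 mulr1 big1 ?addr0 // => i ij.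
by rewrite mxE (negPf ij) andbF rmorph0 mulr0.
Qed.

Lemma dual_coord_eval (phi : dagger M) :
  phi = dual_coord (\row_i phi (f (delta_mx 0 i))).
Proof.
apply/val_inj/funext => x; rewrite -[RHS]/(dual_coord _ x) dual_coordE.
rewrite -[in LHS](gK x) [in LHS](row_sum_delta (g x)) linear_sum.
under eq_bigr => i _ do rewrite linearZ_LR.
rewrite [LHS](conj_linear_sum (hom_val phi)).
by apply: eq_bigr => i _; rewrite mxE mulrC.
Qed.

Lemma dagger_finite_free_basis : isomorphic 'rV[R]_n (dagger M).
Proof.
exists (lin dual_coord_is_linear); apply: bijP.
  apply: linear_eq0_inj => v v0; apply/rowP => j.
  by rewrite mxE -(dual_coord_basis v j) -[dual_coord v]/(lin dual_coord_is_linear v) v0.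
by move=> phi; exists (\row_i phi (f (delta_mx 0 i))); rewrite [RHS]dual_coord_eval.
Qed.

Lemma bidual_inj_basis : injective (bidual (M := M)).
Proof.
apply: linear_eq0_inj => x x0; rewrite -(gK x); suff -> : g x = 0 by rewrite linear0.
apply/rowP => j; rewrite mxE.
have /(congr1 (fun h : dagger (dagger M) => h (dual_coord (delta_mx 0 j)))) := x0.
rewrite -[LHS]/(bar (dual_coord (delta_mx 0 j) x)) dual_coordE (bigD1 j) //=.
rewrite mxE !eqxx mul1r big1 ?addr0 ?barK // => i ij.
by rewrite mxE (negPf ij) andbF mul0r.
Qed.

Lemma bidual_surj_basis : surjective (bidual (M := M)).
Proof.
move=> F; pose v : 'rV[R]_n := \row_i F (dual_coord (delta_mx 0 i)).
exists (f v); apply/val_inj/funext => phi.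
rewrite -[LHS]/(bar ((phi : dagger M) (f v))).
rewrite (dual_coord_eval phi); move: (\row_i _) => u.
rewrite dual_coordE fK rmorph_sum.
have -> : dual_coord u = \sum_i u 0 i *: dual_coord (delta_mx 0 i).
  rewrite -[LHS]/(lin dual_coord_is_linear u) [in LHS](row_sum_delta u).
  rewrite [LHS]linear_sum; apply: eq_bigr => i _.
  by rewrite [LHS]linearZ_LR.
rewrite [RHS](conj_linear_sum (hom_val F)).
by apply: eq_bigr => i _; rewrite mxE rmorphM barK.
Qed.
End FiniteFree.

Lemma finite_free_coordinates M : finite_free M ->
  exists n (f : {linear 'rV[R]_n -> M}) (g : {linear M -> 'rV[R]_n}),
    cancel f g /\ cancel g f.
Proof.
move=> [n [f [g fK gK]]]; have gl : linear g.
  by move=> a x y; apply: (can_inj fK); rewrite linearP !gK.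
by exists n, f, (lin gl).
Qed.

Lemma dagger_finite_free M : finite_free M -> finite_free (dagger M).
Proof.
move=> /finite_free_coordinates[n [f [g [fK gK]]]]; exists n.
exact: dagger_finite_free_basis fK gK.
Qed.

Lemma bidual_inj M : finite_free M -> injective (bidual (M := M)).
Proof.
by move=> /finite_free_coordinates[n [f [g [fK gK]]]]; apply: bidual_inj_basis gK.
Qed.

Lemma bidual_surj M : finite_free M -> surjective (bidual (M := M)).
Proof.
by move=> /finite_free_coordinates[n [f [g [fK gK]]]]; apply: bidual_surj_basis fK gK.
Qed.

Lemma dagger_bidual U V (h : {linear U -> V}) (x : U) :
  dagger_map (dagger_map h) (bidual x) = bidual (h x).
Proof. exact/val_inj/funext. Qed.

Lemma dagger_comp_bidual U V (h : {linear U -> V}) (phi : dagger V) :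
  dagger_map (bidual \o h) (bidual phi) = dagger_map h phi.
Proof. by apply/val_inj/funext => x; rewrite -[LHS]/(bar (bar (phi (h x)))) barK. Qed.

End Conjugation.

(** * Codes *)

Section Codes.
Context {R : invRingType}.
Hypothesis fg_good : forall M : lmodType R, finitely_generated M -> good M.
Implicit Types (U V M N K P E : lmodType R).

(* C := coker phiX embeds in the free module GZ^dagger, so that Ext^l(C) is
   Ext^(l+1) of the quotient. *)
Lemma charge_module_grade (GX P GZ : lmodType R) (phiX : {linear GX -> P})
    (phiZ : {linear GZ -> dagger P}) l :
  topological_css_code phiX phiZ ->
  submodules_grade_ge l.+2 (charge_module phiX l.+1).
Proof.
move=> [[_ _ GZf _] [exX _]].
pose psi : {linear P -> dagger GZ} := dagger_map phiZ \o bidual.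
have [j ej] : exists j : {linear coker phiX -> dagger GZ},
    forall x, j (coker_pi phiX x) = psi x.
  apply: factor_surj => [|x /coker_pi_exact]; first exact: coker_pi_surj.
  by move/exX.
have ji : injective j.
  apply: linear_eq0_inj => y; have [x <-] := coker_pi_surj y.
  by rewrite ej => /exX/coker_pi_exact.
have sj := conj_short_exact (short_exact_coker ji).
have Df := dagger_finite_free GZf.
have Dp := conj_projective (finite_free_projective Df).
have Qfg : finitely_generated (conj_module (coker j)).
  apply: conj_finitely_generated; apply: finitely_generated_quot (finite_free_fg Df).
  exact: (@coker_pi_surj _ _ _ j).
(* Degree l + 1 of the cokernel is degree l + 2 of Q, so the Auslander bound l + 2 is strict for the
   layer l + 1. *)
have [Qa _] := fg_good Qfg.
apply: (serre_iso (submodules_grade_ge_serre _) _ (Qa l.+2)).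
exact: isomorphic_sym (Ext_shift l R^o Dp sj).
Qed.

(** * The code obtained by dualizing a free resolution *)

Section Realization.
Context (E : lmodType R) (k : nat) (E_grade : grade_ge k.+2 E).
Context (G : resolution E) (Gf : forall i, finite_free (G i)).

Let Gp i : projective (G i) := finite_free_projective (Gf i).

(** A functional on [G 0] that vanishes on boundaries descends to E, and Hom(E, R) = 0. *)
Lemma dagger_resolution_inj : injective (dagger_map (res_d G 0)).
Proof.
apply: linear_eq0_inj => u u0.
have [v ev] : exists v : {linear E -> R^o},
    forall x, v (res_aug G x) = lin (bar_linear (hom_val u)) x.
  apply: factor_surj => [|x]; first exact: res_aug_surj.
  move=> /res_exact0[y <-]; rewrite -[LHS]/(bar (dagger_map (res_d G 0) u y)) u0.
  exact: rmorph0.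
have v0 := (Ext0_eq0 E R^o).1 (E_grade (ltn0Sn _)) v.
apply/val_inj/funext => x; rewrite -[LHS](barK (u x)).
by have := ev x; rewrite v0 -[in X in X -> _]/(bar (u x)) => /= <-; rewrite rmorph0.
Qed.

Lemma dagger_resolution_exact i : (i <= k)%N ->
  exact_at (dagger_map (res_d G i)) (dagger_map (res_d G i.+1)).
Proof.
move=> leik u; split=> [u0|[w <-]]; last first.
  apply/val_inj/funext => x; rewrite -[LHS]/(w (res_d G i (res_d G i.+1 x))).
  have -> : res_d G i (res_d G i.+1 x) = 0 by apply/res_exactS; exists x.
  exact: (linear0 (hom_val w)).
have ud x : lin (bar_linear (hom_val u)) (res_d G i.+1 x) = 0.
  rewrite -[LHS]/(bar (dagger_map (res_d G i.+1) u x)) u0; exact: rmorph0.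
have [w ew] := projective_exact_extend Gp (@res_aug_surj _ _ G) (@res_exact0 _ _ G)
  (@res_exactS _ _ G) (E_grade (i := i.+1) leik) ud.
exists (to_hom (lin (unbar_linear w))); apply/val_inj/funext => x.
by rewrite -[LHS]/(bar (w (res_d G i x))) -ew -[LHS]/(bar (bar (u x))) barK.
Qed.

(** The cosyzygies C_j of the dualized resolution; C_0 is the cokernel of 0 -> G_0^+, and C_(k+1) is
    the cokernel of phiX. *)
Definition dual_cokernel (j : nat) : lmodType R :=
  if j is j'.+1 then coker (dagger_map (res_d G j')) else dagger (G 0).

Definition dual_cokernel_pi (j : nat) : {linear dagger (G j) -> dual_cokernel j} :=
  if j is j'.+1 return {linear dagger (G j) -> dual_cokernel j}
  then coker_pi (dagger_map (res_d G j')) else idfun.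

Lemma dual_cokernel_pi_surj j : surjective (dual_cokernel_pi j).
Proof. by case: j => [y|j]; [exists y | apply: coker_pi_surj]. Qed.

(** Exactness of the dualized resolution at G_j^+ identifies C_j with its image in G_(j+1)^+, giving
    0 -> C_j -> G_(j+1)^+ -> C_(j+1) -> 0. All Ext computations below shift along these
    sequences. *)
Lemma dual_cokernel_embed j : (j <= k)%N ->
  exists i : {linear dual_cokernel j -> dagger (G j.+1)},
    short_exact i (coker_pi (dagger_map (res_d G j))) /\
    forall x, i (dual_cokernel_pi j x) = dagger_map (res_d G j) x.
Proof.
move=> lejk; have kerE x : dual_cokernel_pi j x = 0 <-> dagger_map (res_d G j) x = 0.
  case: j lejk x => [|j] lejk x.
    split=> [e|e]; first by rewrite (_ : x = 0) ?linear0 //; apply: e.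
    by apply: dagger_resolution_inj; rewrite e linear0.
  by rewrite (dagger_resolution_exact (ltnW lejk)) -coker_pi_exact.
have [i ei] : exists i : {linear dual_cokernel j -> dagger (G j.+1)},
    forall x, i (dual_cokernel_pi j x) = dagger_map (res_d G j) x.
  by apply: factor_surj => [|x /kerE]; first exact: dual_cokernel_pi_surj.
exists i; split=> //; split.
- apply: linear_eq0_inj => y; have [x <-] := @dual_cokernel_pi_surj j y.
  by rewrite ei => /kerE.
- move=> y; rewrite (@coker_pi_exact _ _ _ (dagger_map (res_d G j)) y); split=> [[x <-]|[z <-]].
    by exists (dual_cokernel_pi j x).
  by have [x <-] := @dual_cokernel_pi_surj j z; exists x.
- exact: coker_pi_surj.
Qed.

Lemma dual_cokernel_free_resolution j : (j <= k.+1)%N ->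
  exists F : resolution (dual_cokernel j),
    (forall i, free_module (F i)) /\ length_le F j.
Proof.
elim: j => [|j IH] lej.
  exact/free_resolution0/finite_free_free/dagger_finite_free.
have [i [si _]] := dual_cokernel_embed lej.
apply: splice_free si _ (IH (ltnW lej)).
exact/finite_free_free/dagger_finite_free.
Qed.

Let dagger_proj i : projective (conj_module (dagger (G i))).
Proof. exact/conj_projective/finite_free_projective/dagger_finite_free. Qed.

Lemma dual_cokernel_Ext_shift j l : (j <= k)%N ->
  isomorphic (Ext l.+1 (conj_module (dual_cokernel j)) R^o)
             (Ext l.+2 (conj_module (dual_cokernel j.+1)) R^o).
Proof.
move=> lej; have [i [si _]] := dual_cokernel_embed lej.
exact: Ext_shift (@dagger_proj _) (conj_short_exact si).
Qed.

Lemma dual_cokernel_Ext_high j l : (j <= k.+1)%N ->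
  zero_module (Ext (j + l).+1 (conj_module (dual_cokernel j)) R^o).
Proof.
elim: j => [|j IH] lej; first exact: Ext_projective (@dagger_proj 0).
exact: isomorphic_zero (dual_cokernel_Ext_shift (j + l) lej) (IH (ltnW lej)).
Qed.

Lemma bidual_composition j (u : {linear conj_module (dual_cokernel j) -> R^o}) :
  exists x : G j, forall phi, u (dual_cokernel_pi j phi) = bidual x phi.
Proof.
have [x ex] := bidual_surj (Gf j) (to_hom (u \o conj_map (dual_cokernel_pi j))).
by exists x => phi; rewrite ex.
Qed.

(** A functional on C_(j+1) is evaluation at some x in G_(j+1), and vanishing on the image of G_j^+
    means that x is a cycle. Then x is the boundary of some y, and evaluation at y extends the
    functional to G_(j+2)^+. *)
Lemma dual_cokernel_Ext1_zero j : (j.+1 <= k)%N ->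
  zero_module (Ext 1 (conj_module (dual_cokernel j.+2)) R^o).
Proof.
move=> lej; have [i [si ei]] := dual_cokernel_embed lej.
apply: isomorphic_zero (Ext1_hom_coker R^o (@dagger_proj _) (conj_short_exact si)) _ => e.
have [u <-] := hom_coker_pi_surj e; apply/hom_coker_pi_eq0.
have [x ex] := bidual_composition u.
have : res_d G j x = 0.
  apply: (bidual_inj (Gf j)); rewrite linear0; apply/val_inj/funext => phi.
  rewrite -[LHS]/(bidual x (dagger_map (res_d G j) phi)) -ex.
  have -> : dual_cokernel_pi j.+1 (dagger_map (res_d G j) phi) = 0.
    by apply/coker_pi_exact; exists phi.
  exact: (linear0 u).
move=> /res_exactS[y ey]; exists (hom_val (bidual y)) => z.
have [phi <-] := @dual_cokernel_pi_surj j.+1 z.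
by rewrite ex -[RHS]/(bidual y (i (dual_cokernel_pi j.+1 phi))) ei -ey.
Qed.

(** Here C_0 = G_0^+, so no cycle condition arises: functionals are the elements of G_0, those that
    extend to G_1^+ are the boundaries, and the quotient is E. *)
Lemma dual_cokernel_Ext1 : isomorphic (Ext 1 (conj_module (dual_cokernel 1)) R^o) E.
Proof.
have [i [si ei]] := dual_cokernel_embed (leq0n k).
apply: isomorphic_trans (isomorphic_sym
  (Ext1_hom_coker R^o (@dagger_proj _) (conj_short_exact si))) _.
apply: isomorphic_sym.
have e0 x : coker_pi (precomp (conj_map i) R^o) (bidual x) = 0 <->
    res_aug G x = 0.
  rewrite coker_pi_exact res_exact0; split=> [[w ew]|[y <-]].
    have [y ey] := bidual_surj (Gf 1) w; exists y.
    apply: (bidual_inj (Gf 0)); rewrite -ew -ey; apply/val_inj/funext => phi.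
    by rewrite -[RHS]/(bidual y (i (dual_cokernel_pi 0 phi))) ei.
  exists (bidual y); apply/val_inj/funext => phi.
  by rewrite -[LHS]/(bidual y (i (dual_cokernel_pi 0 phi))) ei.
have [h eh] : exists h : {linear E -> hom_coker (conj_map i) R^o},
    forall x, h (res_aug G x) = (coker_pi (precomp (conj_map i) R^o) \o bidual) x.
  by apply: factor_surj => [|x /e0]; first exact: res_aug_surj.
exists h; apply: bijP.
  apply: linear_eq0_inj => y; have [x <-] := @res_aug_surj _ _ G y.
  by rewrite eh => /e0.
move=> e; have [u <-] := @coker_pi_surj _ _ _ (precomp (conj_map i) R^o) e.
have [x <-] := bidual_surj (Gf 0) u.
by exists (res_aug G x); rewrite eh.
Qed.

Lemma dual_cokernel_Ext j : (j <= k)%N ->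
  isomorphic (Ext j.+1 (conj_module (dual_cokernel j.+1)) R^o) E /\
  forall l, l <> j -> zero_module (Ext l.+1 (conj_module (dual_cokernel j.+1)) R^o).
Proof.
elim: j => [|j IH] lej.
  split=> [|[|l] // _]; first exact: dual_cokernel_Ext1.
  exact: (@dual_cokernel_Ext_high 1 l).
have [IHj IHl] := IH (ltnW lej); split.
  exact: isomorphic_trans (isomorphic_sym (dual_cokernel_Ext_shift j lej)) IHj.
case=> [_|l nl]; first exact: dual_cokernel_Ext1_zero.
apply: isomorphic_zero (dual_cokernel_Ext_shift l lej) (IHl l _).
by move=> e; apply: nl; rewrite e.
Qed.

(** With P = G_(k+1)^+, the dual of P is the bidual of G_(k+1), reached through [bidual]. The two
    exactness conditions are exactness of the dualized resolution at G_(k+1)^+ and of G at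
    G_(k+1). *)
Lemma resolution_realizes :
  realizes (dagger_map (res_d G k)) (bidual \o res_d G k.+1) E k.+1.
Proof.
have [EE E0] := dual_cokernel_Ext (leqnn k).
split=> //; last first.
  by case=> // l _ nl; apply: E0 => e; apply: nl; rewrite e.
have dd x : res_d G k (res_d G k.+1 x) = 0 by apply/res_exactS; exists x.
split; first split.
- exact: dagger_finite_free.
- exact: dagger_finite_free.
- exact: Gf.
- by move=> z; rewrite [LHS]dagger_bidual dd linear0.
split.
- move=> u; rewrite -(dagger_resolution_exact (leqnn k) u).
  by rewrite -[X in X = 0 <-> _]/(dagger_map _ (bidual u)) dagger_comp_bidual.
- move=> y; have [x <-] := bidual_surj (Gf k.+1) y; rewrite dagger_bidual.
  split=> [e|[z ez]].
    have /res_exactS[z <-] : res_d G k x = 0.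
      by apply: (bidual_inj (Gf k)); rewrite e linear0.
    by exists z.
  by rewrite -(bidual_inj (Gf k.+1) ez) dd linear0.
Qed.

Lemma Ext_proj_dim n (F : nat -> lmodType R) (d : forall i, {linear F i.+1 -> F i})
    M (aug : {linear F 0%N -> M}) l :
  (forall i, projective (F i)) -> surjective aug -> exact_at (d 0%N) aug ->
  (forall i, exact_at (d i.+1) (d i)) -> (forall i, (n < i)%N -> zero_module (F i)) ->
  zero_module (Ext (n + l).+1 (conj_module M) R^o).
Proof.
elim: n F d M aug => [|n IH] F d M aug Fp augs dE dES Fn.
  apply: Ext_projective; apply: conj_projective; apply: projective_iso (Fp 0%N).
  exists aug; apply: bijP augs; apply: linear_eq0_inj => x /dE[y <-].
  by rewrite (Fn 1%N isT y) linear0.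
have saug := short_exact_ker augs.
have [c ec] : exists c : {linear F 1%N -> kernel aug},
    forall x, ker_val aug (c x) = d 0%N x.
  by apply: (short_exact_ker_factor saug) => x; apply: exact_comp0 dE.
have cs : surjective c.
  move=> y; have /dE[x ex] : aug (ker_val aug y) = 0.
    by apply/ker_val_exact; exists y.
  by exists x; apply: ker_val_inj; rewrite ec.
have cE : exact_at (d 1%N) c.
  move=> y; split=> [cy|[x <-]]; last apply: ker_val_inj.
    by apply/dES; rewrite -ec cy linear0.
  by rewrite ec linear0; apply: exact_comp0 (dES 0%N).
apply: isomorphic_zero (Ext_shift (n + l) R^o (conj_projective (Fp 0%N))
  (conj_short_exact saug)) _.
apply: (IH (fun i => F i.+1) (fun i => d i.+1) _ c) => // i lti.
exact: Fn.
Qed.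

(** A projective resolution of length n <= k would annihilate Ext^(k+1) of the conjugate cokernel,
    which is E; the vanishing bound is taken at [l] = k - n. *)
Lemma resolution_proj_dim : ~ zero_module E ->
  proj_dim (coker (dagger_map (res_d G k))) = Some k.+1.
Proof.
move=> nE; apply: inf_natP.
  have [F [Ff Fl]] := dual_cokernel_free_resolution (leqnn k.+1).
  by exists F; split=> // i; apply: free_projective.
move=> n; rewrite ltnS => len [F [Fp Fl]]; apply: nE.
have [EE _] := dual_cokernel_Ext (leqnn k); apply: isomorphic_zero EE _.
have := Ext_proj_dim (l := (k - n)%N) Fp (@res_aug_surj _ _ F) (@res_exact0 _ _ F)
  (@res_exactS _ _ F) Fl.
by rewrite subnKC.
Qed.

End Realization.

Lemma realizable_grade E j : realizable E j.+1 -> ltn_inf j.+1 (grade E).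
Proof.
move=> [GX [P [GZ [phiX [phiZ [code EE _]]]]]]; apply/ltn_gradeP.
apply/submodules_grade_ge_self/(serre_iso (submodules_grade_ge_serre _) EE).
exact: charge_module_grade code.
Qed.

Lemma grade_realizable E j : finitely_generated E ->
  ltn_inf j.+1 (grade E) -> realizable E j.+1.
Proof.
move=> Efg /ltn_gradeP E_grade.
have [|G Gf] := @finite_free_resolution_ex R _ E Efg.
  by move=> M Mfg; have [] := fg_good Mfg.
exists (dagger (G j)), (dagger (G j.+1)), (G j.+2).
exists (dagger_map (res_d G j)), (bidual \o res_d G j.+1).
exact: resolution_realizes.
Qed.

End Codes.

Theorem proposition4 (p m D : nat) (p_prime : prime p) (m_gt0 : (0 < m)%N) :
  [/\ (* (1) *)
      forall (GX P GZ : lmodType (laurent p m D))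
             (phiX : {linear GX -> P}) (phiZ : {linear GZ -> dagger P}),
        topological_css_code phiX phiZ ->
        forall l : nat, (0 < l)%N -> ltn_inf l (grade (charge_module phiX l)),

      (* (2) *)
      forall (E : lmodType (laurent p m D)) (j : nat),
        finitely_generated E -> (0 < j)%N ->
        (realizable E j <-> ltn_inf j (grade E))

    & (* (3), with j = k + 1 *)
      forall (E : lmodType (laurent p m D)) (k : nat),
        finitely_generated E -> ltn_inf k.+1 (grade E) ->
        forall G : resolution E, (forall i, finite_free (G i)) ->
        let phiX : {linear dagger (G k) -> dagger (G k.+1)} :=
          dagger_map (res_d G k) in
        let phiZ : {linear G k.+2 -> dagger (dagger (G k.+1))} :=
          bidual \o res_d G k.+1 in
        [/\ realizes phiX phiZ E k.+1,
            exists F : resolution (coker phiX),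
              (forall i, free_module (F i)) /\ length_le F k.+1
          & ~ zero_module E -> proj_dim (coker phiX) = Some k.+1]].
Proof.
have fg_good (M : lmodType (laurent p m D)) : finitely_generated M -> good M.
  exact: laurent_good p_prime m_gt0 D M.
split.
- move=> GX P GZ phiX phiZ code [//|l] _; apply/ltn_gradeP.
  exact/submodules_grade_ge_self/(charge_module_grade fg_good code).
- move=> E [//|j] Efg _; split; first exact: realizable_grade.
  exact: grade_realizable.
move=> E k Efg /ltn_gradeP E_grade G Gf phiX phiZ; split.
- exact: resolution_realizes.
- exact: (dual_cokernel_free_resolution E_grade Gf (leqnn k.+1)).
- exact: resolution_proj_dim.
Qed.
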